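(* There exist a nonzero unital, separable, nuclear $C^*$-algebra $A$, a free coaction $\delta: A \to A \otimes \mathcal{C}(\mathbb{S}^1)$ of the compact quantum group $(\mathcal{C}(\mathbb{S}^1),\Delta)$ on $A$, and a $(\Delta,\delta_\Delta)$-equivariant unital $*$-homomorphism $\mathcal{C}(\mathbb{S}^1) \to A \circledast_\delta \mathcal{C}(\mathbb{S}^1)$.
   Context: $\otimes$ denotes the minimal tensor product of $C^*$-algebras. $\mathcal{C}(\mathbb{S}^1)$ is a compact quantum group with comultiplication $\Delta(f)(g,h)=f(gh)$ under $\mathcal{C}(\mathbb{S}^1)\otimes\mathcal{C}(\mathbb{S}^1)\cong\mathcal{C}(\mathbb{S}^1\times \mathbb{S}^1)$. A coaction of a compact quantum group $(H,\Delta)$ on a unital $C^*$-algebra $A$ is an injective unital $*$-homomorphism $\delta:A\to A\otimes H$ with $(\delta\otimes\mathrm{id})\circ\delta=(\mathrm{id}\otimes\Delta)\circ\delta$ and with the linear span of $\delta(A)(1\otimes H)$ dense in $A\otimes H$. (For $H=\mathcal{C}(G)$ this is the same as a point-norm continuous action of $G$ by automorphisms, via $\delta(a)(g)=g\triangleright a$ in $A\otimes\mathcal{C}(G)\cong\mathcal{C}(G,A)$.) It is free if the set of finite sums $\sum_i (a_i \otimes 1)\delta(b_i)$, with $a_i, b_i \in A$, is dense in $A \otimes H$. The equivariant noncommutative join of $A$ and $H$ is $$A \circledast_\delta H = \{f \in \mathcal{C}([0,1], A\otimes H) : f(0)\in \mathbb{C} \otimes H,\ f(1)\in \delta(A)\}.$$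 It carries a coaction $\delta_\Delta$ of $(H,\Delta)$ given by applying $\mathrm{id}_A\otimes\Delta$ at each $t\in[0,1]$. For $C^*$-algebras $A,B$ with coactions $\delta_A,\delta_B$ of $(H,\Delta)$, a $*$-homomorphism $\phi:A\to B$ is $(\delta_A,\delta_B)$-equivariant if $\delta_B\circ\phi=(\phi\otimes\mathrm{id}_H)\circ\delta_A$. *)

(* Defs.v *)
From HB Require Import structures.
From mathcomp Require Import all_boot all_order all_algebra.
From mathcomp Require Import all_classical all_reals topology normedtype.
From mathcomp Require Import complex.
Set Implicit Arguments.
Unset Strict Implicit.
Unset Printing Implicit Defensive.
Import Order.TTheory GRing.Theory Num.Theory.
Import numFieldNormedType.Exports.
Local Open Scope classical_set_scope.
Local Open Scope ring_scope.

(* [cplx R] is [R[i]] with its norm topology.                                 *)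
Definition cplx (R : realType) : Type := R[i].
HB.instance Definition _ (R : realType) := Num.ClosedField.on (cplx R).
HB.instance Definition _ (R : realType) :=
  NormedModule.copy (cplx R) (cplx R)^o.
HB.instance Definition _ (R : realType) :=
  GRing.ComAlgebra.copy (cplx R) (cplx R)^o.

Section Cplx.
Variable R : realType.
Local Notation C := (cplx R).
Local Notation Re := (@complex.Re R).
Local Notation Im := (@complex.Im R).

Lemma cplx_real (x : C) : 0 <= x -> x = (Re x)%:C%C.
Proof. by move=> /ger0_real /RRe_real. Qed.

Lemma cplx_le (a b : R) : ((a%:C%C : C) <= b%:C%C) = (a <= b).
Proof. exact: lecR. Qed.

Lemma cplx_lt (a b : R) : ((a%:C%C : C) < b%:C%C) = (a < b).
Proof. exact: ltcR. Qed.

Lemma cplx_ReB (x y : C) : Re (x - y) = Re x - Re y.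
Proof. by case: x y => [a b] [c d]. Qed.

Lemma cplx_ImB (x y : C) : Im (x - y) = Im x - Im y.
Proof. by case: x y => [a b] [c d]. Qed.

Lemma norm_Re_le (x : C) : `|Re x|%:C%C <= `|x|.
Proof.
case: x => a b; rewrite [X in _ <= X]normc_def /= cplx_le -sqrtr_sqr.
by rewrite ler_wsqrtr// lerDl sqr_ge0.
Qed.

Lemma norm_Im_le (x : C) : `|Im x|%:C%C <= `|x|.
Proof.
case: x => a b; rewrite [X in _ <= X]normc_def /= cplx_le -sqrtr_sqr.
by rewrite ler_wsqrtr// lerDr sqr_ge0.
Qed.

Lemma norm_cplx_le (a b : R) : `|(Complex a b : C)| <= (`|a| + `|b|)%:C%C.
Proof.
rewrite [X in X <= _]normc_def /= cplx_le -(@ler_pXn2r _ 2) ?nnegrE ?addr_ge0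
  ?sqrtr_ge0//.
rewrite sqr_sqrtr ?addr_ge0 ?sqr_ge0// sqrrD !real_normK ?num_real//.
by rewrite -addrA [_ *+ 2 + _]addrC addrA lerDl mulrn_wge0// mulr_ge0.
Qed.

Lemma Re_continuous : continuous (Re : C -> R).
Proof.
move=> x; apply/(@cvgrPdist_lt R R^o C (nbhs x) (nbhs_filter x)) => e e0.
have e0' : 0 < e%:C%C :> C by rewrite cplx_lt.
have xe := @cvgr_dist_lt C C C (nbhs x) (nbhs_filter x) id x cvg_id _ e0'.
apply: filterS xe => y xy; rewrite -cplx_lt -cplx_ReB.
exact: le_lt_trans (norm_Re_le (x - y)) xy.
Qed.

Lemma Im_continuous : continuous (Im : C -> R).
Proof.
move=> x; apply/(@cvgrPdist_lt R R^o C (nbhs x) (nbhs_filter x)) => e e0.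
have e0' : 0 < e%:C%C :> C by rewrite cplx_lt.
have xe := @cvgr_dist_lt C C C (nbhs x) (nbhs_filter x) id x cvg_id _ e0'.
apply: filterS xe => y xy; rewrite -cplx_lt -cplx_ImB.
exact: le_lt_trans (norm_Im_le (x - y)) xy.
Qed.

Lemma Complex_continuous :
  continuous (fun p : R * R => Complex p.1 p.2 : C).
Proof.
move=> [a b]; apply/(@cvgrPdist_lt C C^o) => e e0.
have eE := cplx_real (ltW e0).
have e0' : 0 < Re e by rewrite -cplx_lt -eE.
have e2 : 0 < Re e / 2 by rewrite divr_gt0.
exists (ball a (Re e / 2), ball b (Re e / 2)) => /=.
  by split; exact: nbhsx_ballx.
move=> [c d] [/= ac bd]; rewrite eE.
apply: (le_lt_trans (norm_cplx_le (a - c) (b - d))); rewrite cplx_lt.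
by rewrite [ltRHS](splitr (Re e)) ltrD.
Qed.

Lemma cplx_complete (F : set_system C) :
  ProperFilter F -> cauchy F -> cvg F.
Proof.
move=> FF Fc.
have cR (f : C -> R) :
    (forall x y : C, `|f x - f y|%:C%C <= `|x - y|) -> cvg (f @ F).
  move=> fl; apply: cauchy_cvg; apply: cauchy_exP => e e0.
  have e0' : 0 < e%:C%C :> C by rewrite cplx_lt.
  have /cauchyP /(_ _ e0')[x Fx] := Fc; exists (f x).
  rewrite /nbhs/= /fmap/=; apply: filterS Fx => y xy /=.
  rewrite /ball/= /ball/= -cplx_lt; exact: le_lt_trans (fl _ _) xy.
have /cvg_ex[a Fa] : cvg (Re @ F).
  apply: cR => x y; rewrite -cplx_ReB; exact: norm_Re_le.
have /cvg_ex[b Fb] : cvg (Im @ F).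
  apply: cR => x y; rewrite -cplx_ImB; exact: norm_Im_le.
apply/cvg_ex; exists (Complex a b : C).
have H : (fun z : C => (Re z, Im z)) @ F --> ((a, b) : (R * R)%type).
  exact: (cvg_pair Fa Fb).
have := cvg_comp _ _ H (@Complex_continuous (a, b)).
by rewrite (_ : _ \o _ = id) //; apply/funext => -[].
Qed.

HB.instance Definition _ := Uniform_isComplete.Build C cplx_complete.

End Cplx.

(* Nonzero unital C*-algebras. This is a record because no Hierarchy Builder  *)
(* structure can join normed modules with rings: [numDomainType] inherits     *)
(* both, with the type itself as the scalars. The library's topological and   *)
(* algebra structures are declared on the carrier [cs_sort].                  *)
Record cstarAlg (R : realType) := CStarAlg {
  cs_space : completeNormedModType (cplx R);
  cs_one : cs_space;
  cs_mul : cs_space -> cs_space -> cs_space;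
  cs_star : cs_space -> cs_space;
  cs_mulA : associative cs_mul;
  cs_mul1x : left_id cs_one cs_mul;
  cs_mulx1 : right_id cs_one cs_mul;
  cs_mulDl : left_distributive cs_mul +%R;
  cs_mulDr : right_distributive cs_mul +%R;
  cs_scaleAl : forall (k : cplx R) x y, k *: cs_mul x y = cs_mul (k *: x) y;
  cs_scaleAr : forall (k : cplx R) x y, k *: cs_mul x y = cs_mul x (k *: y);
  cs_one_neq0 : cs_one != 0;
  cs_starK : involutive cs_star;
  cs_starD : {morph cs_star : x y / x + y};
  cs_starZ : forall (k : cplx R) x,
    cs_star (k *: x) = (conjc k : cplx R) *: cs_star x;
  cs_starM : forall x y, cs_star (cs_mul x y) = cs_mul (cs_star y) (cs_star x);
  cs_normM : forall x y, `|cs_mul x y| <= `|x| * `|y|;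
  cs_normC : forall x, `|cs_mul (cs_star x) x| = `|x| ^+ 2 }.

Definition cs_sort (R : realType) (A : cstarAlg R) : Type := cs_space A.
Coercion cs_sort : cstarAlg >-> Sortclass.

HB.instance Definition _ (R : realType) (A : cstarAlg R) :=
  CompleteNormedModule.copy (cs_sort A) (cs_space A).
HB.instance Definition _ (R : realType) (A : cstarAlg R) :=
  GRing.Zmodule_isNzRing.Build (cs_sort A) (@cs_mulA R A) (@cs_mul1x R A)
    (@cs_mulx1 R A) (@cs_mulDl R A) (@cs_mulDr R A) (@cs_one_neq0 R A).
HB.instance Definition _ (R : realType) (A : cstarAlg R) :=
  GRing.Lmodule_isLalgebra.Build (cplx R) (cs_sort A) (@cs_scaleAl R A).
HB.instance Definition _ (R : realType) (A : cstarAlg R) :=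
  GRing.Lalgebra_isAlgebra.Build (cplx R) (cs_sort A) (@cs_scaleAr R A).

Definition star (R : realType) (A : cstarAlg R) : A -> A := @cs_star R A.

HB.mixin Record isCompact X & Topological X := {
  compact_setT : compact [set: X] }.
#[short(type="compactType")]
HB.structure Definition Compact := {X of PointedTopological X & isCompact X}.

Lemma compact_set_type (X : topologicalType) (A : set X) :
  compact A -> compact [set: A].
Proof.
move=> cA F FF _.
have FF' : ProperFilter (set_val @ F) by exact: fmap_proper_filter FF.
have FA : (set_val @ F) A.
  by rewrite /nbhs/= /fmap/=;
  apply: filterS filterT => x _; exact: set_mem (valP x).
have [p [Ap pF]] := cA _ FF' FA.
exists (SigSub (mem_set Ap)); split => // U V FU.
rewrite nbhsE => -[W [[W' oW' <-]] W'p WV].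
have : (set_val @ F) (set_val @` U).
  by apply: (@filterS _ F _ U) => // y Uy; exists y.
move=> /pF /(_ (open_nbhs_nbhs (conj oW' W'p)))[_ [[y Uy <-] W'y]].
by exists y; split => //; exact: WV.
Qed.

Lemma prod_compact (X Y : compactType) : compact [set: X * Y].
Proof. by rewrite -setXTT; apply: compact_setX; exact: compact_setT. Qed.
HB.instance Definition _ (X Y : compactType) :=
  isCompact.Build (X * Y)%type (@prod_compact X Y).

Section Spaces.
Variable R : realType.
Local Notation C := (cplx R).

Definition circle : Type := [set z : C | `|z| = 1].
HB.instance Definition _ := Topological.on circle.

Lemma circle_compact : compact [set: circle].
Proof.
apply: compact_set_type.
pose D : set (R * R) := [set p | p.1 ^+ 2 + p.2 ^+ 2 = 1].
have -> : [set z : C | `|z| = 1] = (fun p : R * R => Complex p.1 p.2 : C) @` D.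
  apply/seteqP; split=> [[a b] /= | _ [[a b] /= abD <-]].
    rewrite [X in X = _]normc_def /= => -[] h; exists (a, b) => //=.
    rewrite /D /= -(sqr_sqrtr (a := _ + _)) ?addr_ge0 ?sqr_ge0// h expr1n//.
  by rewrite /= [X in X = _]normc_def /= abD sqrtr1.
apply: continuous_compact.
  exact/continuous_subspaceT/Complex_continuous.
have cI : compact (`[(-1 : R), 1]%classic `*` `[(-1 : R), 1]%classic).
  by apply: compact_setX; exact: segment_compact.
apply: (subclosed_compact _ cI).
- have cD : continuous (fun p : R * R => p.1 * p.1 + p.2 * p.2).
    by move=> p; apply: cvgD; apply: cvgM; (exact: cvg_fst || exact: cvg_snd).
  have -> : D =
    (fun p : R * R => p.1 * p.1 + p.2 * p.2) @^-1` [set x | x = 1] by [].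
  apply: preimage_closed => [x _|]; [exact: cD|exact: closed_eq].
- move=> [a b]; rewrite /D /= !in_itv /= => h.
  rewrite -!ler_norml -!(@ler_pXn2r _ 2 isT _ 1) ?nnegrE// expr1n.
  by rewrite !real_normK ?num_real// -h lerDl lerDr !sqr_ge0.
Qed.

Lemma circle1_subproof : (1 : C) \in [set z : C | `|z| = 1].
Proof. by rewrite inE /= normr1. Qed.
Definition circle1 : circle := SigSub circle1_subproof.
HB.instance Definition _ := isPointed.Build circle circle1.
HB.instance Definition _ := isCompact.Build circle circle_compact.

Lemma circle_mul_subproof (x y : circle) :
  (\val x * \val y : C) \in [set z : C | `|z| = 1].
Proof.
case: x y => [x /set_mem/= hx] [y /set_mem/= hy].
by rewrite inE /= normrM hx hy mulr1.
Qed.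
Definition circle_mul (x y : circle) : circle :=
  SigSub (circle_mul_subproof x y).

Definition itv01 : Type := [set` `[0 : R, 1]%R].
HB.instance Definition _ := Topological.on itv01.

Lemma itv01_compact : compact [set: itv01].
Proof. exact/compact_set_type/segment_compact. Qed.

Lemma itv01_0_subproof : (0 : R) \in [set` `[0 : R, 1]%R].
Proof. by rewrite inE /= in_itv /= lexx ler01. Qed.
Lemma itv01_1_subproof : (1 : R) \in [set` `[0 : R, 1]%R].
Proof. by rewrite inE /= in_itv /= lexx ler01. Qed.
Definition itv01_0 : itv01 := SigSub itv01_0_subproof.
Definition itv01_1 : itv01 := SigSub itv01_1_subproof.
HB.instance Definition _ := isPointed.Build itv01 itv01_0.
HB.instance Definition _ := isCompact.Build itv01 itv01_compact.

End Spaces.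

Section ContinuousFunctions.
Variables (R : realType) (X : compactType) (B : completeNormedModType (cplx R)).
Local Notation C := (cplx R).
Local Notation Re := (@complex.Re R).

Record cfun := CFun { cfun_val :> X -> B; cfunP : continuous cfun_val }.

Lemma cfun_eqP (f g : cfun) : (f : X -> B) =1 g -> f = g.
Proof.
case: f g => [f cf] [g cg] /= /funext fg; subst g.
by congr CFun; exact: Prop_irrelevance.
Qed.

HB.instance Definition _ := gen_eqMixin cfun.
HB.instance Definition _ := gen_choiceMixin cfun.

Definition cfun0 : cfun := CFun (fun _ => cvg_cst (0 : B)).
Definition cfunN (f : cfun) : cfun :=
  CFun (fun x => cvgN (@cfunP f x)).
Definition cfunD (f g : cfun) : cfun :=
  CFun (fun x => cvgD (@cfunP f x) (@cfunP g x)).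
Definition cfunZ (k : C) (f : cfun) : cfun :=
  CFun (fun x => cvgZ (cvg_cst (k : C^o)) (@cfunP f x)).

Lemma cfun_addA : associative cfunD.
Proof. by move=> f g h; apply: cfun_eqP => x; exact: addrA. Qed.
Lemma cfun_addC : commutative cfunD.
Proof. by move=> f g; apply: cfun_eqP => x; exact: addrC. Qed.
Lemma cfun_add0 : left_id cfun0 cfunD.
Proof. by move=> f; apply: cfun_eqP => x; exact: add0r. Qed.
Lemma cfun_addN : left_inverse cfun0 cfunN cfunD.
Proof. by move=> f; apply: cfun_eqP => x; exact: addNr. Qed.
HB.instance Definition _ :=
  GRing.isZmodule.Build cfun cfun_addA cfun_addC cfun_add0 cfun_addN.

Lemma cfun_scaleA a b f : cfunZ a (cfunZ b f) = cfunZ (a * b) f.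
Proof. by apply: cfun_eqP => x; exact: scalerA. Qed.
Lemma cfun_scale1 : left_id 1 cfunZ.
Proof. by move=> f; apply: cfun_eqP => x; exact: scale1r. Qed.
Lemma cfun_scaleDr : right_distributive cfunZ +%R.
Proof. by move=> a f g; apply: cfun_eqP => x; exact: scalerDr. Qed.
Lemma cfun_scaleDl f : {morph cfunZ^~ f : a b / a + b}.
Proof. by move=> a b; apply: cfun_eqP => x; exact: scalerDl. Qed.
HB.instance Definition _ := GRing.Zmodule_isLmodule.Build C cfun
  cfun_scaleA cfun_scale1 cfun_scaleDr cfun_scaleDl.

Definition cfun_norm (f : cfun) : C :=
  (sup (range (fun x => Re `|f x|)))%:C%C.

Lemma cfun_has_sup (f : cfun) : has_sup (range (fun x => Re `|f x|)).
Proof.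
apply: compact_has_sup; first by exists (Re `|f point|), point.
apply: continuous_compact; last exact: compact_setT.
apply: continuous_subspaceT => x.
apply: (@continuous_comp _ _ _ (fun x => `|f x|) Re); last exact: Re_continuous.
by apply: continuous_comp; [exact: cfunP|exact: norm_continuous].
Qed.

Lemma le_cfun_norm (f : cfun) x : `|f x| <= cfun_norm f.
Proof.
rewrite (cplx_real (normr_ge0 (f x))) cplx_le.
by apply: ub_le_sup; [case: (cfun_has_sup f)|exists x].
Qed.

Lemma cfun_norm_ge0 f : 0 <= cfun_norm f.
Proof. exact: le_trans (normr_ge0 _) (le_cfun_norm f point). Qed.

Lemma cfun_norm_le (f : cfun) (c : C) :
  (forall x, `|f x| <= c) -> cfun_norm f <= c.
Proof.
move=> fc.
have c0 : 0 <= c := le_trans (normr_ge0 _) (fc point).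
rewrite (cplx_real c0) cplx_le; apply: ge_sup; first by case: (cfun_has_sup f).
move=> _ [x _ <-].
by rewrite -cplx_le -(cplx_real c0) -(cplx_real (normr_ge0 (f x))).
Qed.

Lemma cfun_normD f g : cfun_norm (f + g) <= cfun_norm f + cfun_norm g.
Proof.
apply: cfun_norm_le => x; apply: le_trans (ler_normD (f x) (g x)) _.
by apply: lerD; exact: le_cfun_norm.
Qed.

Lemma cfun_normZ (k : C) f : cfun_norm (k *: f) = `|k| * cfun_norm f.
Proof.
have le k' h : cfun_norm (k' *: h) <= `|k'| * cfun_norm h.
  apply: cfun_norm_le => x; rewrite [X in X <= _](normrZ k' (h x)).
  by rewrite ler_wpM2l//; exact: le_cfun_norm.
apply/eqP; rewrite eq_le le /=.
have [->|k0] := eqVneq k 0; first by rewrite normr0 mul0r cfun_norm_ge0.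
rewrite -ler_pdivlMl ?normr_gt0// -normfV.
by rewrite -{1}[f](scalerK k0) le.
Qed.

Lemma cfun_norm_eq0 f : cfun_norm f = 0 -> f = 0.
Proof.
move=> f0; apply: cfun_eqP => x; apply/eqP.
by rewrite -normr_le0 -f0 le_cfun_norm.
Qed.

HB.instance Definition _ := isPointed.Build cfun 0.
HB.instance Definition _ :=
  Lmodule_isNormed.Build C cfun cfun_normD cfun_normZ cfun_norm_eq0.

Lemma cfun_complete (F : set_system cfun) :
  ProperFilter F -> cauchy F -> cvg F.
Proof.
move=> FF Fc.
have Fe (e : C) : 0 < e -> exists2 A : set cfun, F A &
    forall f g, A f -> A g -> forall x, `|f x - g x| < e.
  move=> e0; have e2 : 0 < e / 2 by rewrite divr_gt0.
  have /cauchyP /(_ _ e2)[h Fh] := Fc.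
  exists (ball h (e / 2)) => // f g hf hg x.
  rewrite (@distm_lt_split _ _ (h x))//.
    rewrite distrC; apply: le_lt_trans hf; exact: (le_cfun_norm (h - f)).
  by apply: le_lt_trans hg; exact: (le_cfun_norm (h - g)).
have cx x : cvg ((fun f : cfun => f x) @ F).
  apply: cauchy_cvg; apply: cauchy_exP => e e0.
  have [A FA Ae] := Fe _ e0; have [h Ah] := filter_ex FA.
  exists (h x); rewrite /nbhs/= /fmap/=; apply: (filterS _ FA) => g Ag /=.
  by rewrite -ball_normE /=; exact: Ae.
pose l x : B := lim ((fun f : cfun => f x) @ F).
have Al (e : C) A : 0 < e -> F A ->
    (forall f g, A f -> A g -> forall x, `|f x - g x| < e) ->
    forall f, A f -> forall x, `|f x - l x| < e + e.
  move=> e0 FA Ae f Af x.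
  have /cvgrPdist_lt /(_ _ e0) H := cx x.
  have [g [Ag gx]] := filter_ex (filterI FA H).
  apply: le_lt_trans (ler_distD (g x) _ _) _.
  by rewrite ltrD ?Ae// distrC.
have cl : continuous l.
  move=> x; apply/cvgrPdist_lt => e e0.
  have e4 : 0 < e / 2 / 2 / 2 by rewrite !divr_gt0.
  have [A FA Ae] := Fe _ e4; have [h Ah] := filter_ex FA.
  have /cvgrPdist_lt /(_ _ (divr_gt0 e0 (ltr0n _ 2))) H := @cfunP h x.
  apply: filterS H => y hxy.
  have Hx := Al _ _ e4 FA Ae _ Ah x.
  have Hy := Al _ _ e4 FA Ae _ Ah y.
  rewrite -!splitr in Hx Hy.
  have -> : e = e / 2 / 2 + (e / 2 + e / 2 / 2).
    by rewrite addrCA -splitr -splitr.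
  rewrite distrC in Hx.
  apply: le_lt_trans (ler_distD (h x) _ _) (ltrD Hx _).
  exact: le_lt_trans (ler_distD (h y) _ _) (ltrD hxy Hy).
apply/cvg_ex; exists (CFun cl : cfun).
apply/(@fcvgrPdist_lt C cfun F) => e e0.
have e4 : 0 < e / 2 / 2 by rewrite !divr_gt0.
have [A FA Ae] := Fe _ e4.
apply: (filterS _ FA) => f Af.
rewrite distrC; apply: (@le_lt_trans _ _ (e / 2)); last first.
  by rewrite [ltRHS]splitr ltrDl divr_gt0.
apply: cfun_norm_le => x; apply: ltW.
by rewrite [ltRHS]splitr; exact: Al _ _ e4 FA Ae _ Af x.
Qed.

HB.instance Definition _ := Uniform_isComplete.Build cfun cfun_complete.

End ContinuousFunctions.

Section ScalarAlgebra.
Variable R : realType.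
Local Notation C := (cplx R).

Lemma cplx_conjD : {morph (@conjc R : C -> C) : x y / x + y}.
Proof. exact: rmorphD. Qed.
Lemma cplx_conjM (x y : C) : (conjc (x * y) : C) = conjc y * conjc x :> C.
Proof. by rewrite mulrC; exact: (rmorphM (@conjc R)). Qed.
Lemma cplx_conjZ (k x : C) :
  (conjc (k *: x : C) : C) = (conjc k : C) *: (conjc x : C) :> C.
Proof. exact: (rmorphM (@conjc R)). Qed.
Lemma cplx_norm_conj (x : C) : `|(conjc x : C) * x| = `|x| ^+ 2.
Proof.
rewrite normrM expr2; congr (_ * _).
by case: x => a b; rewrite [LHS]normc_def [RHS]normc_def /= sqrrN.
Qed.
Lemma cplx_normM_le (x y : C) : `|x * y| <= `|x| * `|y|.
Proof. by rewrite normrM. Qed.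

Definition cplx_cstar : cstarAlg R :=
  @CStarAlg R (cplx R : completeNormedModType C) (1 : C) ( *%R : C -> C -> C)
    (@conjc R : C -> C) (@mulrA C) (@mul1r C) (@mulr1 C) (@mulrDl C) (@mulrDr C)
    (fun k x y => @mulrA C k x y) (fun k x y => @mulrCA C k x y) (@oner_neq0 C)
    (@conjcK R) cplx_conjD cplx_conjZ cplx_conjM
    cplx_normM_le cplx_norm_conj.

End ScalarAlgebra.

Section FunctionAlgebra.
Variables (R : realType).
Local Notation C := (cplx R).

Section CStarContinuity.
Variable A : cstarAlg R.

Lemma cs_normrM (x y : A) : `|x * y| <= `|x| * `|y|.
Proof. exact: cs_normM. Qed.

Lemma cs_norm_star (x : A) : `|star x| = `|x|.
Proof.
have le (y : A) : `|y| <= `|star y|.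
  have [->|y0] := eqVneq y 0; first by rewrite normr0.
  rewrite -(@ler_pM2r _ `|y|) ?normr_gt0// -expr2.
  by rewrite -(cs_normC y); exact: cs_normM.
by apply/eqP; rewrite eq_le le andbT -{2}[x](cs_starK (c := A)) le.
Qed.

Lemma cs_starB (x y : A) : star (x - y) = star x - star y.
Proof.
rewrite -scaleN1r [LHS]cs_starD [X in _ + X]cs_starZ.
by rewrite (rmorphN1 (@conjc R)) scaleN1r.
Qed.

Lemma star_continuous : continuous (@star R A).
Proof.
move=> x; apply/cvgrPdist_lt => e e0; near=> y.
rewrite -cs_starB cs_norm_star.
by near: y; exact: cvgr_dist_lt.
Unshelve. all: by end_near. Qed.

Lemma cs_mul_cvg (T : topologicalType) (f g : T -> A) (x : T) :
  {for x, continuous f} -> {for x, continuous g} ->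
  {for x, continuous (fun t => f t * g t)}.
Proof.
move=> /cvgrPdist_lt cf /cvgrPdist_lt cg; apply/cvgrPdist_lt => e e0.
pose M : C := `|f x| + `|g x| + 1.
have M0 : 0 < M by rewrite ltr_wpDl// addr_ge0.
have e2 : 0 < e / 2 / M by rewrite !divr_gt0.
near=> t.
have -> : f x * g x - f t * g t = (f x - f t) * g x + f t * (g x - g t).
  by rewrite mulrBl mulrBr addrA subrK.
apply: le_lt_trans (ler_normD _ _) _; rewrite [ltRHS]splitr.
have fM : `|f t| <= M.
  rewrite -[f t](subrK (f x)); apply: le_trans (ler_normD _ _) _.
  rewrite distrC /M -addrA [leRHS]addrC; apply: lerD => //.
  rewrite -[leLHS]add0r lerD//; apply: ltW.
  by near: t; exact: cf.
have gM : `|g x| <= M by rewrite /M addrAC lerDr addr_ge0.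
apply: ltrD; apply: le_lt_trans (cs_normrM _ _) _.
  apply: (@le_lt_trans _ _ (`|f x - f t| * M)); first by rewrite ler_wpM2l.
  by rewrite -ltr_pdivlMr//; near: t; exact: cf.
apply: (@le_lt_trans _ _ (M * `|g x - g t|)); first by rewrite ler_wpM2r.
by rewrite mulrC -ltr_pdivlMr//; near: t; exact: cg.
Unshelve. all: by end_near. Qed.

End CStarContinuity.

Variables (X : compactType) (B : cstarAlg R).
Local Notation CX := (@cfun R X (cs_space B)).

Definition cfun1 : CX := @CFun R X (cs_space B) _ (fun _ => cvg_cst (1 : B)).
Definition cfunM (f g : CX) : CX :=
  @CFun R X (cs_space B) _
    (fun x => cs_mul_cvg (@cfunP _ _ _ f x) (@cfunP _ _ _ g x)).
Definition cfun_star (f : CX) : CX :=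
  @CFun R X (cs_space B) _ (fun x =>
    continuous_comp (@cfunP _ _ _ f x) (@star_continuous B (f x))).

Lemma cfun_mulA : associative cfunM.
Proof. by move=> f g h; apply: cfun_eqP => x; exact: cs_mulA. Qed.
Lemma cfun_mul1x : left_id cfun1 cfunM.
Proof. by move=> f; apply: cfun_eqP => x; exact: cs_mul1x. Qed.
Lemma cfun_mulx1 : right_id cfun1 cfunM.
Proof. by move=> f; apply: cfun_eqP => x; exact: cs_mulx1. Qed.
Lemma cfun_mulDl : left_distributive cfunM +%R.
Proof. by move=> f g h; apply: cfun_eqP => x; exact: cs_mulDl. Qed.
Lemma cfun_mulDr : right_distributive cfunM +%R.
Proof. by move=> f g h; apply: cfun_eqP => x; exact: cs_mulDr. Qed.
Lemma cfun_scaleAl (k : C) f g : k *: cfunM f g = cfunM (k *: f) g.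
Proof. by apply: cfun_eqP => x; exact: cs_scaleAl. Qed.
Lemma cfun_scaleAr (k : C) f g : k *: cfunM f g = cfunM f (k *: g).
Proof. by apply: cfun_eqP => x; exact: cs_scaleAr. Qed.
Lemma cfun_one_neq0 : cfun1 != 0.
Proof.
apply/eqP => /(congr1 (fun f : CX => f point)) /eqP.
exact/negP/(@cs_one_neq0 R B).
Qed.
Lemma cfun_starK : involutive cfun_star.
Proof. by move=> f; apply: cfun_eqP => x; exact: cs_starK. Qed.
Lemma cfun_starD : {morph cfun_star : f g / f + g}.
Proof. by move=> f g; apply: cfun_eqP => x; exact: cs_starD. Qed.
Lemma cfun_starZ (k : C) f :
  cfun_star (k *: f) = (conjc k : C) *: cfun_star f.
Proof. by apply: cfun_eqP => x; exact: cs_starZ. Qed.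
Lemma cfun_starM f g :
  cfun_star (cfunM f g) = cfunM (cfun_star g) (cfun_star f).
Proof. by apply: cfun_eqP => x; exact: cs_starM. Qed.
Lemma cfun_normM (f g : CX) : `|cfunM f g| <= `|f| * `|g|.
Proof.
apply: cfun_norm_le => x; apply: le_trans (cs_normM (f x) (g x)) _.
by apply: ler_pM => //; exact: le_cfun_norm.
Qed.
Lemma cfun_normC (f : CX) : `|cfunM (cfun_star f) f| = `|f| ^+ 2.
Proof.
apply/eqP; rewrite eq_le; apply/andP; split.
  apply: cfun_norm_le => x; rewrite [X in X <= _](cs_normC (f x)).
  by rewrite ler_pXn2r ?nnegrE//; exact: le_cfun_norm.
have n0 : 0 <= `|cfunM (cfun_star f) f| by [].
rewrite -[leRHS](sqrtCK) ler_pXn2r ?nnegrE ?sqrtC_ge0//.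
apply: cfun_norm_le => x.
rewrite -(@ler_pXn2r _ 2) ?nnegrE ?sqrtC_ge0// sqrtCK -cs_normC.
exact: (le_cfun_norm (cfunM (cfun_star f) f) x).
Qed.

Definition cfun_cstar : cstarAlg R :=
  CStarAlg cfun_mulA cfun_mul1x cfun_mulx1 cfun_mulDl cfun_mulDr
    cfun_scaleAl cfun_scaleAr cfun_one_neq0 cfun_starK cfun_starD cfun_starZ
    cfun_starM cfun_normM cfun_normC.

Definition ev (f : cfun_cstar) (x : X) : B := (f : CX) x.

End FunctionAlgebra.

Section StarHomomorphisms.
Variables (R : realType) (A B : cstarAlg R).

Definition unital_star_hom (f : A -> B) : Prop :=
  [/\ linear f, {morph f : x y / x * y}, f 1 = 1
    & forall x, f (star x) = star (f x)].

Definition star_iso (f : A -> B) : Prop := unital_star_hom f /\ bijective f.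

Definition lin_span (S : set A) : set A :=
  [set x | exists n (k : 'I_n -> cplx R) (v : 'I_n -> A),
     (forall i, S (v i)) /\ x = \sum_(i < n) k i *: v i].

End StarHomomorphisms.

Definition cs_separable (R : realType) (A : cstarAlg R) : Prop :=
  exists D : set A, countable D /\ dense D.

(* Nuclearity is the completely positive approximation property: the identity *)
(* of [A] is a point-norm limit of maps that factor through matrix algebras   *)
(* by contractive completely positive maps.                                   *)
Section Nuclearity.
Variable R : realType.
Local Notation C := (cplx R).

(* The positive elements of [M_m(D)] are those of the form [Y^* Y].           *)
Definition mx_positive (D : pzRingType) (st : D -> D) m (X : 'M[D]_m) : Prop :=
  exists Y : 'M[D]_m, X = (map_mx st Y)^T *m Y.

Definition completely_positive (D E : pzRingType) (stD : D -> D) (stE : E -> E)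
    (f : D -> E) : Prop :=
  forall m (X : 'M[D]_m), mx_positive stD X -> mx_positive stE (map_mx f X).

Definition mx_star n (M : 'M[C]_n) : 'M[C]_n :=
  (map_mx (@conjc R : C -> C) M)^T.

(* [op_norm_le M c] says that the operator norm of [M] on Euclidean [C^n] is  *)
(* at most [c], for [0 <= c].                                                 *)
Definition op_norm_le n (M : 'M[C]_n) (c : C) : Prop :=
  forall v : 'cV[C]_n,
    \sum_(i < n) `|(M *m v) i 0| ^+ 2 <= c ^+ 2 * \sum_(i < n) `|v i 0| ^+ 2.

Definition nuclear (A : cstarAlg R) : Prop :=
  forall (F : seq A) (e : C), 0 < e ->
  exists n (phi : A -> 'M[C]_n) (psi : 'M[C]_n -> A),
  [/\ linear phi /\ linear psi,
      completely_positive (@star R A) (@mx_star n) phi,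
      completely_positive (@mx_star n) (@star R A) psi,
      (forall a, op_norm_le (phi a) `|a|) /\
      (forall M c, 0 <= c -> op_norm_le M c -> `|psi M| <= c)
    & forall a, a \in F -> `|psi (phi a) - a| < e].

End Nuclearity.

Section MinimalTensorProduct.
Variable R : realType.
Local Notation C := (cplx R).

Definition state (A : cstarAlg R) (phi : A -> C) : Prop :=
  [/\ forall (k : C) (x y : A), phi (k *: x + y) = k * phi x + phi y,
      forall x, 0 <= phi (star x * x) & phi 1 = 1].

Section Spatial.
Variables A B : cstarAlg R.

(* The squared norm of the vector of [\sum_i x i (x) y i] in the Hilbert      *)
(* tensor product of the GNS spaces of [phi] and [psi].                       *)
Definition gns_sqnorm (phi : A -> C) (psi : B -> C) (I : finType)
    (x : I -> A) (y : I -> B) : C :=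
  \sum_i \sum_j phi (star (x i) * x j) * psi (star (y i) * y j).

(* For [0 <= c]: the operator [\sum_i pi_phi (a i) (x) pi_psi (b i)] has norm *)
(* at most [c] for all GNS representations [pi_phi] of [A], [pi_psi] of [B].  *)
Definition spatial_norm_le n (a : 'I_n -> A) (b : 'I_n -> B) (c : C) : Prop :=
  forall phi psi, state phi -> state psi ->
  forall m (x : 'I_m -> A) (y : 'I_m -> B),
    gns_sqnorm phi psi (fun p : 'I_n * 'I_m => a p.1 * x p.2)
                       (fun p : 'I_n * 'I_m => b p.1 * y p.2)
    <= c ^+ 2 * gns_sqnorm phi psi x y.

(* [T], with [t a b] the elementary tensor of [a] and [b], is the completion  *)
(* of the algebraic tensor product in the spatial norm.                       *)
Definition is_min_tensor (T : cstarAlg R) (t : A -> B -> T) : Prop :=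
  [/\ (forall a, linear (t a)) /\ (forall b, linear (t^~ b)),
      forall a a' b b', t a b * t a' b' = t (a * a') (b * b'),
      t 1 1 = 1 /\ (forall a b, star (t a b) = t (star a) (star b)),
      dense (lin_span [set x | exists a b, x = t a b])
    & forall n (a : 'I_n -> A) (b : 'I_n -> B),
        let N := `|\sum_(i < n) t (a i) (b i)| in
        spatial_norm_le a b N /\
        (forall c, 0 <= c -> spatial_norm_le a b c -> N <= c)].

End Spatial.

Record minTensor (A B : cstarAlg R) := MinTensor {
  mt_alg :> cstarAlg R;
  tens : A -> B -> mt_alg;
  mt_axiom : is_min_tensor tens }.

(* [g] is the tensor product of the homomorphisms [f1] and [f2]; it is        *)
(* determined by its values on elementary tensors.                            *)
Definition is_tensor_map (A B A' B' : cstarAlg R) (S : minTensor A B)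
    (S' : minTensor A' B') (f1 : A -> A') (f2 : B -> B') (g : S -> S') : Prop :=
  unital_star_hom g /\ forall a b, g (tens S a b) = tens S' (f1 a) (f2 b).

End MinimalTensorProduct.

(* [coAH], [coAHH] and [coA_HH] are [A (x) H], [(A (x) H) (x) H] and          *)
(* [A (x) (H (x) H)]; [coassoc] is the canonical identification of the last   *)
(* two.                                                                       *)
Record coaction (R : realType) (H : cstarAlg R) (H2 : minTensor H H)
    (Delta : H -> H2) (A : cstarAlg R) := Coaction {
  coAH : minTensor A H;
  coAHH : minTensor coAH H;
  coA_HH : minTensor A H2;
  coassoc : coA_HH -> coAHH;
  coassoc_iso : star_iso coassoc;
  coassocE : forall a h k,
    coassoc (tens coA_HH a (tens H2 h k)) = tens coAHH (tens coAH a h) k;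
  co_idDelta : coAH -> coA_HH;
  co_idDeltaP : is_tensor_map id Delta co_idDelta;
  comap :> A -> coAH;
  comap_hom : unital_star_hom comap;
  comap_inj : injective comap;
  comap_id : coAH -> coAHH;
  comap_idP : is_tensor_map comap id comap_id;
  comap_coassoc : forall a,
    comap_id (comap a) = coassoc (co_idDelta (comap a));
  comap_dense :
    dense (lin_span [set x | exists a h, x = comap a * tens coAH 1 h]) }.

Section Actions.
Variables (R : realType) (H : cstarAlg R) (H2 : minTensor H H).
Variables (Delta : H -> H2) (A : cstarAlg R) (delta : coaction Delta A).

Definition free_coaction : Prop :=
  dense [set x : coAH delta | exists n (a b : 'I_n -> A),
    x = \sum_(i < n) tens (coAH delta) (a i) 1 * delta (b i)].

(* The join is a subset of the C*-algebra [C([0,1], A (x) H)].                *)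
Local Notation cyl := (cfun_cstar (itv01 R) (coAH delta)).

Definition nc_join : set cyl :=
  [set f | (exists h, ev f (itv01_0 R) = tens (coAH delta) 1 h) /\
           (exists a, ev f (itv01_1 R) = delta a)].

(* [iota] is the canonical identification of [C([0,1], A (x) H) (x) H] with   *)
(* [C([0,1], A (x) H (x) H)], under which [dD] applies [id (x) Delta] at each *)
(* time. Its source contains [nc_join (x) H], since minimal tensor products   *)
(* preserve inclusions.                                                       *)
Definition join_equivariant (phi : H -> cyl) : Prop :=
  exists (W : minTensor cyl H) (iota : W -> cfun_cstar (itv01 R) (coAHH delta))
         (dD : cyl -> W) (phi_id : H2 -> W),
  [/\ star_iso iota /\
      (forall f h t, ev (iota (tens W f h)) t = tens (coAHH delta) (ev f t) h),
      forall f, nc_join f -> forall t,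
        ev (iota (dD f)) t = coassoc (co_idDelta (ev f t)),
      is_tensor_map phi id phi_id
    & forall h, dD (phi h) = phi_id (Delta h)].

End Actions.

Arguments nc_join {R H H2 Delta A} delta.
Arguments join_equivariant {R H H2 Delta A} delta phi.

Section Circle.
Variable R : realType.

Definition C_S1 : cstarAlg R := cfun_cstar (circle R) (cplx_cstar R).
Definition C_S1S1 : cstarAlg R :=
  cfun_cstar (circle R * circle R)%type (cplx_cstar R).

(* [kappa] is the canonical identification of [C(S^1) (x) C(S^1)] with        *)
(* [C(S^1 x S^1)].                                                            *)
Definition circle_comult (H2 : minTensor C_S1 C_S1) (Delta : C_S1 -> H2) :
    Prop :=
  exists kappa : H2 -> C_S1S1,
  [/\ star_iso kappa,
      forall f g x y, ev (kappa (tens H2 f g)) (x, y) = ev f x * ev g y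
    & forall f x y, ev (kappa (Delta f)) (x, y) = ev f (circle_mul x y)].

End Circle.

(* Main.v *)
(* Let [B] be the Cuntz algebra O_2 and [A = C(S^1, B)] with the translation action, whose
   coaction is [delta f y x = f (x y)]; it is free because [(g, s) |-> F g (s / g)] turns the
   products [a (x) 1 * delta b] into elementary tensors.  An equivariant homomorphism out of
   [C(S^1)] amounts to a unitary [u] in [C([0,1], A (x) C(S^1))] of the form
   [u t y = y *: v t]; the boundary conditions of the join become [v 0 = 1] and
   [v 1 = z (x) 1], with [z] the generator of [C(S^1)].  So one needs a null-homotopy [v] of
   the central unitary [z (x) 1] among the unitaries of [A].

   For a projection [p] put [u_p = z p + (1 - p)].  Projections exchanged by a partial isometry
   give a [u_p u_q^*] that is a commutator with a unitary of rotation type, hence homotopic to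
   [1].  In O_2 take [e0 = S2 S2^*], [e1 = S1 S1 (S1 S1)^*], [e2 = S1 S2 (S1 S2)^*] and
   [x = u_(e1+e2) u_e0^*], [y = u_e0 u_e1^*], [y' = u_e0 u_e2^*]; then
   [z = u_(e0+e1+e2) = (x y) (x y') (x y y')] is null-homotopic.

   O_2 is realised on l^2(N) by [S_i e_n = e_(2n+i)]; the vectors [S_w e_1], for all words [w],
   are distinct basis vectors.  For nuclearity of [C(X, B)], use a partition of unity on [X]
   and, on [B], compress to the span of the [S_w e_1] with [m <= |w| < m + N] and map a matrix
   [M] back to [1/N sum M_(w,w') S_w S_w'^*]: on [S_a S_b^*] the composite is multiplication by
   [1 - ||a| - |b|| / N]. *)
Require Import Defs.
From HB Require Import structures.
From mathcomp Require Import all_boot all_order all_algebra.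
From mathcomp Require Import all_classical all_reals topology normedtype.
From mathcomp Require Import separable cyclotomic cyclic spectral.
From mathcomp Require Import complex sequences realfun ring zify.
Set Implicit Arguments. Unset Strict Implicit. Unset Printing Implicit Defensive.
Import Order.TTheory GRing.Theory Num.Theory.
Import numFieldNormedType.Exports.
Local Open Scope classical_set_scope.
Local Open Scope ring_scope.

(** * C*-algebra preliminaries *)

(** The choice of [B] is governed by K-theory. The class of [z (x) 1] in K_1 of C(S^1, B) is the
    image of [1] under an embedding of K_0(B), so a null-homotopy requires [1] = 0 in K_0(B). A
    tracial state on [B] already excludes this, since it turns the winding number of [z] into an
    invariant. In O_2 the unit is a sum of two projections equivalent to it, so [1] = [1] + [1] and
    the class vanishes; the word in [x], [y], [y'] carries out this computation with unitaries of
    the algebra itself, without passing to matrices.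

    The definition of minimal tensor products quantifies over all states. Every right-hand tensor
    factor is commutative, so each product is an algebra of functions C(X, D), and a spatial norm is
    found pointwise once the states of D detect the norm of D. The *-homomorphism of C(S^1) attached
    to a unitary is built in the same spirit: states and finite Fourier analysis at roots of unity
    replace spectral theory. *)

Section CStarBasics.
Variables (R : realType) (A : cstarAlg R).
Local Notation C := (cplx R).
Implicit Types x y : A.

Lemma starK x : star (star x) = x.
Proof. exact: cs_starK. Qed.

Lemma starD x y : star (x + y) = star x + star y.
Proof. exact: cs_starD. Qed.

Lemma starM x y : star (x * y) = star y * star x.
Proof. exact: cs_starM. Qed.

Lemma starZ (k : C) x : star (k *: x) = (conjc k : C) *: star x.
Proof. exact: cs_starZ. Qed.

Lemma starB x y : star (x - y) = star x - star y.
Proof. by rewrite cs_starB. Qed.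

Lemma star0 : star (0 : A) = 0.
Proof. by rewrite -{1}(subrr (0 : A)) starB subrr. Qed.

Lemma star1 : star (1 : A) = 1.
Proof. by rewrite -[LHS]mul1r -{1}[1]starK -starM mul1r starK. Qed.

Lemma star_sum I (r : seq I) (P : pred I) (F : I -> A) :
  star (\sum_(i <- r | P i) F i) = \sum_(i <- r | P i) star (F i).
Proof. exact: (big_morph _ starD star0). Qed.

Lemma normC x : `|star x * x| = `|x| ^+ 2.
Proof. exact: cs_normC. Qed.

Lemma norm1 : `|1 : A| = 1.
Proof.
have := normC 1; rewrite star1 mulr1 expr2 => /eqP.
rewrite -subr_eq0 -[X in X - _]mulr1 -mulrBr mulf_eq0 normr_eq0 oner_eq0 /=.
by rewrite subr_eq0 => /eqP.
Qed.

End CStarBasics.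

Section Closure.
Variables (R : realType).
Local Notation C := (cplx R).

Lemma closureP_norm (V : normedModType C) (S : set V) (x : V) :
  closure S x <-> forall e : C, 0 < e -> exists2 y, S y & `|x - y| < e.
Proof.
split=> [h e e0|h U].
  have [y [Sy /= xy]] := h _ (nbhsx_ballx x e e0).
  by exists y => //; move: xy; rewrite -ball_normE.
move=> /nbhs_normP[e /= e0 eU]; have [y Sy xy] := h e e0.
by exists y; split => //; apply: eU.
Qed.

Lemma denseP_norm (V : normedModType C) (S : set V) :
  dense S <-> forall (x : V) (e : C), 0 < e -> exists2 y, S y & `|x - y| < e.
Proof.
split=> [dS x e e0|h].
  have oB : open (ball x e) by exact: ball_open.
  have := dS (ball x e) (ex_intro _ x (ballxx x e0)) oB.
  by move=> [y []]; rewrite -ball_normE/= => xy Sy; exists y.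
move=> O [x Ox] oO; have : nbhs x O by exact: open_nbhs_nbhs.
move=> /nbhs_normP[e /= e0 eO]; have [y Sy xy] := h x e e0.
by exists y; split => //; apply: eO.
Qed.

End Closure.


Section Geometric.
Variables (R : realType).
Local Notation C := (cplx R).

Lemma conjc_ge0 (k : C) : 0 <= k -> conjc k = k.
Proof. by move=> /cplx_real->; rewrite /conjc /= oppr0. Qed.

Lemma expr_small (q M e : C) : 0 <= q -> q < 1 -> 0 <= M -> 0 < e ->
  exists n, M * q ^+ n < e.
Proof.
move=> q0 q1 M0 e0.
rewrite (cplx_real q0) (cplx_real M0) (cplx_real (ltW e0)) in q1 *.
have q0' : 0 <= complex.Re q by rewrite -cplx_le -cplx_real.
have M0' : 0 <= complex.Re M by rewrite -cplx_le -cplx_real.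
have e0' : 0 < complex.Re e by rewrite -cplx_lt -(cplx_real (ltW e0)).
move: (complex.Re q) (complex.Re M) (complex.Re e) q0' M0' e0' q1.
move=> a b c a0 b0 c0; rewrite cplx_lt => a1.
have a1' : `|a| < 1 by rewrite ger0_norm.
have := @cvg_geometric R b a a1' => /cvgrPdist_lt /(_ _ c0) [n _ /(_ n (leqnn n))] /=.
rewrite sub0r normrN ger0_norm ?mulr_ge0 ?exprn_ge0// => h.
by exists n; rewrite -rmorphXn -rmorphM /= cplx_lt.
Qed.

Lemma geometric_cvg (V : completeNormedModType C) (u : nat -> V) (q M : C) :
  0 <= q -> q < 1 -> (forall n, `|u n.+1 - u n| <= M * q ^+ n) ->
  cvgn u.
Proof.
move=> q0 q1 uq.
have M0 : 0 <= M by have := uq 0%N; rewrite expr0 mulr1; exact: le_trans.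
have q1' : 0 < 1 - q by rewrite subr_gt0.
(* The geometric sum of the increments, multiplied through by [1 - q] so that the induction involves
   no division. *)
have tail n m : `|u (n + m)%N - u n| * (1 - q) <= M * q ^+ n * (1 - q ^+ m).
  elim: m => [|m IH].
    by rewrite addn0 subrr normr0 mul0r expr0 subrr mulr0.
  rewrite -[u _ - _](subrKA (u (n + m)%N)).
  apply: le_trans (ler_wpM2r (ltW q1') (ler_normD _ _)) _.
  rewrite mulrDl; apply: le_trans (lerD (ler_wpM2r (ltW q1') _) IH) _.
    by rewrite addnS; exact: uq.
  by rewrite le_eqVlt exprD exprS; apply/orP; left; apply/eqP; ring.
apply: cauchy_cvg; apply: cauchy_exP => e e0.
have [n nM] := expr_small q0 q1 M0 (mulr_gt0 e0 q1'); exists (u n).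
exists n => // m /= nm; rewrite -ball_normE /= distrC -(subnKC nm).
rewrite -(ltr_pM2r q1'); apply: le_lt_trans (tail _ _) (le_lt_trans _ nM).
by rewrite ler_piMr ?mulr_ge0 ?exprn_ge0// lerBlDr lerDl exprn_ge0.
Qed.

End Geometric.

(** Lets an estimate proved for every constant above a norm pass to the norm itself; [sqrt_one_sub]
    is available only under a strict inequality. For [0 < d <= 1] the square grows by at most
    [d * (2 * n + 1)], and [d] is chosen so that this costs at most [e]. *)
Lemma le_sqrM_gt (R : realType) (n p a : cplx R) : 0 <= n -> 0 <= p ->
  (forall c, n < c -> a <= c ^+ 2 * p) -> a <= n ^+ 2 * p.
Proof.
move=> n0 p0 h; apply/ler_addgt0Pr => e e0.
have d0 : 0 < (2 * n + 1) * p + e.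
  by rewrite ltr_wpDl// mulr_ge0// addr_ge0// mulr_ge0.
pose d := e / ((2 * n + 1) * p + e).
have d1 : d <= 1.
  by rewrite ler_pdivrMr// mul1r lerDr mulr_ge0// addr_ge0// mulr_ge0.
have dp : 0 < d by rewrite divr_gt0.
apply: le_trans (h (n + d) _) _; first by rewrite ltrDl.
have -> : (n + d) ^+ 2 * p = n ^+ 2 * p + d * ((2 * n + d) * p) by ring.
rewrite lerD2l; apply: (@le_trans _ _ (d * ((2 * n + 1) * p + e))); last first.
  by rewrite divfK// gt_eqF.
rewrite ler_wpM2l ?(ltW dp)// -[leLHS]addr0 lerD ?(ltW e0)//.
by rewrite ler_wpM2r// lerD2l.
Qed.

(** * Square roots near 1, and positivity of states *)

Section SquareRoot.
Variables (R : realType) (A : cstarAlg R).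
Local Notation C := (cplx R).

(** A fixed point of [y |-> (x + y * y) / 2] satisfies [(1 - y) ^+ 2 = 1 - 2 y + y ^+ 2 = 1 - x].
    Started at [0], the iteration stays in the ball of radius [r = |x| < 1], where it contracts with
    ratio [r], and all its terms are self-adjoint. *)
Lemma sqrt_one_sub (x : A) : star x = x -> `|x| < 1 ->
  exists2 h : A, star h = h & h * h = 1 - x.
Proof.
move=> sx x1; pose r := `|x|.
have r0 : 0 <= r by rewrite normr_ge0.
pose f (y : A) : A := (2^-1 : C) *: (x + y * y).
pose u n := iter n f 0.
have n2 : `|2^-1 : C| = 2^-1 by rewrite normfV normr_nat.
have h2 (a : C) : 2^-1 * (a + a) = a by field.
have ur n : `|u n| <= r.
  elim: n => [|n IH]; first by rewrite /u /= normr0 normr_ge0.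
  rewrite /u iterS /f normrZ n2 -/(u n).
  rewrite -[leRHS]h2 ler_wpM2l ?invr_ge0 ?ler0n// (le_trans (ler_normD _ _))// lerD//.
  apply: le_trans (cs_normrM _ _) _; apply: le_trans (ler_pM _ _ IH IH) _ => //.
  by rewrite ler_piMr ?r0// ltW.
have ud n : `|u n.+1 - u n| <= r * r ^+ n.
  elim: n => [|n IH].
    by have := ur 1%N; rewrite expr0 mulr1 [u 0%N](_ : _ = 0)// subr0.
  rewrite [u n.+2]/(f (u n.+1)) [in X in _ - X](_ : u n.+1 = f (u n))// /f.
  rewrite -scalerBr normrZ n2 opprD addrACA subrr add0r.
  rewrite (_ : u n.+1 * u n.+1 - u n * u n =
     u n.+1 * (u n.+1 - u n) + (u n.+1 - u n) * u n); last first.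
    by rewrite mulrBr mulrBl addrA subrK.
  rewrite -[leRHS]h2 ler_wpM2l ?invr_ge0 ?ler0n// (le_trans (ler_normD _ _))//.
  rewrite [r ^+ n.+1]exprS lerD// (le_trans (cs_normrM _ _))//.
    by apply: ler_pM.
  by rewrite mulrC; apply: ler_pM.
have cu : cvgn u := geometric_cvg r0 x1 ud.
set y := limn u in cu *.
have fy : f y = y.
  have c1 : (f \o u) @ \oo --> f y.
    apply: cvgZr; apply: cvgD; first exact: cvg_cst.
    apply: (cvg_comp u (fun y => y * y) cu).
    by apply: cs_mul_cvg => z; exact: cvg_id.
  have c2 : (fun n => u n.+1) @ \oo --> y by rewrite cvg_shiftS.
  exact: (cvg_unique _ c1 c2).
have sy : star y = y.
  have su n : star (u n) = u n.
    elim: n => [|n IH]; first exact: star0.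
    rewrite /u iterS -/(u n) /f starZ starD starM IH sx.
    by rewrite conjc_ge0 ?invr_ge0 ?ler0n.
  have := cvg_comp u (@star R A) cu (@star_continuous R A y).
  rewrite (_ : _ \o u = u); last by apply/funext => n; exact: su.
  by move=> c; exact: (cvg_unique _ c cu).
exists (1 - y); first by rewrite starB star1 sy.
have xy : x + y * y = y + y.
  rewrite -{3 4}fy /f -scalerDl -[LHS]scale1r; congr (_ *: _).
  by rewrite -[LHS]h2; field.
have -> : x = y + y - y * y by rewrite -xy addrK.
by rewrite mulrBl mul1r mulrBr mulr1 !opprB opprD -addrA; congr (_ + _);
  rewrite addrCA.
Qed.

End SquareRoot.

Section States.
Variables (R : realType) (A : cstarAlg R) (phi : A -> cplx R).
Local Notation C := (cplx R).
Hypothesis phiP : state phi.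
Implicit Types x y : A.

Lemma stateZ (k : C) x : phi (k *: x) = k * phi x.
Proof.
case: phiP => l _ _; have p0 : phi 0 = 0.
  by have := l 1 0 0; rewrite scale1r addr0 mul1r -{1}[phi 0]addr0 => /addrI.
by have := l k x 0; rewrite p0 !addr0.
Qed.

Lemma state0 : phi 0 = 0.
Proof. by rewrite -(scale0r 0) stateZ mul0r. Qed.

Lemma stateD x y : phi (x + y) = phi x + phi y.
Proof. by case: phiP => l _ _; have := l 1 x y; rewrite scale1r mul1r. Qed.

Lemma stateB x y : phi (x - y) = phi x - phi y.
Proof. by rewrite stateD -scaleN1r stateZ mulN1r. Qed.

Lemma state_sum I (r : seq I) (P : pred I) (F : I -> A) :
  phi (\sum_(i <- r | P i) F i) = \sum_(i <- r | P i) phi (F i).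
Proof. exact: (big_morph _ stateD state0). Qed.

Lemma state_ge0 x : 0 <= phi (star x * x).
Proof. by case: phiP. Qed.

(** For [c > |y|] and [b = y / c], the element [1 - star b * b] is a square [h * h] with [h]
    self-adjoint, so the bound with [c] in place of [|y|] has slack
    [c ^+ 2 * phi (star (h * x) * (h * x))]. *)
Lemma state_norm_le x y :
  phi (star x * (star y * y) * x) <= `|y| ^+ 2 * phi (star x * x).
Proof.
have key (c : C) : `|y| < c ->
    phi (star x * (star y * y) * x) <= c ^+ 2 * phi (star x * x).
  move=> yc; have c0 : 0 < c := le_lt_trans (normr_ge0 _) yc.
  have c2 : c ^+ 2 != 0 by rewrite expf_neq0// gt_eqF.
  pose b := c^-1 *: y.
  have cr : conjc c = c by rewrite conjc_ge0// ltW.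
  have bE : star y * y = c ^+ 2 *: (star b * b).
    rewrite /b starZ -scalerAl -scalerAr !scalerA conjc_ge0 ?invr_ge0 ?ltW//.
    by rewrite -mulrA -invfM -expr2 divff// scale1r.
  have [| |h hs hh] := @sqrt_one_sub R A (star b * b).
  - by rewrite starM starK.
  - rewrite normC expr_lt1// normrZ ger0_norm ?invr_ge0 ?ltW//.
    by rewrite mulrC ltr_pdivrMr// mul1r.
  - rewrite bE -scalerAr -scalerAl stateZ ler_pM2l ?exprn_gt0//.
    rewrite -subr_ge0 -stateB -mulrBl -[X in X - _]mulr1 -mulrBr -hh.
    by rewrite -{1}hs mulrA -mulrA -starM state_ge0.
by apply: le_sqrM_gt => //; rewrite state_ge0.
Qed.

End States.

(** * Functions with values in a C*-algebra *)

Section FunctionAlgebras.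
Variables (R : realType) (X : compactType) (B : cstarAlg R).
Local Notation C := (cplx R).
Local Notation CX := (cfun_cstar X B).
Implicit Types (f g : CX) (x : X).

Definition mkcfun (u : X -> B) (cu : continuous u) : CX := @CFun R X (cs_space B) u cu.

Lemma ev_continuous f : continuous (ev f).
Proof. exact: (@cfunP R X (cs_space B) f). Qed.

Lemma ev_ext f g : ev f =1 ev g -> f = g.
Proof. by move=> h; apply: (@cfun_eqP R X (cs_space B)). Qed.

Lemma evD f g x : ev (f + g) x = ev f x + ev g x. Proof. by []. Qed.
Lemma evB f g x : ev (f - g) x = ev f x - ev g x. Proof. by []. Qed.
Lemma evZ (k : C) f x : ev (k *: f) x = k *: ev f x. Proof. by []. Qed.
Lemma evM f g x : ev (f * g) x = ev f x * ev g x. Proof. by []. Qed.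
Lemma ev0 x : ev (0 : CX) x = 0. Proof. by []. Qed.
Lemma ev1 x : ev (1 : CX) x = 1. Proof. by []. Qed.
Lemma ev_star f x : ev (star f) x = star (ev f x). Proof. by []. Qed.

Lemma ev_sum I (r : seq I) (P : pred I) (F : I -> CX) x :
  ev (\sum_(i <- r | P i) F i) x = \sum_(i <- r | P i) ev (F i) x.
Proof. exact: (big_morph (fun f : CX => ev f x) (fun f g => evD f g x) (ev0 x)). Qed.

Lemma ev_norm_le f x : `|ev f x| <= `|f|.
Proof. exact: (@le_cfun_norm R X (cs_space B) f x). Qed.

Lemma norm_le_ev f (c : C) : (forall x, `|ev f x| <= c) -> `|f| <= c.
Proof. exact: cfun_norm_le. Qed.

Lemma ev_mkcfun (u : X -> B) (cu : continuous u) x : ev (mkcfun cu) x = u x.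
Proof. by []. Qed.

Definition cstf (b : B) : CX := mkcfun (fun x => cvg_cst b).

End FunctionAlgebras.
Arguments ev_continuous {R X B} f x.

(** * Partitions of unity *)

Section PartitionOfUnity.
Variables (R : realType) (X : compactType).
Local Notation C := (cplx R).
Local Notation CX := (cfun_cstar X (cplx_cstar R)).

Lemma realC_continuous : continuous (fun a : R => a%:C%C : C).
Proof.
move=> a; apply/(@cvgrPdist_lt C C^o) => e e0.
have eE := cplx_real (ltW e0).
have e0' : 0 < complex.Re e by rewrite -cplx_lt -eE.
near=> b; rewrite eE -[X in `|X|](rmorphB (real_complex R)).
apply: le_lt_trans (norm_cplx_le (a - b) 0) _; rewrite cplx_lt normr0 addr0.
by near: b; exact: cvgr_dist_lt.
Unshelve. all: by end_near. Qed.

Lemma realCf_subproof (u : X -> R) (cu : continuous u) :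
  continuous (fun x => (u x)%:C%C : cplx_cstar R).
Proof. by move=> x; apply: continuous_comp; [exact: cu|exact: realC_continuous]. Qed.

Definition realCf (u : X -> R) (cu : continuous u) : CX :=
  mkcfun (realCf_subproof cu).

Lemma finite_positive_subfamily (I : choiceType) (D : set I) (h : I -> X -> R) :
  (forall i, continuous (h i)) -> (forall i x, 0 <= h i x) ->
  (forall x, exists2 i, D i & 0 < h i x) ->
  exists n (s : 'I_n -> I), (forall j, D (s j)) /\ forall x, 0 < \sum_j h (s j) x.
Proof.
move=> ch h0 hD.
have := @compact_setT X; rewrite compact_cover.
move=> /(_ _ D (fun i => [set x | 0 < h i x])) [].
- move=> i _; apply: (@open_comp _ _ (h i) [set t | 0 < t]); last exact: open_gt.
  by move=> x _; exact: ch.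
- by move=> x _; have [i Di hi] := hD x; exists i.
move=> D' D'D cov; exists (size (finmap.enum_fset D')), (tnth (in_tuple (finmap.enum_fset D'))).
split=> [j|x].
  apply/set_mem/D'D; exact: mem_tnth.
have [i iD' hi] := cov x Logic.I.
have /tnthP[j ij] : i \in in_tuple (finmap.enum_fset D') by exact: iD'.
rewrite (bigD1 j)//= -ij ltr_wpDr// sumr_ge0// => k _; exact: h0.
Qed.

Lemma pou_subproof n (h : 'I_n -> X -> R) (ch : forall j, continuous (h j))
  (h0 : forall x, 0 < \sum_j h j x) j : continuous (fun x => h j x / \sum_i h i x).
Proof.
move=> x; apply: cvgM; first exact: ch.
apply: cvgV; first by rewrite gt_eqF.
by apply: cvg_big => // [|i _]; [exact: add_continuous|exact: ch].
Qed.

Definition pou n (h : 'I_n -> X -> R) (ch : forall j, continuous (h j))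
  (h0 : forall x, 0 < \sum_j h j x) (j : 'I_n) : CX := realCf (@pou_subproof n h ch h0 j).

Lemma pou_ge0 n (h : 'I_n -> X -> R) ch (h0 : forall x, 0 < \sum_j h j x) j x :
  (forall j x, 0 <= h j x) -> (0 : C) <= ev (pou ch h0 j) x.
Proof. by move=> hp; rewrite cplx_le divr_ge0// ltW. Qed.

Lemma pou_sum n (h : 'I_n -> X -> R) ch (h0 : forall x, 0 < \sum_j h j x) x :
  \sum_j (ev (pou ch h0 j) x : C) = 1.
Proof.
rewrite -(rmorph_sum (real_complex R)) -mulr_suml divff// gt_eqF//.
Qed.

Lemma pou_neq0 n (h : 'I_n -> X -> R) ch (h0 : forall x, 0 < \sum_j h j x) j x :
  (ev (pou ch h0 j) x : C) != 0 -> h j x != 0.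
Proof. by apply: contra_neq => hx; rewrite /pou ev_mkcfun hx mul0r. Qed.

(* The weights are supported where [d] to the base point is less than [e];    *)
(* taking [d x y := |f x - f y|] makes a metric on [X] unnecessary.           *)
Lemma partition_of_unity (d : X -> X -> R) (e : R) : 0 < e ->
  (forall y, continuous (d ^~ y)) -> (forall x, d x x = 0) ->
  exists n (y : 'I_n -> X) (p : 'I_n -> CX),
  [/\ forall j x, (0 : C) <= ev (p j) x, forall x, \sum_j (ev (p j) x : C) = 1
    & forall j x, (ev (p j) x : C) != 0 -> d x (y j) < e].
Proof.
move=> e0 cd d0; pose h (y x : X) := Num.max 0 (e - d x y).
have ch y : continuous (h y).
  move=> x; apply: (@continuous_max R X (fun=> 0) (fun x => e - d x y)).
    exact: cvg_cst.
  by apply: (@cvgB R R^o); [exact: cvg_cst|exact: cd].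
have h0 y x : 0 <= h y x by rewrite le_max lexx.
have [|n [s [_ s0]]] := @finite_positive_subfamily X setT h ch h0.
  by move=> x; exists x => //; rewrite /h d0 subr0 lt_max e0 orbT.
exists n, s, (pou (fun j => ch (s j)) s0); split=> [j x|x|j x].
- exact: pou_ge0.
- exact: pou_sum.
move=> /pou_neq0; apply: contraNT; rewrite -leNgt => de.
by apply/eqP/max_idPl; rewrite subr_le0.
Qed.

Lemma convex_comb_norm_le (V : normedModType C) n (p : 'I_n -> C) (v : 'I_n -> V) (c : C) :
  0 <= c -> (forall j, 0 <= p j) -> \sum_j p j = 1 -> (forall j, p j != 0 -> `|v j| <= c) ->
  `|\sum_j p j *: v j| <= c.
Proof.
move=> c0 p0 p1 vc; apply: le_trans (ler_norm_sum _ _ _) _.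
rewrite -[leRHS]mul1r -p1 mulr_suml; apply: ler_sum => j _.
rewrite normrZ ger0_norm//; have [->|pj] := eqVneq (p j) 0; first by rewrite !mul0r.
by rewrite ler_wpM2l// vc.
Qed.

End PartitionOfUnity.

Section TensorWithFunctions.
Variables (R : realType) (X : compactType).
Local Notation C := (cplx R).
Local Notation CX := (cfun_cstar X (cplx_cstar R)).

Lemma tens_cfun_subproof (A : cstarAlg R) (a : A) (h : CX) :
  continuous (fun x => (ev h x : C) *: a).
Proof.
move=> x; have H : (fun x => ev h x : C^o) @ x --> (ev h x : C^o).
  exact: (ev_continuous h x).
exact: (cvgZ H (cvg_cst a)).
Qed.

Definition tens_cfun (A : cstarAlg R) (a : A) (h : CX) : cfun_cstar X A :=
  mkcfun (@tens_cfun_subproof A a h).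

Lemma ev_tens_cfun (A : cstarAlg R) (a : A) (h : CX) x :
  ev (tens_cfun a h) x = (ev h x : C) *: a.
Proof. by []. Qed.

Lemma cfun_approx (A : cstarAlg R) (f : cfun_cstar X A) (e : C) : 0 < e ->
  exists n (y : 'I_n -> X) (p : 'I_n -> CX),
  [/\ forall j x, (0 : C) <= ev (p j) x, forall x, \sum_j (ev (p j) x : C) = 1
    & `|f - \sum_j tens_cfun (ev f (y j)) (p j)| <= e].
Proof.
move=> e0; pose d x y : R := complex.Re `|ev f x - ev f y|.
have e0' : 0 < complex.Re e by rewrite -cplx_lt -(cplx_real (ltW e0)).
have [| |n [y [p [p0 p1 pd]]]] := partition_of_unity (d := d) e0'.
- move=> y x.
  apply: (@continuous_comp _ _ _ (fun x => `|ev f x - ev f y|)).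
    apply: continuous_comp; last exact: norm_continuous.
    by apply: cvgB; [exact: (ev_continuous f x)|exact: cvg_cst].
  exact: (@Re_continuous R _).
- by move=> x; rewrite /d subrr normr0.
exists n, y, p; split=> //; apply: norm_le_ev => x.
rewrite evB ev_sum -[ev f x]scale1r -(p1 x) scaler_suml -sumrB.
under eq_bigr do rewrite ev_tens_cfun -scalerBr.
apply: convex_comb_norm_le => // [|j /pd]; first exact: ltW.
by rewrite -cplx_lt -(cplx_real (ltW e0)) -cplx_real// => /ltW.
Qed.

End TensorWithFunctions.

(** * C(X, A) as the minimal tensor product of A and C(X) *)

Section MinimalTensor.
Variables (R : realType).
Local Notation C := (cplx R).

(* Holds in every C*-algebra; here it is obtained from faithful representations and inherited by function algebras. *)
Definition enough_states (A : cstarAlg R) : Prop := forall (a : A) (c : C), 0 <= c ->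
  (forall phi : A -> C, state phi ->
     forall x : A, phi (star x * (star a * a) * x) <= c ^+ 2 * phi (star x * x)) ->
  `|a| <= c.

Lemma enough_states_C : enough_states (cplx_cstar R).
Proof.
move=> a c c0 /(_ id) h.
have sid : state (A := cplx_cstar R) (id : cplx_cstar R -> C).
  split=> // x; rewrite [X in _ <= X](_ : _ = `|x : C| ^+ 2) ?exprn_ge0//.
  by rewrite [RHS]sqr_normc mulrC.
have := h sid 1; rewrite star1 !mul1r !mulr1 => ha.
rewrite -(@ler_pXn2r _ 2) ?nnegrE// -normC.
apply: le_trans ha; rewrite le_eqVlt; apply/orP; left; apply/eqP.
by have /(@ger0_norm C) := state_ge0 sid a.
Qed.

Section Space.
Variables (X : compactType).
Local Notation CX := (cfun_cstar X (cplx_cstar R)).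

Lemma state_ev (A : cstarAlg R) (phi : A -> C) (x : X) :
  state phi -> state (fun f : cfun_cstar X A => phi (ev f x)).
Proof.
move=> sp; split=> [k f g|f|]; last by case: sp.
- by rewrite evD evZ (stateD sp) (stateZ sp).
- exact: (state_ge0 sp).
Qed.

Lemma enough_states_cfun (A : cstarAlg R) : enough_states A -> enough_states (cfun_cstar X A).
Proof.
move=> eA f c c0 h; apply: norm_le_ev => x; apply: eA => // phi sp a.
exact: (h _ (state_ev x sp) (cstf X a)).
Qed.

(** States are positive by definition on elements [star q * q]; a nonnegative function is one of
    these, with [q] its pointwise square root. *)
Lemma state_cfun_ge0 (psi : CX -> C) (F : CX) : state psi ->
  (forall x, (0 : C) <= ev F x) -> 0 <= psi F.
Proof.
move=> sp F0; have cF : continuous (fun x => Num.sqrt (complex.Re (ev F x : C))).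
  move=> x; apply: continuous_comp; last exact: sqrt_continuous.
  by apply: continuous_comp; [exact: (ev_continuous F x)|exact: (@Re_continuous R _)].
rewrite (_ : F = star (realCf cF) * realCf cF) ?(state_ge0 sp)//.
apply: ev_ext => x; rewrite evM ev_star.
rewrite [LHS](cplx_real (F0 x)).
have F0' : 0 <= complex.Re (ev F x : C) by rewrite -cplx_le -cplx_real.
rewrite -{1}(sqr_sqrtr F0') expr2 rmorphM; congr (_ * _).
by rewrite ev_mkcfun /star /= oppr0.
Qed.

Lemma state_ev_cplx (x : X) : state (fun f : CX => (ev f x : C)).
Proof.
split=> // f; rewrite evM ev_star [X in _ <= X](_ : _ = `|ev f x : C| ^+ 2) ?exprn_ge0//.
by rewrite [RHS]sqr_normc mulrC.
Qed.

(** Under [A (x) C(X) = C(X, A)] the vector [\sum_i u i (x) v i] becomes the function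
    [w s = \sum_i v i s *: u i], and its GNS square norm is [psi] of [s |-> phi (star (w s) * w s)].
    Spatial estimates thereby become pointwise ones. *)
Lemma gns_sqnorm_cfun (A : cstarAlg R) (phi : A -> C) (psi : CX -> C) (I : finType)
    (u : I -> A) (v : I -> CX) : state phi -> state psi ->
  exists2 G : CX, gns_sqnorm phi psi u v = psi G &
    forall s, (ev G s : C) = phi (star (\sum_i (ev (v i) s : C) *: u i) *
                                  (\sum_i (ev (v i) s : C) *: u i)).
Proof.
move=> sphi spsi.
exists (\sum_i \sum_j (phi (star (u i) * u j) : C) *: (star (v i) * v j)).
  rewrite (state_sum spsi); apply: eq_bigr => i _.
  by rewrite (state_sum spsi); apply: eq_bigr => j _; rewrite (stateZ spsi).
move=> s; rewrite star_sum mulr_suml (state_sum sphi) ev_sum; apply: eq_bigr => i _.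
rewrite mulr_sumr (state_sum sphi) ev_sum; apply: eq_bigr => j _.
rewrite starZ -scalerAl -scalerAr !(stateZ sphi) evZ evM ev_star.
by rewrite [LHS]mulrC -mulrA.
Qed.

(** That the sup norm dominates the spatial norm is [state_norm_le] at each point, to which the
    positive functional [psi] is applied. For the converse, the point evaluations are enough states
    of C(X), and [eA] supplies those of [A]. *)
Lemma tens_cfun_min (A : cstarAlg R) : enough_states A -> is_min_tensor (@tens_cfun R X A).
Proof.
move=> eA; split.
- split=> [a k h1 h2|h k a1 a2]; apply: ev_ext => x.
    by rewrite evD evZ !ev_tens_cfun evD evZ scalerDl scalerA.
  by rewrite evD evZ !ev_tens_cfun scalerDr !scalerA mulrC.
- move=> a a' b b'; apply: ev_ext => x.
  by rewrite evM !ev_tens_cfun evM -scalerAl -scalerAr scalerA.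
- split=> [|a b]; apply: ev_ext => x; first by rewrite ev_tens_cfun scale1r.
  by rewrite ev_star !ev_tens_cfun starZ.
- apply/denseP_norm => f e e0.
  have e2 : 0 < e / 2 by rewrite divr_gt0.
  have [n [y [p [_ _ fp]]]] := cfun_approx f e2.
  exists (\sum_j tens_cfun (ev f (y j)) (p j)); last first.
    by apply: le_lt_trans fp _; rewrite ltr_pdivrMr// ltr_pMr// ltr1n.
  exists n, (fun=> 1), (fun j => tens_cfun (ev f (y j)) (p j)); split.
    by move=> j; eexists; eexists.
  by apply: eq_bigr => j _; rewrite scale1r.
move=> n a b N; split.
  move=> phi psi sphi spsi m x y.
  have [G1 -> G1E] := gns_sqnorm_cfun (fun p : 'I_n * 'I_m => a p.1 * x p.2)
     (fun p : 'I_n * 'I_m => b p.1 * y p.2) sphi spsi.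
  have [G2 -> G2E] := gns_sqnorm_cfun x y sphi spsi.
  rewrite -subr_ge0 -(stateZ spsi) -(stateB spsi); apply: state_cfun_ge0 => // s.
  rewrite evB evZ G1E G2E subr_ge0.
  rewrite -(pair_bigA _ (fun i k => (ev (b i * y k) s : C) *: (a i * x k)))/=.
  set w := \sum_i (ev (y i) s : C) *: x i.
  have -> : \sum_i \sum_j (ev (b i * y j) s : C) *: (a i * x j) =
            ev (\sum_i tens_cfun (a i) (b i)) s * w.
    rewrite ev_sum mulr_suml; apply: eq_bigr => i _; rewrite mulr_sumr.
    apply: eq_bigr => j _.
    by rewrite ev_tens_cfun evM -scalerAl -scalerAr scalerA.
  rewrite starM -mulrA [star _ * (_ * w)]mulrA [star w * _]mulrA.
  apply: le_trans (state_norm_le sphi _ _) _.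
  apply: (@ler_wpM2r C); first exact: (state_ge0 sphi).
  by rewrite !expr2; apply: ler_pM => //; exact: ev_norm_le.
move=> c c0 h; apply: norm_le_ev => s; apply: eA => // phi sphi x.
(* The single vector [x (x) 1], under [phi] and evaluation at [s], sees exactly the value of the sum
   at [s]. *)
have := h _ _ sphi (state_ev_cplx s) 1 (fun=> x) (fun=> 1).
have [G1 -> ->] := gns_sqnorm_cfun (fun p : 'I_n * 'I_1 => a p.1 * x)
   (fun p : 'I_n * 'I_1 => b p.1 * 1) sphi (state_ev_cplx s).
have [G2 -> ->] := gns_sqnorm_cfun (fun _ : 'I_1 => x) (fun=> 1) sphi (state_ev_cplx s).
rewrite big_ord1 ev1 scale1r.
rewrite -(pair_bigA _ (fun i k => (ev (b i * 1) s : C) *: (a i * x)))/=.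
have -> : \sum_i \sum_(j < 1) (ev (b i * 1) s : C) *: (a i * x) =
            ev (\sum_i tens_cfun (a i) (b i)) s * x.
  rewrite ev_sum mulr_suml; apply: eq_bigr => i _.
  by rewrite big_ord1 mulr1 scalerAl.
by rewrite starM -mulrA [star _ * (_ * x)]mulrA [star x * _]mulrA.
Qed.

Definition cfun_tensor (A : cstarAlg R) (eA : enough_states A) : minTensor A CX :=
  MinTensor (tens_cfun_min eA).

End Space.
End MinimalTensor.

(** * Functions of two variables *)

Section Currying.
Variables (R : realType) (X Y : compactType) (D : cstarAlg R).
Local Notation C := (cplx R).

Lemma cf2_subproof1 (u : Y -> X -> D) (cu : continuous (fun p : Y * X => u p.1 p.2)) y :
  continuous (u y).
Proof.
move=> x; apply: (@continuous_comp _ _ _ (fun x => (y, x)) (fun p : Y * X => u p.1 p.2)).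
  by apply: cvg_pair; [exact: cvg_cst|exact: cvg_id].
exact: cu.
Qed.

(** Continuity of [y |-> u y] in the sup norm asks for a neighbourhood of [y0] that serves all [x]
    at once; compactness of [X] provides it. *)
Lemma cf2_subproof (u : Y -> X -> D) (cu : continuous (fun p : Y * X => u p.1 p.2)) :
  continuous (fun y => mkcfun (@cf2_subproof1 u cu y) : cfun_cstar X D).
Proof.
move=> y0; apply/cvgrPdist_le => e e0.
have /compact_near_coveringP cX := @compact_setT X.
have e2 : 0 < e / 2 by rewrite divr_gt0.
suff : \forall y \near y0, [set: X] `<=` (fun x => `|u y0 x - u y x| < e).
  apply: filterS => y h; apply: norm_le_ev => x; apply/ltW; exact: h.
apply: (cX Y (nbhs y0) (fun y x => `|u y0 x - u y x| < e)) => x _.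
  have /cvgrPdist_lt/(_ _ e2) [[U V] /= [Uy Vx] UV] := cu (y0, x).
  exists (V, U) => //= -[x' y] [/= Vx' Uy'].
  have h1 := UV (y0, x') (conj (nbhs_singleton Uy) Vx').
  have h2 := UV (y, x') (conj Uy' Vx').
  apply: (distm_lt_split (z := u y0 x)) => //; rewrite distrC; exact: h1.
Qed.

Definition cf2 (u : Y -> X -> D) (cu : continuous (fun p : Y * X => u p.1 p.2)) :
  cfun_cstar Y (cfun_cstar X D) := mkcfun (@cf2_subproof u cu).

Lemma ev_cf2 u cu y x : ev (ev (@cf2 u cu) y) x = u y x.
Proof. by []. Qed.

Lemma ev2_continuous (F : cfun_cstar Y (cfun_cstar X D)) :
  continuous (fun p : Y * X => ev (ev F p.1) p.2).
Proof.
move=> [y x]; apply/cvgrPdist_lt => e e0.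
have e2 : 0 < e / 2 by rewrite divr_gt0.
have /cvgrPdist_lt/(_ _ e2) h1 := ev_continuous F y.
have /cvgrPdist_lt/(_ _ e2) h2 := ev_continuous (ev F y) x.
exists ([set y' | `|ev F y - ev F y'| < e / 2],
        [set x' | `|ev (ev F y) x - ev (ev F y) x'| < e / 2]) => //=.
move=> [y' x'] [/= hy hx]; apply: (distm_lt_split (z := ev (ev F y) x')) => //.
by apply: le_lt_trans hy; exact: (ev_norm_le (ev F y - ev F y')).
Qed.

Lemma ev2_ext (F G : cfun_cstar Y (cfun_cstar X D)) :
  (forall y x, ev (ev F y) x = ev (ev G y) x) -> F = G.
Proof. by move=> h; apply: ev_ext => y; apply: ev_ext => x; exact: h. Qed.

Lemma ev2B (F G : cfun_cstar Y (cfun_cstar X D)) y x :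
  ev (ev (F - G) y) x = ev (ev F y) x - ev (ev G y) x.
Proof. by []. Qed.

Lemma ev2_sum I (r : seq I) (P : pred I) (F : I -> cfun_cstar Y (cfun_cstar X D)) y x :
  ev (ev (\sum_(i <- r | P i) F i) y) x = \sum_(i <- r | P i) ev (ev (F i) y) x.
Proof. by rewrite ev_sum ev_sum. Qed.

Lemma norm_le_ev2 (F : cfun_cstar Y (cfun_cstar X D)) c :
  (forall y x, `|ev (ev F y) x| <= c) -> `|F| <= c.
Proof. by move=> h; apply: norm_le_ev => y; apply: norm_le_ev => x; exact: h. Qed.

Lemma ev2_norm_le (F : cfun_cstar Y (cfun_cstar X D)) y x : `|ev (ev F y) x| <= `|F|.
Proof. exact: le_trans (ev_norm_le _ _) (ev_norm_le _ _). Qed.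

End Currying.

Section StarHoms.
Variables (R : realType).
Local Notation C := (cplx R).
Implicit Types (A B D : cstarAlg R).

Lemma contractive_continuous A B (f : A -> B) : linear f ->
  (forall x, `|f x| <= `|x|) -> continuous f.
Proof.
move=> lf fc x; apply/cvgrPdist_lt => e e0.
have fB y : f x - f y = f (x - y).
  by rewrite addrC -scaleN1r -[LHS]lf scaleN1r addrC.
have /cvgrPdist_lt/(_ _ e0) := @cvg_id _ (nbhs x).
by apply: filterS => y; rewrite fB; exact: le_lt_trans.
Qed.

Lemma star_hom_comp A B D (f : A -> B) (g : B -> D) :
  unital_star_hom f -> unital_star_hom g -> unital_star_hom (g \o f).
Proof.
move=> [f1 f2 f3 f4] [g1 g2 g3 g4]; split=> [k x y|x y||x] /=.
- by rewrite f1 g1.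
- by rewrite f2 g2.
- by rewrite f3 g3.
- by rewrite f4 g4.
Qed.

Lemma star_iso_id A : star_iso (@id A).
Proof. by split; [split | exists id]. Qed.

Section Map.
Variables (X : compactType) (A B : cstarAlg R) (g : A -> B) (cg : continuous g).

Lemma cmap_subproof (f : cfun_cstar X A) : continuous (fun x => g (ev f x)).
Proof. by move=> x; apply: continuous_comp; [exact: (ev_continuous f x)|exact: cg]. Qed.

Definition cmap (f : cfun_cstar X A) : cfun_cstar X B := mkcfun (@cmap_subproof f).

Lemma ev_cmap f x : ev (cmap f) x = g (ev f x). Proof. by []. Qed.

Lemma cmap_hom : unital_star_hom g -> unital_star_hom cmap.
Proof.
move=> [g1 g2 g3 g4]; split=> [k u v|u v||u]; apply: ev_ext => x.
- by rewrite evD evZ !ev_cmap evD evZ g1.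
- by rewrite evM !ev_cmap evM g2.
- by rewrite ev_cmap g3.
- by rewrite ev_star !ev_cmap ev_star g4.
Qed.
End Map.

End StarHoms.

Section Swap.
Variables (R : realType) (X Y : compactType) (D : cstarAlg R).

Lemma cswap_subproof (F : cfun_cstar Y (cfun_cstar X D)) :
  continuous (fun p : X * Y => ev (ev F p.2) p.1).
Proof.
move=> [x y]; apply: (@continuous_comp _ _ _ (fun p : X * Y => (p.2, p.1))
   (fun p : Y * X => ev (ev F p.1) p.2)); last exact: (@ev2_continuous R X Y D F).
by apply: cvg_pair; [exact: cvg_snd|exact: cvg_fst].
Qed.

Definition cswap (F : cfun_cstar Y (cfun_cstar X D)) : cfun_cstar X (cfun_cstar Y D) :=
  @cf2 R Y X D (fun x y => ev (ev F y) x) (@cswap_subproof F).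

Lemma cuncurry_subproof (F : cfun_cstar Y (cfun_cstar X D)) :
  continuous (fun p : X * Y => ev (ev F p.2) p.1 : D).
Proof. exact: cswap_subproof. Qed.

Definition cuncurry (F : cfun_cstar Y (cfun_cstar X D)) : cfun_cstar (X * Y)%type D :=
  mkcfun (@cuncurry_subproof F).

Lemma ev_cuncurry F x y : ev (cuncurry F) (x, y) = ev (ev F y) x. Proof. by []. Qed.

Lemma ccurry_subproof (F : cfun_cstar (X * Y)%type D) :
  continuous (fun p : Y * X => ev F (p.2, p.1)).
Proof.
move=> [y x]; apply: (@continuous_comp _ _ _ (fun p : Y * X => (p.2, p.1)) (ev F)).
  by apply: cvg_pair; [exact: cvg_snd|exact: cvg_fst].
exact: (ev_continuous F (x, y)).
Qed.

Definition ccurry (F : cfun_cstar (X * Y)%type D) : cfun_cstar Y (cfun_cstar X D) :=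
  @cf2 R X Y D (fun y x => ev F (x, y)) (@ccurry_subproof F).

Lemma cuncurryK : cancel cuncurry ccurry.
Proof. by move=> F; apply: ev2_ext. Qed.

Lemma ccurryK : cancel ccurry cuncurry.
Proof. by move=> F; apply: ev_ext => -[x y]. Qed.

Lemma cuncurry_hom : unital_star_hom cuncurry.
Proof. by split=> [k u v|u v||u]; apply: ev_ext => -[x y]. Qed.

Lemma ccurry_hom : unital_star_hom ccurry.
Proof. by split=> [k u v|u v||u]; apply: ev2_ext. Qed.

Lemma ccurry_norm F : `|ccurry F| = `|F|.
Proof.
apply/eqP; rewrite eq_le; apply/andP; split.
  by apply: norm_le_ev2 => y x; exact: (ev_norm_le F (x, y)).
by apply: norm_le_ev => -[x y]; exact: (ev2_norm_le (ccurry F) y x).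
Qed.

Lemma cuncurry_iso : star_iso cuncurry.
Proof. by split; [exact: cuncurry_hom|exists ccurry; [exact: cuncurryK|exact: ccurryK]]. Qed.
End Swap.

Lemma cswap_iso (R : realType) (X Y : compactType) (D : cstarAlg R) : star_iso (@cswap R X Y D).
Proof.
split; first by split=> [k u v|u v||u]; apply: ev2_ext.
by exists (@cswap R Y X D) => F; apply: ev2_ext.
Qed.

Section Transport.
Variables (R : realType).
Local Notation C := (cplx R).
Variables (A Q0 T0 Q T : cstarAlg R) (t0 : A -> Q0 -> T0).
Variables (j : T0 -> T) (k : Q -> Q0) (k' : Q0 -> Q).
Hypotheses (mt0 : is_min_tensor t0) (hj : unital_star_hom j)
  (nj : forall x, `|j x| = `|x|) (sj : forall y, exists x, j x = y)
  (hk : unital_star_hom k) (kK : cancel k k') (k'K : cancel k' k).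

Lemma star_hom_sum (A1 A2 : cstarAlg R) (f : A1 -> A2) I (r : seq I) (P : pred I) F :
  linear f -> f (\sum_(i <- r | P i) F i) = \sum_(i <- r | P i) f (F i).
Proof.
move=> lf; have f0 : f 0 = 0.
  have := lf 1 0 0; rewrite !scale1r addr0 -{1}[f 0]addr0.
  by move/addrI.
by apply: (big_morph f _ f0) => x y; have := lf 1 x y; rewrite !scale1r.
Qed.

Lemma state_comp (A1 A2 : cstarAlg R) (f : A1 -> A2) (phi : A2 -> C) :
  unital_star_hom f -> state phi -> state (phi \o f).
Proof.
move=> [f1 f2 f3 f4] sp; split=> [c x y|x|] /=.
- by rewrite f1 (stateD sp) (stateZ sp).
- by rewrite f2 f4 (state_ge0 sp).
- by rewrite f3; case: sp.
Qed.

Let hk' : unital_star_hom k'.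
Proof.
case: hk => k1 k2 k3 k4; split=> [c x y|x y||x]; apply: (can_inj kK).
- by rewrite k1 !k'K.
- by rewrite k2 !k'K.
- by rewrite k3 k'K.
- by rewrite k4 !k'K.
Qed.

(** The spatial norm sees [Q] only through its states, and these correspond to the states of [Q0] by
    composition with [k] and [k']. The application is [A (x) (H (x) H)], where [H (x) H] is C(S^1,
    C(S^1)) while the product is readily formed with C(S^1 x S^1). *)
Lemma min_tensor_transport : is_min_tensor (fun a q => j (t0 a (k q))).
Proof.
case: mt0 => -[lin1 lin2] tM [t1 ts] dt tn; case: (hj) => j1 j2 j3 j4.
case: (hk) => k1 k2 k3 k4; case: (hk') => k'1 k'2 k'3 k'4.
split.
- split=> [a c x y|q c x y]; first by rewrite k1 lin1 j1.
  by have := lin2 (k q) c x y => /= ->; rewrite j1.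
- by move=> *; rewrite -j2 tM k2.
- by split=> [|a b]; [rewrite k3 t1 j3|rewrite -j4 ts k4].
- apply/denseP_norm => y e e0; have [x <-] := sj y.
  have /denseP_norm/(_ x e e0) [z [n [c [v [vS ->]]]] xz] := dt.
  exists (j (\sum_(i < n) c i *: v i)).
    exists n, c, (j \o v); split=> [i|].
      have [a [b vE]] := vS i; exists a, (k' b); by rewrite /= vE k'K.
    rewrite (@star_hom_sum _ _ j _ _ _ _ j1); apply: eq_bigr => i _ /=.
    have j0 : j 0 = 0 by have := nj 0; rewrite normr0 => /eqP; rewrite normr_eq0 => /eqP.
    by have := j1 (c i) (v i) 0; rewrite !addr0 j0 addr0.
  have -> : j x - j (\sum_(i < n) c i *: v i) = j (x - \sum_(i < n) c i *: v i).
    by rewrite addrC -scaleN1r -[LHS]j1 scaleN1r addrC.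
  by rewrite nj.
move=> n a b N; have [t2 t3] := tn n a (k \o b).
have NE : N = `|\sum_i t0 (a i) ((k \o b) i)| by rewrite /N -(@star_hom_sum _ _ j _ _ _ _ j1) nj.
rewrite NE; split.
  move=> phi psi sp ss m x y.
  have := t2 phi (psi \o k') sp (state_comp hk' ss) m x (k \o y).
  congr (_ <= _ * _); rewrite /gns_sqnorm; apply: eq_bigr => p _; apply: eq_bigr => q _ /=;
  by congr (_ * psi _); rewrite -?k2 -k4 -k2 kK.
move=> c c0 sc; apply: t3 => // phi psi sp ss m x y.
have := sc phi (psi \o k) sp (state_comp hk ss) m x (k' \o y).
congr (_ <= _ * _); rewrite /gns_sqnorm; apply: eq_bigr => p _; apply: eq_bigr => q _ /=;
by congr (_ * psi _); rewrite k2 k4 ?k2 !k'K.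
Qed.

End Transport.

(** * The circle group *)

Section CircleGroup.
Variable R : realType.
Local Notation C := (cplx R).
Local Notation S1 := (circle R).
Implicit Types x y z : S1.

Lemma circle_val_cont : continuous (fun x : S1 => \val x : C).
Proof. exact: initial_continuous. Qed.

Lemma circle_norm x : `|\val x : C| = 1.
Proof. exact: set_mem (valP x). Qed.

Lemma circle_neq0 x : (\val x : C) != 0.
Proof. by rewrite -normr_eq0 circle_norm oner_neq0. Qed.

Lemma circle_cont (T : topologicalType) (f : T -> S1) :
  continuous (fun t => \val (f t) : C) -> continuous f.
Proof. by move=> cf; apply/continuous_comp_initial. Qed.

Lemma circle_mulA x y z : circle_mul x (circle_mul y z) = circle_mul (circle_mul x y) z.
Proof. by apply: val_inj => /=; rewrite mulrA. Qed.

Lemma circle_mulC x y : circle_mul x y = circle_mul y x.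
Proof. by apply: val_inj => /=; rewrite mulrC. Qed.

Lemma circle_inv_subproof x : ((\val x)^-1 : C) \in [set z : C | `|z| = 1].
Proof. by rewrite inE /= normfV circle_norm invr1. Qed.

Definition circle_inv x : S1 := SigSub (circle_inv_subproof x).

Lemma circle_mulK x y : circle_mul (circle_mul x y) (circle_inv y) = x.
Proof. by apply: val_inj => /=; rewrite mulfK// circle_neq0. Qed.

Lemma circle_divK x y : circle_mul (circle_mul x (circle_inv y)) y = x.
Proof. by apply: val_inj => /=; rewrite mulfVK// circle_neq0. Qed.

Lemma circle_mul1 x : circle_mul x (circle1 R) = x.
Proof. by apply: val_inj => /=; rewrite mulr1. Qed.

Lemma circle_mul_cont (T : topologicalType) (f g : T -> S1) :
  continuous f -> continuous g -> continuous (fun t => circle_mul (f t) (g t)).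
Proof.
move=> cf cg; apply: circle_cont => t /=; apply: (@cvgM C).
  by apply: continuous_comp; [exact: cf|exact: circle_val_cont].
by apply: continuous_comp; [exact: cg|exact: circle_val_cont].
Qed.

Lemma circle_inv_cont (T : topologicalType) (f : T -> S1) :
  continuous f -> continuous (fun t => circle_inv (f t)).
Proof.
move=> cf; apply: circle_cont => t /=; apply: (@cvgV C); first exact: circle_neq0.
by apply: continuous_comp; [exact: cf|exact: circle_val_cont].
Qed.

End CircleGroup.

(** * The translation coaction *)

Lemma pair_continuous (T U V : topologicalType) (f : T -> U) (g : T -> V) :
  continuous f -> continuous g -> continuous (fun t => (f t, g t)).
Proof. by move=> cf cg t; apply: cvg_pair; [exact: cf|exact: cg]. Qed.

Section Translation.
Variables (R : realType).
Local Notation C := (cplx R).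
Local Notation S1 := (circle R).
Local Notation "'F1' D" := (cfun_cstar S1 D) (at level 10).

Section Shift.
Variable D : cstarAlg R.

Lemma cshift_subproof (f : F1 D) :
  continuous (fun p : S1 * S1 => ev f (circle_mul p.2 p.1)).
Proof.
move=> p; apply: (@continuous_comp _ _ _ (fun p : S1 * S1 => circle_mul p.2 p.1) (ev f)).
  by apply: circle_mul_cont => q; [exact: cvg_snd|exact: cvg_fst].
exact: ev_continuous.
Qed.

(** The outer variable is the tensor leg added last. The same map serves as [Delta] for scalar [D],
    as the coaction for [D = B], and as [id (x) Delta] for [D = C(S^1, B)]. *)
Definition cshift (f : F1 D) : F1 (F1 D) :=
  @cf2 R S1 S1 D (fun y x => ev f (circle_mul x y)) (@cshift_subproof f).

Lemma ev_cshift f y x : ev (ev (cshift f) y) x = ev f (circle_mul x y).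
Proof. by []. Qed.

Lemma cshift_hom : unital_star_hom cshift.
Proof. by split=> [k u v|u v||u]; apply: ev2_ext. Qed.

Lemma cshift_inj : injective cshift.
Proof.
move=> f g fg; apply: ev_ext => x.
by rewrite -(circle_mul1 x) -!ev_cshift fg.
Qed.

Lemma cshift_continuous : continuous cshift.
Proof.
apply: contractive_continuous; first by case: cshift_hom.
by move=> f; apply: norm_le_ev2 => y x; exact: ev_norm_le.
Qed.

End Shift.

Local Notation H := (C_S1 R).

Definition H2 : minTensor H H :=
  cfun_tensor S1 (enough_states_cfun (X := S1) (@enough_states_C R)).

Definition Delta : H -> H2 := @cshift (cplx_cstar R).

Lemma circle_comult_Delta : circle_comult Delta.
Proof.
exists (@cuncurry R S1 S1 (cplx_cstar R)); split; first exact: cuncurry_iso.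
- move=> f g x y; rewrite ev_cuncurry /=.
  exact: mulrC.
- by move=> f x y; rewrite ev_cuncurry ev_cshift.
Qed.

Section Coaction.
Variables (B : cstarAlg R) (eB : enough_states B).
Local Notation A := (F1 B).

Let eA : enough_states A := enough_states_cfun (X := S1) eB.

Definition tAH : minTensor A H := cfun_tensor S1 eA.
Definition tAHH : minTensor tAH H := cfun_tensor S1 (enough_states_cfun (X := S1) eA).

(** Currying gives [A (x) (H (x) H)] the same underlying algebra as [(A (x) H) (x) H], so that
    [coassoc] can be the identity. *)
Definition tens_A_HH (a : A) (q : H2) : F1 (F1 A) :=
  ccurry (tens_cfun a (cuncurry q)).

Lemma tens_A_HH_min : is_min_tensor tens_A_HH.
Proof.
apply: (@min_tensor_transport R A _ _ _ _ (@tens_cfun R (S1 * S1)%type A) _ _ (@ccurry R S1 S1 (cplx_cstar R))).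
- exact: tens_cfun_min.
- exact: ccurry_hom.
- exact: ccurry_norm.
- by move=> F; exists (cuncurry F); exact: cuncurryK.
- exact: cuncurry_hom.
- exact: cuncurryK.
- exact: ccurryK.
Qed.

Definition tA_HH : minTensor A H2 := MinTensor tens_A_HH_min.

Lemma translation_tens a h k :
  id (tens tA_HH a (tens H2 h k)) = tens tAHH (tens tAH a h) k :> tAHH.
Proof.
apply: ev2_ext => y x.
exact: (esym (scalerA (ev k y : C) (ev h x : C) a)).
Qed.

Lemma cshift_tens : is_tensor_map (S := tAH) (S' := tA_HH) id Delta (@cshift A).
Proof.
by split; [exact: cshift_hom|move=> a h; apply: ev2_ext].
Qed.

Definition comap_id0 : tAH -> tAHH := @cmap R S1 A (F1 A) (@cshift B) (@cshift_continuous B).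

Lemma comap_id0_tens : is_tensor_map (S := tAH) (S' := tAHH) (@cshift B : A -> tAH) id comap_id0.
Proof.
split; first by apply: cmap_hom; exact: cshift_hom.
by move=> a h; apply: ev_ext => y; apply: ev2_ext.
Qed.

Lemma cshift_coassoc a : comap_id0 (@cshift B a) = id (@cshift A (@cshift B a)) :> tAHH.
Proof.
apply: ev2_ext => y x; apply: ev_ext => s.
rewrite ev_cmap !ev_cshift; congr (ev _ _).
by rewrite -!circle_mulA; congr circle_mul; rewrite circle_mulC.
Qed.

(* [(g, s) |-> F g (s / g)] and [(y, s) |-> F (y / s) s] turn translated
   products into elementary tensors. *)
Lemma untwist_source (F : F1 A) :
  continuous (fun p : S1 * S1 => ev (ev F p.1) (circle_mul p.2 (circle_inv p.1))).
Proof.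
move=> p; apply: (@continuous_comp _ _ _ (fun p : S1 * S1 => (p.1, circle_mul p.2 (circle_inv p.1)))
  (fun p : S1 * S1 => ev (ev F p.1) p.2)); last exact: (@ev2_continuous R S1 S1 B F).
apply: pair_continuous p => [p|]; first exact: cvg_fst.
apply: (@circle_mul_cont R _ snd (fun q : S1 * S1 => circle_inv q.1)) => [q|].
  exact: cvg_snd.
by apply: circle_inv_cont => q; exact: cvg_fst.
Qed.

Lemma untwist_target (F : F1 A) :
  continuous (fun p : S1 * S1 => ev (ev F (circle_mul p.1 (circle_inv p.2))) p.2).
Proof.
move=> p; apply: (@continuous_comp _ _ _ (fun p : S1 * S1 => (circle_mul p.1 (circle_inv p.2), p.2))
  (fun p : S1 * S1 => ev (ev F p.1) p.2)); last exact: (@ev2_continuous R S1 S1 B F).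
apply: pair_continuous p => [|p]; last exact: cvg_snd.
apply: (@circle_mul_cont R _ fst (fun q : S1 * S1 => circle_inv q.2)) => [q|].
  exact: cvg_fst.
by apply: circle_inv_cont => q; exact: cvg_snd.
Qed.

Lemma half_lt (e : C) : 0 < e -> 0 < e / 2 /\ e / 2 < e.
Proof. by move=> e0; rewrite divr_gt0// ltr_pdivrMr// ltr_pMr// ltr1n. Qed.

Lemma cshift_dense :
  dense (lin_span [set x : tAH | exists a h, x = @cshift B a * tens tAH 1 h]).
Proof.
apply/denseP_norm => F e /half_lt[e2 e2e]; move: (F : F1 A) => {}F.
pose F' := @cf2 R S1 S1 B (fun g s => ev (ev F g) (circle_mul s (circle_inv g)))
  (@untwist_source F).
have [n [y [p [_ _ Fp]]]] := cfun_approx F' e2.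
pose G : F1 A := \sum_j @cshift B (ev F' (y j)) * tens_cfun 1 (p j).
exists G.
  exists n, (fun=> 1), (fun j => @cshift B (ev F' (y j)) * tens tAH 1 (p j)).
  split; first by move=> j; eexists; eexists.
  by apply: eq_bigr => j _; rewrite scale1r.
apply: le_lt_trans e2e; apply: (@norm_le_ev2 R S1 S1 B (F - G)) => g s.
apply: le_trans Fp.
(* [F'] at [(g, s g)] is [F] at [(g, s)], and evaluating [ev F' (y j)] at [s g] is translating it by
   [g]. *)
apply: le_trans (ev2_norm_le _ g (circle_mul s g)).
rewrite !ev2B ev_cf2 circle_mulK /G !ev2_sum.
rewrite le_eqVlt; apply/orP; left; apply/eqP; congr (`|_ - _|).
apply: eq_bigr => j _.
transitivity (ev (ev F' (y j)) (circle_mul s g) * ((ev (p j) g : C) *: (1 : B))) => //.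
by rewrite -scalerAr mulr1.
Qed.

Definition translation : coaction Delta A :=
  @Coaction R H H2 Delta A tAH tAHH tA_HH id (star_iso_id _) translation_tens
    (@cshift A) cshift_tens (@cshift B) (@cshift_hom B) (@cshift_inj B)
    comap_id0 comap_id0_tens cshift_coassoc cshift_dense.

Lemma translation_free : free_coaction translation.
Proof.
apply/denseP_norm => F e /half_lt[e2 e2e]; move: (F : F1 A) => {}F.
pose F' := @cf2 R S1 S1 B (fun y s => ev (ev F (circle_mul y (circle_inv s))) s)
  (@untwist_target F).
have [n [y [p [_ _ Fp]]]] := cfun_approx F' e2.
pose G : F1 A := \sum_j tens_cfun (ev F' (y j)) 1 * @cshift B (tens_cfun 1 (p j)).
exists G.
  exists n, (fun j => ev F' (y j)), (fun j => tens_cfun 1 (p j)); by [].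
apply: le_lt_trans e2e; apply: (@norm_le_ev2 R S1 S1 B (F - G)) => g s.
apply: le_trans Fp.
apply: le_trans (ev2_norm_le _ (circle_mul s g) s).
rewrite !ev2B ev_cf2 [circle_mul s g]circle_mulC circle_mulK /G !ev2_sum.
rewrite le_eqVlt; apply/orP; left; apply/eqP; congr (`|_ - _|).
apply: eq_bigr => j _.
transitivity (((1 : C) *: ev (ev F' (y j)) s) * ((ev (p j) (circle_mul s g) : C) *: (1 : B))) => //.
by rewrite -scalerAr mulr1 scale1r circle_mulC.
Qed.

End Coaction.
End Translation.

(** * Functional calculus of a unitary *)

Section RootsOfUnity.
Variable R : realType.
Local Notation C := (cplx R).

Lemma prim_root_exists n : (0 < n)%N -> exists w : C, n.-primitive_root w.
Proof.
move=> n0; pose p : {poly C} := 'X^n - 1.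
have [r pE] := closed_field_poly_normal p.
rewrite (monicP _) ?monicXnsubC// scale1r in pE.
have rn1 : all n.-unity_root r by apply/allP => z; rewrite -root_prod_XsubC -pE.
have szr : (n < (size r).+1)%N by rewrite -(size_prod_XsubC r id) -pE size_XnsubC.
have ur : uniq r.
  by rewrite -separable_prod_XsubC -pE separable_Xn_sub_1// pnatr_eq0 -lt0n.
by have /hasP[w _ wP] := has_prim_root n0 rn1 ur szr; exists w.
Qed.

Lemma unity_norm n (w : C) : (0 < n)%N -> w ^+ n = 1 -> `|w| = 1.
Proof.
move=> n0 /(congr1 Num.norm); rewrite normrX normr1 => /eqP.
by rewrite pexpr_eq1// => /eqP.
Qed.

Lemma conjc_unit (x : C) : `|x| = 1 -> conjc x = x^-1.
Proof.
move=> x1; have x0 : x != 0 by rewrite -normr_eq0 x1 oner_eq0.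
by apply: (mulfI x0); rewrite divff// -sqr_normc x1 expr1n.
Qed.

Lemma sum_unity_roots n (w : C) (k l : 'I_n) : n.-primitive_root w ->
  \sum_(i < n) (w ^+ i) ^+ k * (w ^+ i) ^- l = (k == l)%:R * n%:R.
Proof.
move=> pw; have n0 : (0 < n)%N := prim_order_gt0 pw.
have w1 : w ^+ n = 1 := prim_expr_order pw.
have w0 : w != 0 by rewrite -normr_eq0 (unity_norm n0 w1) oner_eq0.
under eq_bigr do rewrite -!exprM mulnC [(_ * l)%N]mulnC !exprM -exprVn -exprMn.
have [->|kl] := eqVneq k l.
  under eq_bigr do rewrite divff ?expf_neq0// expr1n.
  by rewrite sumr_const card_ord mul1r.
(* A geometric sum whose ratio [w ^+ k / w ^+ l] differs from [1] but has [n]-th power [1]. *)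
rewrite mul0r; apply/eqP; rewrite -(@mulrI_eq0 _ (w ^+ k / w ^+ l - 1)); last first.
  apply/mulfI; rewrite subr_eq0; apply: contra_neq kl => /(congr1 ( *%R^~ (w ^+ l))).
  rewrite divfK ?expf_neq0// mul1r => /eqP; rewrite (eq_prim_root_expr pw).
  by rewrite !modn_small// => /eqP/val_inj.
by rewrite -subrX1 exprMn exprVn -!exprM mulnC [(_ * n)%N]mulnC !exprM w1 !expr1n divr1 subrr.
Qed.

End RootsOfUnity.

Lemma exists_divn_lt (R : realType) (c e : cplx R) : 0 <= c -> 0 < e ->
  exists2 m : nat, (0 < m)%N & c / m%:R < e.
Proof.
move=> c0 e0; pose r := complex.Re c / complex.Re e.
have e0' : 0 < complex.Re e by rewrite -cplx_lt -(cplx_real (ltW e0)).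
have c0' : 0 <= complex.Re c by rewrite -cplx_le -(cplx_real c0).
have r0 : 0 <= r by rewrite divr_ge0// ltW.
have := archi_boundP r0; set m := Num.bound r => rm.
have m0 : (0 < m)%N by rewrite lt0n; apply: contraTneq rm => ->; rewrite -leNgt.
exists m => //; rewrite ltr_pdivrMr ?ltr0n//.
rewrite (cplx_real c0) (cplx_real (ltW e0)).
rewrite -(rmorph_nat (real_complex R)) -rmorphM /= cplx_lt.
by rewrite mulrC -ltr_pdivrMr.
Qed.

Lemma le_harmonic (R : realType) (a b c : cplx R) : 0 <= c ->
  (forall m : nat, (0 < m)%N -> a <= b + c / m%:R) -> a <= b.
Proof.
move=> c0 h; apply/ler_addgt0Pr => e e0.
have [m m0 /ltW me] := exists_divn_lt c0 e0.
by apply: le_trans (h m m0) _; rewrite lerD2l.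
Qed.

Section ApproximateEigenvectors.
Variables (R : realType) (D : cstarAlg R) (u : D).
Local Notation C := (cplx R).
Hypotheses (uu : star u * u = 1) (uu' : u * star u = 1).

Lemma unitary_norm : `|u| = 1.
Proof.
have := normC u; rewrite uu norm1 => /eqP; rewrite eq_sym sqrf_eq1 => /orP[/eqP//|/eqP h].
by have := normr_ge0 u; rewrite h oppr_ge0 ler10.
Qed.

Lemma star_expr k : star (u ^+ k) = star u ^+ k.
Proof. by elim: k => [|k IH]; [exact: star1|rewrite exprS starM IH -exprSr]. Qed.

Lemma star_exprK k : star u ^+ k * u ^+ k = 1.
Proof.
elim: k => [|k IH]; first by rewrite mulr1.
by rewrite exprSr exprS mulrA -[_ * star u * u]mulrA uu mulr1.
Qed.

(* For [x ^+ n = 1] an approximate eigenvector of [u]: the defect [u * wave n x - x *: wave n x]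
   is bounded in [n], while the [star (wave n x) * wave n x] add up to [n ^ 2] over the roots. *)
Definition wave n (x : C) : D := \sum_(k < n) x ^- k *: u ^+ k.

(** Multiplication by [u] shifts the index of the sum; since [x ^+ n = 1], only the two end terms
    fail to match. *)
Lemma mul_wave n x : x != 0 -> x ^+ n = 1 ->
  u * wave n x = x *: wave n x + x *: (u ^+ n - 1).
Proof.
move=> x0 xn; rewrite -scalerDr addrC /wave.
have -> : u ^+ n - 1 + \sum_(k < n) x ^- k *: u ^+ k =
          \sum_(k < n) x ^- k.+1 *: u ^+ k.+1.
  apply: (addIr 1); rewrite addrAC subrK.
  have -> : u ^+ n = x ^- n *: u ^+ n by rewrite xn invr1 scale1r.
  rewrite addrC -(big_ord_recr n (fun k => x ^- k *: u ^+ k))/= big_ord_recl/=.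
  by rewrite expr0 invr1 scale1r addrC.
rewrite mulr_sumr scaler_sumr; apply: eq_bigr => k _.
by rewrite -scalerAr -exprS scalerA [x ^+ k.+1]exprS invfM mulVKf.
Qed.

Lemma mul_wave_norm n x : `|x| = 1 -> x ^+ n = 1 -> `|u * wave n x - x *: wave n x| <= 2.
Proof.
move=> x1 xn; have x0 : x != 0 by rewrite -normr_eq0 x1 oner_eq0.
rewrite mul_wave// addrC addKr normrZ x1 mul1r (le_trans (ler_normB _ _))//.
rewrite norm1 lerD2r; elim: n {xn} => [|n IH]; first by rewrite expr0 norm1.
rewrite exprS (le_trans (cs_normrM _ _))// unitary_norm mul1r//.
Qed.

Lemma star_mul_wave_norm n x : `|x| = 1 -> x ^+ n = 1 ->
  `|star u * wave n x - x^-1 *: wave n x| <= 2.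
Proof.
move=> x1 xn; have x0 : x != 0 by rewrite -normr_eq0 x1 oner_eq0.
have -> : star u * wave n x - x^-1 *: wave n x =
   (- x^-1) *: (star u * (u * wave n x - x *: wave n x)).
  rewrite mulrBr mulrA uu mul1r -scalerAr scalerBr scalerA scaleNr mulNr mulVf//.
  by rewrite scaleN1r opprK addrC.
rewrite normrZ normrN normfV x1 invr1 mul1r (le_trans (cs_normrM _ _))//.
by rewrite cs_norm_star unitary_norm mul1r mul_wave_norm.
Qed.

(** Orthogonality of characters leaves only the terms with equal exponents: there are [n] of them,
    and each sums to [n] over the roots. *)
Lemma wave_parseval n (w : C) : n.-primitive_root w ->
  \sum_(i < n) star (wave n (w ^+ i)) * wave n (w ^+ i) = (n%:R ^+ 2 : C) *: 1.
Proof.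
move=> pw; have n0 : (0 < n)%N := prim_order_gt0 pw.
have w1 : w ^+ n = 1 := prim_expr_order pw.
have nw i : `|w ^+ i| = 1 by rewrite normrX (unity_norm n0 w1) expr1n.
transitivity (\sum_(k < n) \sum_(l < n)
   (\sum_(i < n) (w ^+ i) ^+ k * (w ^+ i) ^- l) *: (star u ^+ k * u ^+ l)).
  under [RHS]eq_bigr => k _ do under eq_bigr => l _ do rewrite scaler_suml.
  under [RHS]eq_bigr => k _ do rewrite exchange_big/=.
  rewrite exchange_big/=; apply: eq_bigr => i _.
  rewrite star_sum mulr_suml; apply: eq_bigr => k _.
  rewrite mulr_sumr; apply: eq_bigr => l _.
  rewrite starZ -scalerAl -scalerAr scalerA star_expr; congr (_ * _ *: _).
  by rewrite conjc_unit ?invrK// normfV normrX nw expr1n invr1.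
transitivity (\sum_(k < n) (n%:R : C) *: (1 : D)).
  apply: eq_bigr => k _; rewrite (bigD1 k)//= [X in _ + X]big1 ?addr0.
    by rewrite sum_unity_roots// eqxx mul1r star_exprK.
  by move=> l lk; rewrite sum_unity_roots// eq_sym (negbTE lk) mul0r scale0r.
by rewrite sumr_const card_ord -scaler_nat scalerA expr2.
Qed.

End ApproximateEigenvectors.

(** The right side minus the left side is [s^-1 * phi (star (s *: a - b) * (s *: a - b))]. *)
Lemma state_young (R : realType) (D : cstarAlg R) (phi : D -> cplx R) (s : cplx R) (a b : D) :
  state phi -> 0 < s ->
  phi (star (a + b) * (a + b)) <=
    (1 + s) * phi (star a * a) + (1 + s^-1) * phi (star b * b).
Proof.
move=> sp s0; have s0' : s != 0 by rewrite gt_eqF.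
have E1 : phi (star (a + b) * (a + b)) = phi (star a * a) + phi (star a * b) +
    (phi (star b * a) + phi (star b * b)).
  by rewrite starD mulrDl !mulrDr !(stateD sp).
have E2 : phi (star (s *: a - b) * (s *: a - b)) = s * (s * phi (star a * a)) -
    s * phi (star a * b) - (s * phi (star b * a) - phi (star b * b)).
  have -> : star (s *: a - b) * (s *: a - b) = s *: (s *: (star a * a)) -
      s *: (star a * b) - (s *: (star b * a) - star b * b).
    by rewrite starB starZ conjc_ge0 ?(ltW s0)// mulrBl !mulrBr -!scalerAr -!scalerAl.
  by rewrite !(stateB sp) !(stateZ sp).
rewrite -subr_ge0 E1.
rewrite [X in 0 <= X](_ : _ = s^-1 * phi (star (s *: a - b) * (s *: a - b))); last first.
  by rewrite E2; field.
by rewrite mulr_ge0 ?invr_ge0 ?(ltW s0)// state_ge0.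
Qed.

Section Calculus.
Variables (R : realType) (D : cstarAlg R) (u : D).
Local Notation C := (cplx R).
Local Notation S1 := (circle R).
Local Notation H := (C_S1 R).

Lemma circz_subproof : continuous (fun x : S1 => \val x : cplx_cstar R).
Proof. exact: circle_val_cont. Qed.

Definition circz : H := mkcfun circz_subproof.

Lemma ev_circz x : ev circz x = \val x. Proof. by []. Qed.

(* [d] is the value at [u] of the *-polynomial [f]; only a relation until [calc_norm] shows that
   it is single-valued. *)
Inductive calc : H -> D -> Prop :=
| calc1 : calc 1 1
| calcz : calc circz u
| calczs : calc (star circz) (star u)
| calcD f d f' d' : calc f d -> calc f' d' -> calc (f + f') (d + d')
| calcZ (k : C) f d : calc f d -> calc (k *: f) (k *: d)
| calcM f d f' d' : calc f d -> calc f' d' -> calc (f * f') (d * d').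

Lemma calc0 : calc 0 0.
Proof. by have := calcZ 0 calc1; rewrite !scale0r. Qed.

Lemma calcB f d f' d' : calc f d -> calc f' d' -> calc (f - f') (d - d').
Proof. by move=> cf cf'; have := calcD cf (calcZ (-1) cf'); rewrite !scaleN1r. Qed.

Lemma calc_star f d : calc f d -> calc (star f) (star d).
Proof.
elim=> [|||||] *; rewrite ?star1 ?starK ?starD ?starZ ?starM.
- exact: calc1.
- exact: calczs.
- exact: calcz.
- by apply: calcD.
- by apply: calcZ.
- by apply: calcM.
Qed.

Lemma calc_sum n (f : 'I_n -> H) (d : 'I_n -> D) :
  (forall i, calc (f i) (d i)) -> calc (\sum_i f i) (\sum_i d i).
Proof.
elim: n f d => [|n IH] f d h; first by rewrite !big_ord0; exact: calc0.
by rewrite !big_ord_recl; apply: calcD => //; exact: IH.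
Qed.

Lemma calc_exp k f d : calc f d -> calc (f ^+ k) (d ^+ k).
Proof.
move=> c; elim: k => [|k IH]; first by rewrite !expr0; exact: calc1.
by rewrite !exprS; exact: calcM.
Qed.

Hypotheses (uu : star u * u = 1) (uu' : u * star u = 1).

Lemma calc_comm f d : calc f d -> GRing.comm d u.
Proof.
elim=> [|||||].
- exact/commr_sym/commr1.
- exact: commr_refl.
- by rewrite /GRing.comm uu uu'.
- by move=> ? ? ? ? _ h _ h'; rewrite /GRing.comm mulrDl mulrDr h h'.
- by move=> ? ? ? _ h; rewrite /GRing.comm -scalerAl -scalerAr h.
- by move=> ? ? ? ? _ h _ h'; apply/commr_sym/commrM; apply/commr_sym.
Qed.

Lemma calc_wave_comm f d n x : calc f d -> d * wave u n x = wave u n x * d.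
Proof.
move=> /calc_comm c; rewrite mulr_sumr mulr_suml; apply: eq_bigr => k _.
by rewrite -scalerAr -scalerAl; congr (_ *: _); exact: commrX.
Qed.

Lemma calc_eigen f d : calc f d -> exists2 K : C, 0 <= K &
  forall n (x : S1), (\val x : C) ^+ n = 1 ->
    `|d * wave u n (\val x) - (ev f x : C) *: wave u n (\val x)| <= K.
Proof.
elim=> [|||||].
- exists 0 => // n x _; by rewrite mul1r ev1 scale1r subrr normr0.
- exists 2 => // n x xn; apply: mul_wave_norm => //; exact: circle_norm.
- exists 2 => // n x xn.
  have -> : (ev (star circz) x : C) = (\val x)^-1.
    by rewrite ev_star ev_circz [LHS]conjc_unit// circle_norm.
  apply: star_mul_wave_norm => //; exact: circle_norm.
- move=> f1 d1 f2 d2 _ [K1 K10 h1] _ [K2 K20 h2].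
  exists (K1 + K2) => [|n x xn]; first by rewrite addr_ge0.
  rewrite mulrDl evD scalerDl opprD addrACA.
  by rewrite (le_trans (ler_normD _ _))// lerD ?h1 ?h2.
- move=> k f1 d1 _ [K1 K10 h1]; exists (`|k| * K1) => [|n x xn]; first by rewrite mulr_ge0.
  rewrite -scalerAl evZ -[X in _ - X]scalerA -scalerBr normrZ ler_wpM2l//; exact: h1.
- move=> f1 d1 f2 d2 _ [K1 K10 h1] _ [K2 K20 h2].
  exists (`|d1| * K2 + `|f2| * K1) => [|n x xn].
    by rewrite addr_ge0// mulr_ge0.
  set a := wave _ _ _.
  have -> : d1 * d2 * a - (ev (f1 * f2) x : C) *: a =
      d1 * (d2 * a - (ev f2 x : C) *: a) + (ev f2 x : C) *: (d1 * a - (ev f1 x : C) *: a).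
    rewrite mulrBr scalerBr -scalerAr addrA subrK mulrA scalerA evM.
    by congr (_ - _ *: _); exact: mulrC.
  rewrite (le_trans (ler_normD _ _))// lerD//.
    by rewrite (le_trans (cs_normrM _ _))// ler_wpM2l// h2.
  rewrite normrZ ler_pM ?h1//; exact: (ev_norm_le f2 x).
Qed.

Hypothesis eD : enough_states D.

(** Von Neumann's inequality for a unitary. The waves at the [n]-th roots of unity resolve [n ^+ 2]
    by Parseval; on the wave at [z i] the element [d] acts as the scalar [ev f (z i)], of modulus at
    most [F], up to an error bounded in [n]. Summing over the roots, the error is negligible as [n]
    grows. *)
Lemma calc_norm f d : calc f d -> `|d| <= `|f|.
Proof.
move=> cfd; have [K K0 hK] := calc_eigen cfd.
apply: eD => // phi sp x.
set p := phi (star x * x); set F := `|f|.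
have p0 : 0 <= p := state_ge0 sp x.
have F0 : 0 <= F by rewrite normr_ge0.
apply: (@le_harmonic R _ _ (F ^+ 2 * p + 2 * K ^+ 2 * p)).
  by rewrite addr_ge0 ?mulr_ge0 ?exprn_ge0 ?ler0n.
move=> m m0; have mC0 : (0 : C) < m%:R by rewrite ltr0n.
(* With Young parameter [1 / m] the errors add up to [n * (1 + m) * K ^+ 2 * p], to be divided by
   [n ^+ 2]; for [n = m ^ 2] the quotient is at most [2 * K ^+ 2 * p / m]. *)
pose n := (m ^ 2)%N.
have n0 : (0 < n)%N by rewrite expn_gt0 m0.
have [w pw] := prim_root_exists R n0.
have w1 : w ^+ n = 1 := prim_expr_order pw.
have wi i : w ^+ i \in [set z : C | `|z| = 1].
  by rewrite inE /= normrX (unity_norm n0 w1) expr1n.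
pose z i : S1 := SigSub (wi i).
have zn i : (\val (z i) : C) ^+ n = 1 by rewrite /= -exprM mulnC exprM w1 expr1n.
pose a i := wave u n (\val (z i)).
have Q y : phi (star y * y) * n%:R ^+ 2 = \sum_(i < n) phi (star (a i * y) * (a i * y)).
  rewrite -(state_sum sp) mulrC -(stateZ sp); congr phi.
  transitivity (star y * ((n%:R ^+ 2 : C) *: 1) * y).
    by rewrite -scalerAr mulr1 -scalerAl.
  rewrite -(wave_parseval uu pw) mulr_sumr mulr_suml.
  by apply: eq_bigr => i _; rewrite starM !mulrA.
have bound i : phi (star (a i * (d * x)) * (a i * (d * x))) <=
    (1 + m%:R^-1) * (F ^+ 2 * phi (star (a i * x) * (a i * x))) + (1 + m%:R) * (K ^+ 2 * p).
  pose k : C := ev f (z i).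
  have -> : a i * (d * x) = k *: (a i * x) + (d * a i - k *: a i) * x.
    by rewrite mulrBl -scalerAl addrC subrK mulrA -(calc_wave_comm _ _ cfd).
  have m1 : (0 : C) < m%:R^-1 by rewrite invr_gt0.
  apply: le_trans (state_young _ _ sp m1) _; rewrite invrK; apply: lerD.
    apply: ler_wpM2l; first by rewrite addr_ge0// ltW.
    have -> : star (k *: (a i * x)) * (k *: (a i * x)) =
        (`|k| ^+ 2) *: (star (a i * x) * (a i * x)).
      by rewrite starZ -scalerAl -scalerAr scalerA sqr_normc mulrC.
    rewrite (stateZ sp); apply: ler_wpM2r; first exact: state_ge0.
    by rewrite !expr2; apply: ler_pM => //; exact: (ev_norm_le f (z i)).
  apply: ler_wpM2l; first by rewrite addr_ge0// ltW.
  set r := _ - _; rewrite starM -mulrA [star r * _]mulrA mulrA.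
  apply: le_trans (state_norm_le sp _ _) _; apply: ler_wpM2r => //.
  by rewrite !expr2; apply: ler_pM => //; exact: hK.
have n2 : (0 : C) < n%:R ^+ 2 by rewrite exprn_gt0// ltr0n.
have -> : star x * (star d * d) * x = star (d * x) * (d * x) by rewrite starM !mulrA.
rewrite -(ler_pM2r n2) Q.
apply: (@le_trans _ _ (\sum_(i < n) ((1 + m%:R^-1) *
    (F ^+ 2 * phi (star (a i * x) * (a i * x))) + (1 + m%:R) * (K ^+ 2 * p)))).
  by apply: ler_sum => i _; exact: bound.
rewrite big_split/= -mulr_sumr -mulr_sumr -Q -/p sumr_const card_ord -mulr_natr.
rewrite -subr_ge0 /n natrX.
rewrite [X in 0 <= X](_ : _ = K ^+ 2 * p * m%:R ^+ 2 * (m%:R - 1)).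
  by rewrite mulr_ge0 ?mulr_ge0 ?exprn_ge0 ?(ltW mC0)// subr_ge0 ler1n.
by field; rewrite gt_eqF.
Qed.

End Calculus.

(** * Density of the trigonometric polynomials *)

Section CalculusDensity.
Variables (R : realType).
Local Notation C := (cplx R).
Local Notation S1 := (circle R).
Local Notation H := (C_S1 R).

Lemma circle_nbhs1 (U : set S1) : nbhs (circle1 R) U ->
  exists2 d : C, 0 < d & forall y : S1, `|1 - \val y| < d -> U y.
Proof.
rewrite nbhsE => -[W [[W' oW' <-] W'1 WU]].
have /nbhs_normP[d /= d0 dW] : nbhs (1 : C) W' by apply: open_nbhs_nbhs; split.
by exists d => // y yd; apply: WU; apply: dW.
Qed.

(** Uniform continuity of [f] is continuity at [1] of [y |-> f (_ y)] as a map into C(S^1) with the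
    sup norm, which [cshift] already provides. *)
Lemma circle_uniform_continuity (f : H) (e : C) : 0 < e ->
  exists2 d : C, 0 < d & forall x y : S1, `|\val x - \val y : C| < d -> `|ev f x - ev f y| <= e.
Proof.
move=> e0; have /cvgrPdist_le/(_ _ e0)/circle_nbhs1[d d0 h] := ev_continuous (cshift f) (circle1 R).
exists d => // x y xy.
pose q := circle_mul y (circle_inv x).
have qE : circle_mul x q = y by rewrite /q circle_mulC circle_divK.
have -> : ev f x - ev f y = ev (ev (cshift f) (circle1 R) - ev (cshift f) q) x.
  by rewrite evB !ev_cshift circle_mul1 qE.
apply: le_trans (ev_norm_le _ _) (h q _).
have x0 := circle_neq0 x.
have -> : 1 - \val q = (\val x - \val y) / \val x :> C.
  by rewrite /q /= mulrBl divff.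
by rewrite normrM normfV circle_norm invr1 mulr1.
Qed.

Lemma circz_unitary : star (circz R) * circz R = 1 :> H.
Proof.
apply: ev_ext => x; rewrite evM ev_star ev1 ev_circz.
have := sqr_normc (\val x : C); rewrite circle_norm expr1n => h.
exact: (etrans (mulrC _ _) (esym h)).
Qed.

Lemma circz_unitary' : circz R * star (circz R) = 1 :> H.
Proof. by rewrite -[RHS]circz_unitary; apply: ev_ext => x; exact: mulrC. Qed.

Lemma calc_wave (D : cstarAlg R) (u : D) n x : calc u (wave (circz R) n x) (wave u n x).
Proof. by apply: calc_sum => i; apply/calcZ/calc_exp/calcz. Qed.

(** Fejer's argument on a finite grid. By Parseval the functions [n ^- 2 * |a i| ^+ 2] form a
    partition of unity, and [|x - z i| * |a i x| <= 2] concentrates each near [z i]; weighting the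
    values [ev f (z i)] with them gives a *-polynomial close to [f]. *)
Lemma calc_dense (D : cstarAlg R) (u : D) (f : H) (e : C) : 0 < e ->
  exists g d, calc u g d /\ `|f - g| < e.
Proof.
move=> e0; have e2 : 0 < e / 2 by rewrite divr_gt0.
have e4 : 0 < e / 2 / 2 by rewrite divr_gt0.
have [t t0 ft] := circle_uniform_continuity f e4.
(* Where [|x - z i| >= t], the weight is at most [(2 / t) ^+ 2 / n ^+ 2] and the difference of
   values of [f] at most [2 * |f|]; at most [n] such terms contribute no more than [M / n]. *)
pose M := 2 * `|f| * (2 / t) ^+ 2.
have M0 : 0 <= M.
  apply: mulr_ge0; first by apply: mulr_ge0; rewrite ?ler0n ?normr_ge0.
  by apply: exprn_ge0; apply: divr_ge0; rewrite ?ler0n ?(ltW t0).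
have [n n0 Mn] := exists_divn_lt M0 e4.
have nC0 : (0 : C) < n%:R by rewrite ltr0n.
have [w pw] := prim_root_exists R n0.
have w1 : w ^+ n = 1 := prim_expr_order pw.
have wi i : w ^+ i \in [set z : C | `|z| = 1].
  by rewrite inE /= normrX (unity_norm n0 w1) expr1n.
pose z i : S1 := SigSub (wi i).
have zn i : (\val (z i) : C) ^+ n = 1 by rewrite /= -exprM mulnC exprM w1 expr1n.
pose a i : H := wave (circz R) n (\val (z i)).
pose g : H := \sum_(i < n) (n%:R ^- 2 * (ev f (z i) : C)) *: (star (a i) * a i).
exists g, (\sum_(i < n) (n%:R ^- 2 * (ev f (z i) : C)) *:
    (star (wave u n (\val (z i))) * wave u n (\val (z i)))); split.
  by apply: calc_sum => i; apply/calcZ/calcM; [apply/calc_star|]; exact: calc_wave.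
apply: (@le_lt_trans _ _ (e / 2)); last by rewrite ltr_pdivrMr// ltr_pMr// ltr1n.
apply: norm_le_ev => x.
pose al i : C := ev (a i) x.
have par : \sum_(i < n) `|al i| ^+ 2 = n%:R ^+ 2.
  have := congr1 (fun h : H => ev h x : C) (wave_parseval circz_unitary pw).
  rewrite evZ ev1 ev_sum => h.
  transitivity ((n%:R ^+ 2 : C) *: (1 : C)); last exact: mulr1.
  rewrite -[RHS]h; apply: eq_bigr => i _; rewrite evM ev_star sqr_normc.
  exact: mulrC.
have loc i : `|\val x - \val (z i)| * `|al i| <= 2.
  rewrite -normrM mulrBl.
  apply: le_trans (mul_wave_norm circz_unitary (circle_norm (z i)) (zn i)).
  exact: (ev_norm_le (circz R * a i - \val (z i) *: a i) x).
have n2 : (n%:R ^+ 2 : C) != 0 by rewrite expf_neq0// gt_eqF.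
have -> : ev (f - g) x = \sum_(i < n) n%:R ^- 2 * `|al i| ^+ 2 *
   ((ev f x : C) - (ev f (z i) : C)).
  under eq_bigr do rewrite mulrBr.
  rewrite sumrB -mulr_suml -mulr_sumr par mulVf// mul1r evB; congr (_ - _).
  rewrite ev_sum; apply: eq_bigr => i _.
  rewrite -[RHS]mulrA [X in _ = _ * X]mulrC mulrA evZ evM ev_star sqr_normc.
  by congr (_ * _); exact: mulrC.
apply: le_trans (ler_norm_sum _ _ _) _.
apply: (@le_trans _ _ (\sum_(i < n) n%:R ^- 2 * (e / 2 / 2 * `|al i| ^+ 2 + M))).
  apply: ler_sum => i _.
  have n2' : (0 : C) <= n%:R ^- 2 by rewrite invr_ge0 exprn_ge0// ltW.
  rewrite -mulrA normrM (ger0_norm n2'); apply: ler_wpM2l => //.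
  rewrite normrM (ger0_norm (exprn_ge0 2 (normr_ge0 _))).
  have [xz|xz] := real_ltP (normr_real (\val x - \val (z i))) (gtr0_real t0).
    rewrite -[leLHS]addr0 lerD// mulrC ler_wpM2r ?exprn_ge0//; exact: ft.
  rewrite -[leLHS]add0r; apply: lerD.
    by apply: mulr_ge0; [exact: ltW|exact: exprn_ge0].
  rewrite mulrC /M; apply: ler_pM => //; first exact: exprn_ge0.
    rewrite (le_trans (ler_normB _ _))// mulr_natl mulr2n lerD//.
      exact: (ev_norm_le f x).
    exact: (ev_norm_le f (z i)).
  rewrite !expr2; have h : `|al i| <= 2 / t.
    rewrite ler_pdivlMr// mulrC; apply: le_trans (loc i).
    by rewrite ler_wpM2r.
  exact: ler_pM.
rewrite -mulr_sumr big_split/= -mulr_sumr par sumr_const card_ord -[M *+ n]mulr_natr.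
rewrite [leLHS](_ : _ = e / 2 / 2 + M / n%:R).
  by rewrite [leRHS]splitr lerD2l ltW.
by field; rewrite gt_eqF.
Qed.

End CalculusDensity.

Lemma dense_continuous_eq (R : realType) (V W : normedModType (cplx R)) (P : set V)
    (f g : V -> W) : dense P -> continuous f -> continuous g ->
  (forall v, P v -> f v = g v) -> f =1 g.
Proof.
move=> dP cf cg fg v; apply/eqP; rewrite -subr_eq0 -normr_le0; apply/ler_addgt0Pr => e e0.
rewrite add0r; have e2 : 0 < e / 2 by rewrite divr_gt0.
have /cvgrPdist_lt/(_ _ e2) h1 := cf v; have /cvgrPdist_lt/(_ _ e2) h2 := cg v.
have /nbhs_normP[d /= d0 dh] :
    nbhs v ([set t | `|f v - f t| < e / 2] `&` [set t | `|g v - g t| < e / 2]).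
  exact: filterI h1 h2.
have /denseP_norm/(_ v d d0) [w Pw vw] := dP.
have [/= hf hg] := dh w vw; apply/ltW/(distm_lt_split (z := f w)) => //.
by rewrite fg// distrC.
Qed.

Lemma nonexpansive_continuous (R : realType) (A B : cstarAlg R) (f : A -> B) :
  (forall x y, `|f x - f y| <= `|x - y|) -> continuous f.
Proof.
move=> fc x; apply/cvgrPdist_lt => e e0.
have /cvgrPdist_lt/(_ _ e0) := @cvg_id _ (nbhs x).
by apply: filterS => y; exact: le_lt_trans.
Qed.

Section ContinuousOperations.
Variables (R : realType) (T : topologicalType) (D : cstarAlg R).
Implicit Types f g : T -> D.

Lemma addf_continuous f g :
  continuous f -> continuous g -> continuous (fun t => f t + g t).
Proof. by move=> cf cg t; apply: cvgD; [exact: cf|exact: cg]. Qed.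

Lemma scalef_continuous (k : cplx R) f : continuous f -> continuous (fun t => k *: f t).
Proof. by move=> cf t; apply: cvgZr; exact: cf. Qed.

Lemma mulf_continuous f g :
  continuous f -> continuous g -> continuous (fun t => f t * g t).
Proof. by move=> cf cg t; apply: cs_mul_cvg; [exact: cf|exact: cg]. Qed.

Lemma starf_continuous f : continuous f -> continuous (fun t => star (f t)).
Proof. by move=> cf t; apply: continuous_comp; [exact: cf|exact: star_continuous]. Qed.

Lemma compf_continuous (D' : cstarAlg R) (h : D -> D') f :
  continuous h -> continuous f -> continuous (fun t => h (f t)).
Proof. by move=> ch cf t; apply: continuous_comp; [exact: cf|exact: ch]. Qed.

End ContinuousOperations.

Lemma cs_id_continuous (R : realType) (D : cstarAlg R) : continuous (@id D).
Proof. by move=> x; exact: cvg_id. Qed.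

Lemma cs_cst_continuous (R : realType) (T : topologicalType) (D : cstarAlg R) (d : D) :
  continuous (fun _ : T => d).
Proof. by move=> t; exact: cvg_cst. Qed.

(** * Extension from *-polynomials to continuous functions *)

Section FunctionalCalculus.
Variables (R : realType) (D : cstarAlg R) (u : D).
Local Notation C := (cplx R).
Local Notation H := (C_S1 R).
Hypotheses (uu : star u * u = 1) (uu' : u * star u = 1) (eD : enough_states D).

(** The closure of [calc]. By [calc_norm] it is the graph of a map that does not increase distances,
    and by [calc_dense] with completeness of [D] this map is defined everywhere. *)
Let graph (f : H) (d : D) := forall e : C, 0 < e ->
  exists g b, [/\ calc u g b, `|f - g| < e & `|d - b| < e].

Let graph_calc f d : calc u f d -> graph f d.
Proof. by move=> c e e0; exists f, d; rewrite !subrr !normr0. Qed.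

Let graph_dist f d f' d' : graph f d -> graph f' d' -> `|d - d'| <= `|f - f'|.
Proof.
move=> gf gf'; apply/ler_addgt0Pr => e e0.
have e4 : 0 < e / 2 / 2 by rewrite !divr_gt0.
have [g [b [c fg db]]] := gf _ e4; have [g' [b' [c' fg' db']]] := gf' _ e4.
have h := calc_norm uu uu' eD (calcB c c').
have -> : d - d' = (d - b) + (b - b') + (b' - d') by rewrite !subrKA.
have gE : g - g' = (g - f) + (f - f') + (f' - g') by rewrite !subrKA.
rewrite gE in h; rewrite distrC in fg; rewrite distrC in db'.
apply: le_trans (ler_normD _ _) _.
apply: (@le_trans _ _ ((e / 2 / 2 + (e / 2 / 2 + `|f - f'| + e / 2 / 2)) + e / 2 / 2)).
  apply: lerD; last exact: ltW.
  apply: le_trans (ler_normD _ _) _; apply: lerD; first exact: ltW.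
  apply: le_trans h _; apply: le_trans (ler_normD _ _) _; apply: lerD; last exact: ltW.
  by apply: le_trans (ler_normD _ _) _; apply: lerD => //; exact: ltW.
by rewrite le_eqVlt; apply/orP; left; apply/eqP; field.
Qed.

Let graph_exists f : exists d, graph f d.
Proof.
have h n : exists gb, calc u gb.1 gb.2 /\ `|f - gb.1| < 2^-1 ^+ n.
  have n0 : (0 : C) < 2^-1 ^+ n by rewrite exprn_gt0// invr_gt0.
  by have [g [b h]] := calc_dense u f n0; exists (g, b).
have [s sP] := choice h.
have half0 : (0 : C) <= 2^-1 by rewrite invr_ge0.
have half1 : (2^-1 : C) < 1 by rewrite invf_lt1// ltr1n.
have cs : cvgn (fun n => (s n).2).
  apply: (@geometric_cvg R D _ 2^-1 2) => // n.
  have [c fg] := sP n; have [c' fg'] := sP n.+1.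
  apply: le_trans (calc_norm uu uu' eD (calcB c' c)) _.
  rewrite -(subrKA f) mulr_natl mulr2n addrC; apply: le_trans (ler_normD _ _) _.
  apply: lerD; first exact: ltW.
  rewrite distrC; apply: le_trans (ltW fg') _.
  by rewrite exprS ler_piMl ?exprn_ge0// ltW.
exists (limn (fun n => (s n).2)) => e e0.
have /cvgrPdist_lt/(_ _ e0) [N1 _ h1] := cs.
have [N2 h2] := expr_small half0 half1 (@ler01 C) e0.
pose n := maxn N1 N2; exists (s n).1, (s n).2; split; first by case: (sP n).
  have [_ fg] := sP n; apply: lt_trans fg _; apply: le_lt_trans h2.
  by rewrite mul1r ler_wiXn2l// ?(ltW half1)// leq_maxr.
by apply: h1; rewrite /= leq_maxl.
Qed.

Definition fcalc (f : H) : D := sval (cid (graph_exists f)).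

Let fcalcP f : graph f (fcalc f).
Proof. exact: svalP (cid (graph_exists f)). Qed.

Lemma fcalc_dist f g : `|fcalc f - fcalc g| <= `|f - g|.
Proof. exact: graph_dist. Qed.

Lemma fcalcE f d : calc u f d -> fcalc f = d.
Proof.
move=> c; apply/eqP; rewrite -subr_eq0 -normr_le0.
by have := graph_dist (fcalcP f) (graph_calc c); rewrite subrr normr0.
Qed.

Lemma fcalc_continuous : continuous fcalc.
Proof.
exact: nonexpansive_continuous fcalc_dist.
Qed.

Let dom : set H := [set g | exists b, calc u g b].

Let dom_dense : dense dom.
Proof.
apply/denseP_norm => f e e0; have [g [b [c fg]]] := calc_dense u f e0.
by exists g => //; exists b.
Qed.

Lemma fcalc_hom : unital_star_hom fcalc.
Proof.
have cf := fcalc_continuous.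
have ci := @cs_id_continuous R H; have cc := @cs_cst_continuous R H.
split.
- move=> k f g; move: f; apply: (dense_continuous_eq dom_dense).
  + apply: (compf_continuous cf); apply: addf_continuous; last exact: cc.
    exact: scalef_continuous.
  + by apply: addf_continuous; [exact: scalef_continuous|exact: cc].
  move=> f [b c]; move: g; apply: (dense_continuous_eq dom_dense).
  + by apply: (compf_continuous cf); apply: addf_continuous; [exact: cc|].
  + by apply: addf_continuous; [exact: cc|].
  move=> g [b' c'].
  by rewrite (fcalcE c) (fcalcE c') (fcalcE (calcD (calcZ k c) c')).
- move=> f g; move: f; apply: (dense_continuous_eq dom_dense).
  + by apply: (compf_continuous cf); apply: mulf_continuous; [|exact: cc].
  + by apply: mulf_continuous; [|exact: cc].
  move=> f [b c]; move: g; apply: (dense_continuous_eq dom_dense).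
  + by apply: (compf_continuous cf); apply: mulf_continuous; [exact: cc|].
  + by apply: mulf_continuous; [exact: cc|].
  move=> g [b' c'].
  by rewrite (fcalcE c) (fcalcE c') (fcalcE (calcM c c')).
- exact/fcalcE/calc1.
apply: (dense_continuous_eq dom_dense).
- exact: (compf_continuous cf (@star_continuous R H)).
- exact: (starf_continuous cf).
by move=> f [b c]; rewrite (fcalcE c) (fcalcE (calc_star c)).
Qed.

Lemma fcalc_circz : fcalc (circz R) = u.
Proof. exact/fcalcE/calcz. Qed.

End FunctionalCalculus.

Lemma star_hom_eq (R : realType) (D : cstarAlg R) (f g : C_S1 R -> D) :
  unital_star_hom f -> unital_star_hom g -> continuous f -> continuous g ->
  f (circz R) = g (circz R) -> f =1 g.
Proof.
move=> [f1 f2 f3 f4] [g1 g2 g3 g4] cf cg fg.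
have dd : dense [set h : C_S1 R | exists b, calc (f (circz R)) h b].
  apply/denseP_norm => h e e0; have [k [b [c hk]]] := calc_dense (f (circz R)) h e0.
  by exists k => //; exists b.
apply: (dense_continuous_eq dd) => // h [b]; elim=> [|||||].
- by rewrite f3 g3.
- by [].
- by rewrite f4 g4 fg.
- by move=> p q p' q' _ h1 _ h2; have := f1 1 p p'; rewrite !scale1r h1 h2 => ->;
    have := g1 1 p p'; rewrite !scale1r.
- move=> k p q _ h1; have f0 : f 0 = 0.
    have := f1 1 0 0; rewrite !scale1r addr0 -{1}[f 0]addr0.
    by move/addrI.
  have g0 : g 0 = 0.
    have := g1 1 0 0; rewrite !scale1r addr0 -{1}[g 0]addr0.
    by move/addrI.
  by have := f1 k p 0; have := g1 k p 0; rewrite !addr0 f0 g0 !addr0 h1 => -> ->.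
- by move=> p q p' q' _ h1 _ h2; rewrite f2 g2 h1 h2.
Qed.

(** * The homomorphism into the join *)

Section EvaluationHom.
Variables (R : realType) (X : compactType) (D : cstarAlg R).

Lemma ev_hom (x : X) : unital_star_hom (fun f : cfun_cstar X D => ev f x).
Proof. by []. Qed.

Lemma ev_contractive_continuous (x : X) : continuous (fun f : cfun_cstar X D => ev f x).
Proof. by apply: contractive_continuous => // f; exact: ev_norm_le. Qed.

Lemma tens_cfun1_hom : unital_star_hom (@tens_cfun R X D 1).
Proof.
split=> [k u v|u v||u]; apply: ev_ext => x.
- by rewrite evD evZ !ev_tens_cfun evD evZ scalerDl scalerA.
- by rewrite evM !ev_tens_cfun -scalerAl -scalerAr mulr1 scalerA.
- by rewrite ev_tens_cfun scale1r.
- by rewrite ev_star !ev_tens_cfun starZ star1.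
Qed.

Lemma tens_cfun1_continuous : continuous (@tens_cfun R X D 1).
Proof.
apply: contractive_continuous; first by case: tens_cfun1_hom.
move=> f; apply: norm_le_ev => x.
by rewrite ev_tens_cfun normrZ norm1 mulr1; exact: (ev_norm_le f x).
Qed.

End EvaluationHom.

Lemma star_hom_scale (R : realType) (A B : cstarAlg R) (f : A -> B) (k : cplx R) x :
  linear f -> f (k *: x) = k *: f x.
Proof.
move=> lf; have f0 : f 0 = 0.
  have := lf 1 0 0; rewrite !scale1r addr0 -{1}[f 0]addr0.
  by move/addrI.
by have := lf k x 0; rewrite f0 !addr0.
Qed.

Section JoinHom.
Variables (R : realType) (B : cstarAlg R) (eB : enough_states B).
Local Notation C := (cplx R).
Local Notation S1 := (circle R).
Local Notation I1 := (itv01 R).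
Local Notation A := (cfun_cstar S1 B).
Local Notation F1 D := (cfun_cstar S1 D).
Local Notation cyl := (cfun_cstar I1 (F1 A)).
Variable v : cfun_cstar I1 A.
Hypotheses (vv : star v * v = 1) (vv' : v * star v = 1).
Hypotheses (v0 : ev v (itv01_0 R) = 1) (v1 : ev v (itv01_1 R) = tens_cfun 1 (circz R)).

Lemma join_unitary_subproof :
  continuous (fun p : I1 * S1 => (\val p.2 : C) *: ev v p.1).
Proof.
move=> p.
have H1 : (fun p : I1 * S1 => \val p.2 : C^o) @ p --> (\val p.2 : C^o).
  apply: (@continuous_comp _ _ _ snd (fun x : S1 => \val x : C)); first exact: cvg_snd.
  exact: circle_val_cont.
apply: (cvgZ H1); apply: (@continuous_comp _ _ _ fst (ev v)); first exact: cvg_fst.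
exact: ev_continuous.
Qed.

Definition join_unitary : cyl :=
  @cf2 R S1 I1 A (fun t g => (\val g : C) *: ev v t) join_unitary_subproof.

Lemma join_unitaryK : star join_unitary * join_unitary = 1.
Proof.
apply: ev2_ext => t g.
transitivity (star ((\val g : C) *: ev v t) * ((\val g : C) *: ev v t)) => //.
rewrite starZ -scalerAl -scalerAr scalerA mulrC -sqr_normc circle_norm expr1n scale1r.
by rewrite -ev_star -evM vv.
Qed.

Lemma join_unitaryK' : join_unitary * star join_unitary = 1.
Proof.
apply: ev2_ext => t g.
transitivity (((\val g : C) *: ev v t) * star ((\val g : C) *: ev v t)) => //.
rewrite starZ -scalerAl -scalerAr scalerA -sqr_normc circle_norm expr1n scale1r.
by rewrite -ev_star -evM vv'.
Qed.

Let eA : enough_states A := enough_states_cfun (X := S1) eB.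
Let ecyl : enough_states cyl := enough_states_cfun (X := I1) (enough_states_cfun (X := S1) eA).

Definition join_hom : C_S1 R -> cyl := fcalc join_unitaryK join_unitaryK' ecyl.

Let phi_hom : unital_star_hom join_hom := fcalc_hom _ _ _.
Let phi_cont : continuous join_hom := @fcalc_continuous _ _ _ _ _ _.
Let phi_circz : join_hom (circz R) = join_unitary := fcalc_circz _ _ _.

(** Continuous *-homomorphisms out of C(S^1) that agree at [circz] are equal, so each identity for
    [join_hom] reduces to one for [join_unitary]; here it is [v 0 = 1]. *)
Lemma join_hom_start f : ev (join_hom f) (itv01_0 R) = tens_cfun 1 f.
Proof.
apply: (@star_hom_eq R (F1 A) (fun f => ev (join_hom f) (itv01_0 R)) (@tens_cfun R S1 A 1)).
- exact: (star_hom_comp phi_hom (ev_hom (F1 A) (itv01_0 R))).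
- exact: tens_cfun1_hom.
- exact: (compf_continuous (@ev_contractive_continuous R I1 (F1 A) (itv01_0 R)) phi_cont).
- exact: tens_cfun1_continuous.
rewrite phi_circz; apply: ev_ext => g.
transitivity ((\val g : C) *: ev v (itv01_0 R)) => //.
by rewrite v0.
Qed.

(** At the generator both sides are [(g, s) |-> g s]: the factor [g] of [join_unitary] multiplies
    the value of [v 1] at [s], which is [s], and this is the translate of [z] by [g]. *)
Lemma join_hom_end f : ev (join_hom f) (itv01_1 R) = cshift (tens_cfun 1 f).
Proof.
apply: (@star_hom_eq R (F1 A) (fun f => ev (join_hom f) (itv01_1 R)) (fun f => cshift (@tens_cfun R S1 B 1 f))).
- exact: (star_hom_comp phi_hom (ev_hom (F1 A) (itv01_1 R))).
- exact: (star_hom_comp (tens_cfun1_hom S1 B) (cshift_hom B)).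
- exact: (compf_continuous (@ev_contractive_continuous R I1 (F1 A) (itv01_1 R)) phi_cont).
- exact: (compf_continuous (@cshift_continuous R B) (@tens_cfun1_continuous R S1 B)).
rewrite phi_circz; apply: ev2_ext => g s.
transitivity ((\val g : C) *: ev (ev v (itv01_1 R)) s) => //.
rewrite v1 ev_cshift !ev_tens_cfun scalerA; congr (_ *: _).
exact: mulrC.
Qed.

Lemma join_hom_join f : nc_join (translation eB) (join_hom f).
Proof.
split; first by exists f; exact: join_hom_start.
by exists (tens_cfun 1 f); exact: join_hom_end.
Qed.

Definition cylH : minTensor cyl (C_S1 R) := cfun_tensor S1 ecyl.

(** [cmap] leaves time as the outermost variable, while in [cyl (x) H] the outermost variable is
    that of [H]; hence the swap. *)
Definition cyl_coaction (f : cyl) : F1 cyl :=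
  cswap (cmap (@cshift_continuous R A) f).

Lemma ev_cyl_coaction f y t x :
  ev (ev (ev (cyl_coaction f) y) t) x = ev (ev f t) (circle_mul x y).
Proof. by []. Qed.

Lemma join_hom_intertwines h : cyl_coaction (join_hom h) = cmap phi_cont (cshift h).
Proof.
apply: ev_ext => y.
pose sw : C_S1 R -> cyl := fun h => ev (cyl_coaction (join_hom h)) y.
pose tr : C_S1 R -> cyl := fun h => join_hom (ev (cshift h) y).
apply: (@star_hom_eq R cyl sw tr).
- have h1 := @cmap_hom R I1 _ _ _ (@cshift_continuous R A) (cshift_hom A).
  have [h2 _] := @cswap_iso R S1 I1 (F1 A).
  exact: (star_hom_comp phi_hom (star_hom_comp (star_hom_comp h1 h2) (ev_hom cyl y))).
- exact: (star_hom_comp (star_hom_comp (cshift_hom (cplx_cstar R)) (ev_hom _ y)) phi_hom).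
- have cev : continuous (fun f : cyl => ev (cyl_coaction f) y).
    apply: contractive_continuous => [k f g|f]; first by apply: ev_ext => t; apply: ev_ext.
    apply: norm_le_ev2 => t x; rewrite ev_cyl_coaction; exact: ev2_norm_le.
  exact: (compf_continuous cev phi_cont).
- apply: (compf_continuous phi_cont).
  apply: (compf_continuous (@ev_contractive_continuous R S1 (C_S1 R) y)).
  exact: cshift_continuous.
rewrite /sw /tr phi_circz.
have -> : ev (cshift (circz R)) y = (\val y : C) *: circz R.
  by apply: ev_ext => x; rewrite evZ ev_cshift /=; exact: mulrC.
rewrite (star_hom_scale _ _ (let: And4 l _ _ _ := phi_hom in l)) phi_circz.
apply: ev2_ext => t x; rewrite ev_cyl_coaction.
transitivity ((\val y * \val x : C) *: ev v t); last by rewrite -scalerA.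
by rewrite [X in X *: _]mulrC.
Qed.

Lemma join_hom_equivariant : join_equivariant (translation eB) join_hom.
Proof.
exists cylH, (@cswap R I1 S1 (F1 A)), cyl_coaction, (cmap phi_cont); split.
- by split; [exact: cswap_iso|move=> f h t; apply: ev_ext].
- by move=> f _ t; apply: ev2_ext.
- split; first exact: cmap_hom.
  move=> f h; apply: ev_ext => y; rewrite ev_cmap.
  exact: (star_hom_scale _ _ (let: And4 l _ _ _ := phi_hom in l)).
- by move=> h; exact: join_hom_intertwines.
Qed.

End JoinHom.

(** * Bounded operators on l2 *)

Section Summation.
Variable R : realType.
Local Notation C := (cplx R).

Lemma cplx_cvg_unique (u : nat -> C) (a b : C) : u @ \oo --> a -> u @ \oo --> b -> a = b.
Proof. by move=> ua ub; apply: (@cvg_unique C (@norm_hausdorff C C^o) _ _ a b ua ub). Qed.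

(** In the order of the complex numbers [0 <= l] also asserts that [l] is real, so the imaginary
    parts have to be followed to the limit too. *)
Lemma cplx_lim_ge0 (T : Type) (F : set_system T) (FF : ProperFilter F) (u : T -> C) (l : C) :
  u @ F --> l -> (\forall t \near F, 0 <= u t) -> 0 <= l.
Proof.
move=> ul u0.
have rl : (fun t => complex.Re (u t)) @ F --> complex.Re l.
  exact: (continuous_cvg _ (@Re_continuous R l) ul).
have il : (fun t => complex.Im (u t)) @ F --> complex.Im l.
  exact: (continuous_cvg _ (@Im_continuous R l) ul).
have l0 : 0 <= complex.Re l.
  rewrite -(cvg_lim _ rl)//; apply: limr_ge; first by apply/cvg_ex; exists (complex.Re l).
  by apply: filterS u0 => t ut; rewrite -cplx_le -(cplx_real ut).
have i0 : complex.Im l = 0.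
  apply: (cvg_unique _ il); first exact: Rhausdorff.
  by apply: cvg_near_cst; apply: filterS u0 => t ut; rewrite (cplx_real ut).
by case: l l0 i0 {ul rl il} => a b /= a0 ->; rewrite (cplx_le 0).
Qed.

Lemma conjc_continuous : continuous (@conjc R : C -> C).
Proof. exact: (@star_continuous R (cplx_cstar R)). Qed.

Lemma summable_cvg (f : nat -> C) (M : C) :
  (forall n, \sum_(k < n) `|f k| <= M) -> cvgn (fun n => \sum_(k < n) f k).
Proof.
move=> fM; pose r n : R := complex.Re (\sum_(k < n) `|f k|).
have rE n : \sum_(k < n) `|f k| = (r n)%:C%C :> C.
  by apply: cplx_real; apply: sumr_ge0.
have rd : nondecreasing_seq r.
  apply/nondecreasing_seqP => n; rewrite -cplx_le -!rE big_ord_recr /= lerDl//.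
have M0 : 0 <= M by have := fM 0%N; rewrite big_ord0.
have rb : has_ubound (range r).
  exists (complex.Re M) => _ [n _ <-]; rewrite -cplx_le -rE -(cplx_real M0); exact: fM.
have rc : cvgn r := nondecreasing_is_cvgn rd rb.
apply: (@cauchy_cvg C); apply: cauchy_exP => e e0.
have e0' : 0 < complex.Re e by rewrite -cplx_lt -(cplx_real (ltW e0)).
have /cvgrPdist_lt/(_ _ e0')[N _ rN] := rc.
exists (\sum_(k < N) f k); exists N => // n /= Nn.
rewrite -ball_normE /= distrC -(subnKC Nn) big_split_ord /= addrAC subrr add0r.
rewrite (cplx_real (ltW e0)); apply: le_lt_trans (ler_norm_sum _ _ _) _.
have -> : \sum_(i < n - N) `|f (N + i)%N| = (r n - r N)%:C%C :> C.
  have -> : r n = r (N + (n - N))%N by rewrite subnKC.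
  by rewrite rmorphB /= -!rE big_split_ord /= addrAC subrr add0r.
rewrite cplx_lt; apply: le_lt_trans (rN N (leqnn N)).
rewrite ger0_norm ?subr_ge0; last exact: nondecreasing_cvgn_le.
by rewrite lerD2r; exact: nondecreasing_cvgn_le.
Qed.

End Summation.

Section Ell2.
Variable R : realType.
Local Notation C := (cplx R).

Record ell2 := Ell2 {
  coord :> nat -> C;
  ell2P : exists M : C, forall n, \sum_(k < n) `|coord k| ^+ 2 <= M }.

Lemma ell2_ext (x y : ell2) : (x : nat -> C) =1 y -> x = y.
Proof.
case: x y => [x xM] [y yM] /= /funext xy; subst y.
by congr Ell2; exact: Prop_irrelevance.
Qed.

HB.instance Definition _ := gen_eqMixin ell2.
HB.instance Definition _ := gen_choiceMixin ell2.

Lemma sqr_norm_parallelogram (a b : C) : `|a + b| ^+ 2 <= 2 * (`|a| ^+ 2 + `|b| ^+ 2).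
Proof.
apply: (@le_trans _ _ ((`|a| + `|b|) ^+ 2)).
  by rewrite !expr2; apply: ler_pM => //; exact: ler_normD.
rewrite -subr_ge0 (_ : _ - _ = (`|a| - `|b|) ^+ 2); last by ring.
by rewrite -realEsqr rpredB// normr_real.
Qed.

Lemma ell2_0_subproof : exists M : C, forall n, \sum_(k < n) `|(0 : C)| ^+ 2 <= M.
Proof. by exists 0 => n; rewrite big1// => k _; rewrite normr0 expr0n. Qed.
Definition ell2_0 := @Ell2 (fun=> 0) ell2_0_subproof.

Lemma ell2_D_subproof (x y : ell2) :
  exists M : C, forall n, \sum_(k < n) `|x k + y k| ^+ 2 <= M.
Proof.
have [M xM] := ell2P x; have [N yN] := ell2P y; exists (2 * (M + N)) => n.
apply: (@le_trans _ _ (2 * (\sum_(k < n) `|x k| ^+ 2 + \sum_(k < n) `|y k| ^+ 2))).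
  rewrite -big_split mulr_sumr; apply: ler_sum => k _; exact: sqr_norm_parallelogram.
by rewrite ler_wpM2l// lerD.
Qed.
Definition ell2_D (x y : ell2) := @Ell2 (fun k => x k + y k) (ell2_D_subproof x y).

Lemma ell2_Z_subproof (c : C) (x : ell2) :
  exists M : C, forall n, \sum_(k < n) `|c * x k| ^+ 2 <= M.
Proof.
have [M xM] := ell2P x; exists (`|c| ^+ 2 * M) => n.
under eq_bigr do rewrite normrM exprMn.
by rewrite -mulr_sumr ler_wpM2l// exprn_ge0.
Qed.
Definition ell2_Z c (x : ell2) := @Ell2 (fun k => c * x k) (ell2_Z_subproof c x).

Lemma ell2_N_subproof (x : ell2) :
  exists M : C, forall n, \sum_(k < n) `|- x k| ^+ 2 <= M.
Proof. by have [M xM] := ell2P x; exists M => n; under eq_bigr do rewrite normrN. Qed.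
Definition ell2_N (x : ell2) := @Ell2 (fun k => - x k) (ell2_N_subproof x).

Lemma ell2_addA : associative ell2_D.
Proof. by move=> x y z; apply: ell2_ext => k; exact: addrA. Qed.
Lemma ell2_addC : commutative ell2_D.
Proof. by move=> x y; apply: ell2_ext => k; exact: addrC. Qed.
Lemma ell2_add0 : left_id ell2_0 ell2_D.
Proof. by move=> x; apply: ell2_ext => k; exact: add0r. Qed.
Lemma ell2_addN : left_inverse ell2_0 ell2_N ell2_D.
Proof. by move=> x; apply: ell2_ext => k; exact: addNr. Qed.
HB.instance Definition _ :=
  GRing.isZmodule.Build ell2 ell2_addA ell2_addC ell2_add0 ell2_addN.

Lemma ell2_scaleA a b x : ell2_Z a (ell2_Z b x) = ell2_Z (a * b) x.
Proof. by apply: ell2_ext => k; exact: mulrA. Qed.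
Lemma ell2_scale1 : left_id 1 ell2_Z.
Proof. by move=> x; apply: ell2_ext => k; exact: mul1r. Qed.
Lemma ell2_scaleDr : right_distributive ell2_Z +%R.
Proof. by move=> a x y; apply: ell2_ext => k; exact: mulrDr. Qed.
Lemma ell2_scaleDl x : {morph ell2_Z^~ x : a b / a + b}.
Proof. by move=> a b; apply: ell2_ext => k; exact: mulrDl. Qed.
HB.instance Definition _ := GRing.Zmodule_isLmodule.Build C ell2
  ell2_scaleA ell2_scale1 ell2_scaleDr ell2_scaleDl.

Definition ip_seq (x y : ell2) : nat -> C := fun n => \sum_(k < n) conjc (x k) * y k.
Definition ip (x y : ell2) : C := limn (ip_seq x y).

Lemma normr_conjc (a : C) : `|conjc a : C| = `|a|.
Proof. exact: (@cs_norm_star R (cplx_cstar R)). Qed.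

Lemma ip_cvg x y : ip_seq x y @ \oo --> ip x y.
Proof.
have [M xM] := ell2P x; have [N yN] := ell2P y.
suff : cvgn (ip_seq x y) by [].
apply: (@summable_cvg R (fun k => conjc (x k) * y k) (M + N)) => n.
apply: (@le_trans _ _ (\sum_(k < n) (`|x k| ^+ 2 + `|y k| ^+ 2))); last first.
  by rewrite big_split lerD.
apply: ler_sum => k _; rewrite normrM normr_conjc.
have h : `|x k| * `|y k| *+ 2 <= `|x k| ^+ 2 + `|y k| ^+ 2.
  by rewrite -subr_ge0 addrAC -sqrrB -realEsqr rpredB// normr_real.
by apply: le_trans h; rewrite mulr2n lerDl mulr_ge0.
Qed.

Lemma ipDr x y z : ip x (y + z) = ip x y + ip x z.
Proof.
apply: (cplx_cvg_unique (@ip_cvg x (y + z))).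
rewrite (_ : ip_seq x (y + z) = fun n => ip_seq x y n + ip_seq x z n).
  by apply: cvgD; exact: ip_cvg.
by apply/funext => n; rewrite -big_split; apply: eq_bigr => k _; exact: mulrDr.
Qed.

Lemma ipZr x c y : ip x (c *: y) = c * ip x y.
Proof.
apply: (cplx_cvg_unique (@ip_cvg x (c *: y))).
rewrite (_ : ip_seq x (c *: y) = fun n => c * ip_seq x y n).
  by apply: (@cvgM C); [exact: cvg_cst|exact: ip_cvg].
by apply/funext => n; rewrite mulr_sumr; apply: eq_bigr => k _; exact: mulrCA.
Qed.

Lemma ipC x y : ip y x = conjc (ip x y).
Proof.
apply: (cplx_cvg_unique (@ip_cvg y x)).
rewrite (_ : ip_seq y x = (@conjc R : C -> C) \o ip_seq x y).
  exact: (continuous_cvg _ (@conjc_continuous R (ip x y)) (@ip_cvg x y)).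
apply/funext => n.
rewrite /ip_seq /= (big_morph (@conjc R : C -> C) (@cplx_conjD R) (conjc0 _)).
by apply: eq_bigr => k _; rewrite [RHS]cplx_conjM conjcK.
Qed.

Lemma partial_le_ip (x : ell2) n : \sum_(k < n) `|x k| ^+ 2 <= ip x x.
Proof.
rewrite -subr_ge0.
have h : (fun m => ip_seq x x m - \sum_(k < n) `|x k| ^+ 2) @ \oo --> ip x x - \sum_(k < n) `|x k| ^+ 2.
  by apply: (@cvgB C C^o); [exact: ip_cvg|exact: cvg_cst].
apply: (cplx_lim_ge0 _ h); exists n => // m /= nm.
rewrite /ip_seq -(subnKC nm) big_split_ord /= addrAC.
rewrite (_ : \sum_(i < n) _ - _ = 0) ?add0r; last first.
  by rewrite -sumrB big1// => k _; rewrite sqr_normc [X in X - _]mulrC subrr.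
apply: sumr_ge0 => k _; rewrite mulrC -sqr_normc exprn_ge0//.
Qed.

Lemma ip_ge0 x : 0 <= ip x x.
Proof. by have := partial_le_ip x 0; rewrite big_ord0. Qed.

Lemma ip_le (x : ell2) (M : C) : (forall n, \sum_(k < n) `|x k| ^+ 2 <= M) -> ip x x <= M.
Proof.
move=> xM; rewrite -subr_ge0.
have h : (fun m => M - ip_seq x x m) @ \oo --> M - ip x x.
  by apply: (@cvgB C C^o); [exact: cvg_cst|exact: ip_cvg].
apply: (cplx_lim_ge0 _ h); exists 0%N => // m _; rewrite subr_ge0.
apply: le_trans (xM m); rewrite le_eqVlt; apply/orP; left; apply/eqP.
by apply: eq_bigr => k _; rewrite sqr_normc mulrC.
Qed.

Lemma ip0r x : ip x 0 = 0.
Proof. by rewrite -(scale0r (0 : ell2)) ipZr mul0r. Qed.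

Lemma ipNr x y : ip x (- y) = - ip x y.
Proof. by rewrite -scaleN1r ipZr mulN1r. Qed.

Lemma ipBr x y z : ip x (y - z) = ip x y - ip x z.
Proof. by rewrite ipDr ipNr. Qed.

Lemma ipDl x y z : ip (x + y) z = ip x z + ip y z.
Proof. by rewrite ipC ipDr cplx_conjD -!ipC. Qed.

Lemma ipZl c x y : ip (c *: x) y = conjc c * ip x y.
Proof. by rewrite ipC ipZr cplx_conjM -ipC mulrC. Qed.

Lemma ipBl x y z : ip (x - y) z = ip x z - ip y z.
Proof. by rewrite ipDl -scaleN1r ipZl [conjc _](_ : _ = -1) ?mulN1r// /conjc /= oppr0. Qed.

Lemma ip_eq0 x : ip x x = 0 -> x = 0.
Proof.
move=> x0; apply: ell2_ext => k; apply/eqP; rewrite -normr_eq0 -sqrf_eq0 eq_le exprn_ge0// andbT.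
by have := partial_le_ip x k.+1; rewrite x0 big_ord_recr /=; apply: le_trans; rewrite lerDr sumr_ge0// => i _; rewrite exprn_ge0.
Qed.

Lemma cauchy_schwarz_sqr x y : `|ip x y| ^+ 2 <= ip x x * ip y y.
Proof.
have [/ip_eq0->|y0] := eqVneq (ip y y) 0; first by rewrite !ip0r normr0 expr0n mulr0.
have yp : 0 < ip y y by rewrite lt_def y0 ip_ge0.
pose t := ip y x / ip y y.
have tc : conjc t = ip x y / ip y y.
  by rewrite /t cplx_conjM -ipC conjc_ge0 ?invr_ge0 ?ip_ge0// mulrC.
have := ip_ge0 (x - t *: y).
rewrite ipBl !ipBr !ipZl !ipZr tc sqr_normc -ipC.
rewrite (_ : _ - _ = ip x x - ip x y * ip y x / ip y y); last by rewrite /t; field.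
by rewrite subr_ge0 ler_pdivrMr.
Qed.

Definition ell2_norm x : C := sqrtC (ip x x).

Lemma ell2_norm_ge0 x : 0 <= ell2_norm x.
Proof. by rewrite sqrtC_ge0 ip_ge0. Qed.

Lemma ell2_normK x : ell2_norm x ^+ 2 = ip x x.
Proof. exact: sqrtCK. Qed.

Lemma cauchy_schwarz0 x y : `|ip x y| <= ell2_norm x * ell2_norm y.
Proof.
rewrite -(@ler_pXn2r _ 2)// ?nnegrE ?mulr_ge0 ?ell2_norm_ge0//.
by rewrite exprMn !ell2_normK cauchy_schwarz_sqr.
Qed.

Lemma addc_conj_le (a : C) : a + conjc a <= 2 * `|a|.
Proof.
apply: (@le_trans _ _ (2 * `|complex.Re a|%:C%C)); last by rewrite ler_wpM2l// norm_Re_le.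
rewrite (_ : a + conjc a = 2 * (complex.Re a)%:C%C) ?ler_wpM2l// ?cplx_le ?ler_norm//.
by case: a => a b; rewrite mulr_natl mulr2n; congr Complex => /=; rewrite ?subrr ?addr0.
Qed.

Lemma ell2_normD x y : ell2_norm (x + y) <= ell2_norm x + ell2_norm y.
Proof.
rewrite -(@ler_pXn2r _ 2)// ?nnegrE ?addr_ge0 ?ell2_norm_ge0//.
have h : ip x y + ip y x <= ell2_norm x * ell2_norm y *+ 2.
  rewrite (ipC x y); apply: le_trans (addc_conj_le _) _.
  by rewrite -[leRHS]mulr_natl ler_wpM2l// cauchy_schwarz0.
rewrite ell2_normK sqrrD !ell2_normK ipDl !ipDr.
rewrite [leLHS](_ : _ = ip x x + (ip x y + ip y x) + ip y y); last by ring.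
by rewrite lerD2r lerD2l.
Qed.

Lemma ell2_normZ (c : C) x : ell2_norm (c *: x) = `|c| * ell2_norm x.
Proof.
apply/eqP; rewrite -(@eqrXn2 _ 2)// ?ell2_norm_ge0 ?mulr_ge0 ?ell2_norm_ge0//.
by rewrite exprMn !ell2_normK ipZl ipZr mulrA sqr_normc [conjc c * c]mulrC.
Qed.

Lemma ell2_norm_eq0 x : ell2_norm x = 0 -> x = 0.
Proof. by move=> x0; apply: ip_eq0; rewrite -ell2_normK x0 expr0n. Qed.

HB.instance Definition _ := isPointed.Build ell2 0.
HB.instance Definition _ :=
  Lmodule_isNormed.Build C ell2 ell2_normD ell2_normZ ell2_norm_eq0.

Lemma sqr_norm_ip x : `|x| ^+ 2 = ip x x.
Proof. exact: ell2_normK. Qed.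

Lemma cauchy_schwarz x y : `|ip x y| <= `|x| * `|y|.
Proof. exact: cauchy_schwarz0. Qed.

Lemma coord_le_norm (x : ell2) k : `|x k| <= `|x|.
Proof.
rewrite -(@ler_pXn2r _ 2)// ?nnegrE// sqr_norm_ip.
apply: le_trans (partial_le_ip x k.+1).
by rewrite big_ord_recr /= lerDr sumr_ge0// => i _; rewrite exprn_ge0.
Qed.

Lemma ell2_complete (F : set_system ell2) : ProperFilter F -> cauchy F -> cvg F.
Proof.
move=> FF Fc.
have Fe (e : C) : 0 < e -> exists2 A : set ell2, F A &
    forall x y, A x -> A y -> `|x - y| < e.
  move=> e0; have e2 : 0 < e / 2 by rewrite divr_gt0.
  have /cauchyP /(_ _ e2)[h Fh] := Fc.
  exists (ball h (e / 2)) => // f g; rewrite -ball_normE /= => hf hg.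
  by rewrite (@distm_lt_split _ _ h)// distrC.
have cx k : cvg ((fun x : ell2 => x k) @ F).
  apply: (@cauchy_cvg C); apply: cauchy_exP => e e0.
  have [A FA Ae] := Fe _ e0; have [h Ah] := filter_ex FA.
  exists (h k); rewrite /nbhs/= /fmap/=; apply: filterS FA => y Ay /=.
  rewrite -ball_normE /=; apply: le_lt_trans (Ae _ _ Ah Ay).
  exact: (coord_le_norm (h - y) k).
pose l k : C := lim ((fun x : ell2 => x k) @ F).
have Al (e : C) A : 0 < e -> F A -> (forall x y, A x -> A y -> `|x - y| < e) ->
    forall x, A x -> forall n, \sum_(k < n) `|x k - l k| ^+ 2 <= e ^+ 2.
  move=> e0 FA Ae x Ax n; rewrite -subr_ge0.
  apply: (@cplx_lim_ge0 R _ F _ (fun y : ell2 => e ^+ 2 - \sum_(k < n) `|x k - y k| ^+ 2)).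
    apply: (@cvgB C C^o); first exact: cvg_cst.
    apply: cvg_big => [|k _]; first exact: add_continuous.
    have h : (fun y : ell2 => `|x k - y k| : C) @ F --> (`|x k - l k| : C).
      apply: (@cvg_norm C C^o); apply: (@cvgB C C^o); first exact: cvg_cst.
      exact: cx.
    exact: (@cvgM C _ _ _ _ _ _ _ h h).
  apply: filterS FA => y Ay; rewrite subr_ge0.
  apply: le_trans (partial_le_ip (x - y) n) _; rewrite -sqr_norm_ip.
  by rewrite !expr2; apply: ler_pM => //; apply/ltW/Ae.
have [A FA Ae] := Fe 1 ltr01; have [h Ah] := filter_ex FA.
have lM : exists M : C, forall n, \sum_(k < n) `|l k| ^+ 2 <= M.
  exists (2 * (ip h h + 1 ^+ 2)) => n.
  apply: (@le_trans _ _ (2 * (\sum_(k < n) `|h k| ^+ 2 + \sum_(k < n) `|h k - l k| ^+ 2))).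
    rewrite -big_split mulr_sumr; apply: ler_sum => k _.
    rewrite -[`|h k - l k|]normrN; apply: le_trans (sqr_norm_parallelogram _ _).
    by rewrite opprB addrC subrK.
  by rewrite ler_wpM2l// lerD ?partial_le_ip//; exact: Al ltr01 FA Ae _ Ah n.
apply/cvg_ex; exists (@Ell2 l lM).
apply/(@fcvgrPdist_lt C ell2 F) => e e0.
have e2 : 0 < e / 2 by rewrite divr_gt0.
have [A' FA' Ae'] := Fe _ e2; apply: (filterS _ FA') => x A'x.
apply: (@le_lt_trans _ _ (e / 2)); last by rewrite ltr_pdivrMr// ltr_pMr// ltr1n.
rewrite distrC -(@ler_pXn2r _ 2)// ?nnegrE ?(ltW e2)// sqr_norm_ip.
apply: ip_le => n; exact: Al e2 FA' Ae' _ A'x n.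
Qed.

HB.instance Definition _ := Uniform_isComplete.Build ell2 ell2_complete.

End Ell2.

(** * The C*-algebra of bounded operators on l2 *)

Section BoundedOperators.
Variable R : realType.
Local Notation C := (cplx R).
Local Notation E := (ell2 R).

(** Carrying the adjoint as data avoids the Riesz representation theorem. It is determined by the
    operator, whence [bop_ext], and its existence forces linearity, whence [bopD] and [bopZ]. *)
Record bop := Bop {
  bop_fun :> E -> E;
  bop_adj : E -> E;
  bop_adjP : forall x y, ip (bop_fun x) y = ip x (bop_adj y);
  bop_bounded : exists2 M : C, 0 <= M & forall x, `|bop_fun x| <= M * `|x| }.

Lemma ip_nondegenerate (a b : E) : (forall z, ip z a = ip z b) -> a = b.
Proof. by move=> h; apply/eqP; rewrite -subr_eq0; apply/eqP/ip_eq0; rewrite ipBr h subrr. Qed.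

Lemma bop_ext (S T : bop) : (S : E -> E) =1 T -> S = T.
Proof.
case: S T => [f a h b] [f' a' h' b'] /= /funext ff; subst f'.
have aa : a = a'.
  by apply/funext => y; apply: ip_nondegenerate => z; rewrite -h h'.
by subst a'; congr Bop; exact: Prop_irrelevance.
Qed.

Lemma bop_adjP' (T : bop) x y : ip (bop_adj T x) y = ip x (T y).
Proof. by rewrite ipC -bop_adjP -ipC. Qed.

Lemma bopD (T : bop) x y : T (x + y) = T x + T y.
Proof. by apply: ip_nondegenerate => z; rewrite -bop_adjP' !ipDr !bop_adjP'. Qed.

Lemma bopZ (T : bop) (c : C) x : T (c *: x) = c *: T x.
Proof. by apply: ip_nondegenerate => z; rewrite -bop_adjP' !ipZr !bop_adjP'. Qed.

Lemma bop0 (T : bop) : T 0 = 0.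
Proof. by rewrite -(scale0r (0 : E)) bopZ !scale0r. Qed.

Lemma adj_bounded (f a : E -> E) (M : C) : 0 <= M -> (forall x y, ip (f x) y = ip x (a y)) ->
  (forall x, `|f x| <= M * `|x|) -> forall y, `|a y| <= M * `|y|.
Proof.
move=> M0 fa fM y; have [->|ay0] := eqVneq (a y) 0; first by rewrite normr0 mulr_ge0.
rewrite -(@ler_pM2l _ `|a y|) ?normr_gt0// -expr2 sqr_norm_ip -fa.
apply: le_trans (_ : `|ip (f (a y)) y| <= _).
  by rewrite ger0_norm// fa ip_ge0.
apply: le_trans (cauchy_schwarz _ _) _.
by rewrite mulrA [`|a y| * M]mulrC ler_wpM2r.
Qed.

Lemma bop_D_bounded (S T : bop) :
  exists2 M : C, 0 <= M & forall x, `|S x + T x| <= M * `|x|.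
Proof.
have [M M0 SM] := bop_bounded S; have [N N0 TN] := bop_bounded T.
exists (M + N); first by rewrite addr_ge0.
by move=> x; rewrite mulrDl (le_trans (ler_normD _ _))// lerD.
Qed.

Definition bop_D (S T : bop) : bop.
Proof.
apply: (@Bop (fun x => S x + T x) (fun x => bop_adj S x + bop_adj T x)) => [x y|].
  by rewrite ipDl ipDr !bop_adjP.
exact: bop_D_bounded.
Defined.

Definition bop_N (T : bop) : bop.
Proof.
apply: (@Bop (fun x => - T x) (fun x => - bop_adj T x)) => [x y|].
  by rewrite -sub0r ipBl bop_adjP ipNr ipC ip0r conjc0 sub0r.
have [M M0 TM] := bop_bounded T; exists M => // x; by rewrite normrN.
Defined.

Definition bop_Z (c : C) (T : bop) : bop.
Proof.
apply: (@Bop (fun x => c *: T x) (fun x => (conjc c : C) *: bop_adj T x)) => [x y|].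
  by rewrite ipZl ipZr bop_adjP.
have [M M0 TM] := bop_bounded T; exists (`|c| * M) => [|x]; first by rewrite mulr_ge0.
by rewrite normrZ -mulrA ler_wpM2l.
Defined.

Definition bop_zero : bop.
Proof.
apply: (@Bop (fun _ => 0) (fun _ => 0)) => [x y|]; first by rewrite ipC !ip0r conjc0.
by exists 0 => // x; rewrite normr0 mul0r.
Defined.

Definition bop_one : bop.
Proof. by apply: (@Bop id id) => //; exists 1 => // x; rewrite mul1r. Defined.

Definition bop_M (S T : bop) : bop.
Proof.
apply: (@Bop (S \o T) (bop_adj T \o bop_adj S)) => [x y|]; first by rewrite /= !bop_adjP.
have [M M0 SM] := bop_bounded S; have [N N0 TN] := bop_bounded T.
exists (M * N) => [|x]; first by rewrite mulr_ge0.
by apply: le_trans (SM _) _; rewrite -mulrA ler_wpM2l.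
Defined.

Definition bop_star (T : bop) : bop.
Proof.
apply: (@Bop (bop_adj T) T) => [x y|]; first by rewrite bop_adjP'.
have [M M0 TM] := bop_bounded T; exists M => //; exact: (adj_bounded M0 (@bop_adjP T)).
Defined.

HB.instance Definition _ := gen_eqMixin bop.
HB.instance Definition _ := gen_choiceMixin bop.

Lemma bop_addA : associative bop_D.
Proof. by move=> S T U; apply: bop_ext => x; exact: addrA. Qed.
Lemma bop_addC : commutative bop_D.
Proof. by move=> S T; apply: bop_ext => x; exact: addrC. Qed.
Lemma bop_add0 : left_id bop_zero bop_D.
Proof. by move=> S; apply: bop_ext => x; exact: add0r. Qed.
Lemma bop_addN : left_inverse bop_zero bop_N bop_D.
Proof. by move=> S; apply: bop_ext => x; exact: addNr. Qed.
HB.instance Definition _ := GRing.isZmodule.Build bop bop_addA bop_addC bop_add0 bop_addN.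

Lemma bop_scaleA a b T : bop_Z a (bop_Z b T) = bop_Z (a * b) T.
Proof. by apply: bop_ext => x; exact: scalerA. Qed.
Lemma bop_scale1 : left_id 1 bop_Z.
Proof. by move=> T; apply: bop_ext => x; exact: scale1r. Qed.
Lemma bop_scaleDr : right_distributive bop_Z +%R.
Proof. by move=> a S T; apply: bop_ext => x; exact: scalerDr. Qed.
Lemma bop_scaleDl T : {morph bop_Z^~ T : a b / a + b}.
Proof. by move=> a b; apply: bop_ext => x; exact: scalerDl. Qed.
HB.instance Definition _ := GRing.Zmodule_isLmodule.Build C bop
  bop_scaleA bop_scale1 bop_scaleDr bop_scaleDl.

Definition bop_norm (T : bop) : C :=
  (sup [set r | exists2 x : E, `|x| <= 1 & r = complex.Re `|T x|])%:C%C.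

Lemma bop_has_sup (T : bop) :
  has_sup [set r | exists2 x : E, `|x| <= 1 & r = complex.Re `|T x|].
Proof.
split; first by exists (complex.Re `|T 0|); exists 0 => //; rewrite normr0 ler01.
have [M M0 TM] := bop_bounded T; exists (complex.Re M) => _ [x x1 ->].
rewrite -cplx_le -!cplx_real//; apply: le_trans (TM x) _.
by rewrite -[leRHS]mulr1 ler_wpM2l.
Qed.

Lemma bop_norm_ge0 T : 0 <= bop_norm T.
Proof.
rewrite (cplx_le 0); apply: ub_le_sup; first by case: (bop_has_sup T).
by exists 0; rewrite ?normr0 ?ler01// bop0 normr0.
Qed.

Lemma le_bop_norm (T : bop) x : `|T x| <= bop_norm T * `|x|.
Proof.
have [->|x0] := eqVneq x 0; first by rewrite bop0 !normr0 mulr0.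
have nx : 0 < `|x| by rewrite normr_gt0.
rewrite -ler_pdivrMr//.
have -> : `|T x| / `|x| = `|T (`|x|^-1 *: x)|.
  by rewrite bopZ normrZ normfV normr_id mulrC.
rewrite (cplx_real (normr_ge0 _)) cplx_le.
apply: ub_le_sup; first by case: (bop_has_sup T).
exists (`|x|^-1 *: x) => //.
by rewrite normrZ normfV normr_id mulVf// gt_eqF.
Qed.

Lemma bop_norm_le (T : bop) (c : C) : 0 <= c -> (forall x, `|T x| <= c * `|x|) -> bop_norm T <= c.
Proof.
move=> c0 Tc; rewrite (cplx_real c0) cplx_le; apply: ge_sup; first by case: (bop_has_sup T).
move=> _ [x x1 ->]; rewrite -cplx_le -!cplx_real//.
by apply: le_trans (Tc x) _; rewrite -[leRHS]mulr1 ler_wpM2l.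
Qed.

Lemma bop_normD S T : bop_norm (S + T) <= bop_norm S + bop_norm T.
Proof.
apply: bop_norm_le => [|x]; first by rewrite addr_ge0 ?bop_norm_ge0.
rewrite mulrDl; apply: le_trans (ler_normD (S x) (T x)) _.
by rewrite lerD ?le_bop_norm.
Qed.

Lemma bop_normZ (c : C) T : bop_norm (c *: T) = `|c| * bop_norm T.
Proof.
have le c' U : bop_norm (c' *: U) <= `|c'| * bop_norm U.
  apply: bop_norm_le => [|x]; first by rewrite mulr_ge0 ?bop_norm_ge0.
  rewrite [X in X <= _](normrZ c' (U x)) -mulrA ler_wpM2l//; exact: le_bop_norm.
apply/eqP; rewrite eq_le le /=.
have [->|c0] := eqVneq c 0; first by rewrite normr0 mul0r bop_norm_ge0.
rewrite -ler_pdivlMl ?normr_gt0// -normfV.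
by rewrite -{1}[T](scalerK c0) le.
Qed.

Lemma bop_norm_eq0 T : bop_norm T = 0 -> T = 0.
Proof.
move=> T0; apply: bop_ext => x; apply/eqP.
by have := le_bop_norm T x; rewrite T0 mul0r normr_le0.
Qed.

HB.instance Definition _ := isPointed.Build bop 0.
HB.instance Definition _ :=
  Lmodule_isNormed.Build C bop bop_normD bop_normZ bop_norm_eq0.

Lemma bop_le (T : bop) x : `|T x| <= `|T| * `|x|.
Proof. exact: le_bop_norm. Qed.

Lemma bop_norm_adj (T : bop) : `|bop_star T| = `|T|.
Proof.
have le (S : bop) : `|bop_star S| <= `|S|.
  apply: bop_norm_le; first exact: bop_norm_ge0.
  exact: (adj_bounded (bop_norm_ge0 S) (@bop_adjP S) (le_bop_norm S)).
apply/eqP; rewrite eq_le le /=.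
by rewrite (_ : T = bop_star (bop_star T)) ?le//; apply: bop_ext.
Qed.

Lemma bop_complete (F : set_system bop) : ProperFilter F -> cauchy F -> cvg F.
Proof.
move=> FF Fc.
have Fe (e : C) : 0 < e -> exists2 A : set bop, F A &
    forall S T, A S -> A T -> `|S - T| < e.
  move=> e0; have e2 : 0 < e / 2 by rewrite divr_gt0.
  have /cauchyP /(_ _ e2)[h Fh] := Fc.
  exists (ball h (e / 2)) => // f g; rewrite -ball_normE /= => hf hg.
  by rewrite (@distm_lt_split _ _ h)// distrC.
(* Taking adjoints is isometric, so the adjoints are pointwise Cauchy as well; their limit is the
   adjoint that the limit operator must carry. *)
have Fx (e : C) x : 0 < e -> exists2 A : set bop, F A & forall S T, A S -> A T ->
    `|S x - T x| < e /\ `|bop_adj S x - bop_adj T x| < e.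
  move=> e0; have x1 : 0 < `|x| + 1 by rewrite ltr_wpDl.
  have [A FA Ae] := Fe (e / (`|x| + 1)) (divr_gt0 e0 x1); exists A => // S T AS AT.
  have h (c : C) : c <= `|S - T| * `|x| -> c < e.
    move=> hc; apply: le_lt_trans hc _; apply: (@le_lt_trans _ _ (`|S - T| * (`|x| + 1))).
      by rewrite ler_wpM2l// lerDl.
    by rewrite -ltr_pdivlMr// Ae.
  split; first exact/h/(bop_le (S - T) x).
  by apply/h; rewrite -(bop_norm_adj (S - T)); exact: (bop_le (bop_star (S - T)) x).
have cx x : cvg ((fun T : bop => T x) @ F).
  apply: cauchy_cvg; apply: cauchy_exP => e e0.
  have [A FA Ae] := Fx _ x e0; have [h Ah] := filter_ex FA.
  exists (h x); rewrite /nbhs/= /fmap/=; apply: filterS FA => y Ay /=.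
  by rewrite -ball_normE /=; case: (Ae _ _ Ah Ay).
have cax x : cvg ((fun T : bop => bop_adj T x) @ F).
  apply: cauchy_cvg; apply: cauchy_exP => e e0.
  have [A FA Ae] := Fx _ x e0; have [h Ah] := filter_ex FA.
  exists (bop_adj h x); rewrite /nbhs/= /fmap/=; apply: filterS FA => y Ay /=.
  by rewrite -ball_normE /=; case: (Ae _ _ Ah Ay).
pose l x : E := lim ((fun T : bop => T x) @ F).
pose la x : E := lim ((fun T : bop => bop_adj T x) @ F).
have near_l (e : C) x y : 0 < e -> exists T : bop, `|l x - T x| < e /\ `|la y - bop_adj T y| < e.
  move=> e0; have /cvgrPdist_lt/(_ _ e0) h1 := cx x; have /cvgrPdist_lt/(_ _ e0) h2 := cax y.
  by have [T [hT hT']] := filter_ex (filterI h1 h2); exists T.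
have ladj x y : ip (l x) y = ip x (la y).
  apply/eqP; rewrite -subr_eq0 -normr_le0; apply/ler_addgt0Pr => e e0; rewrite add0r.
  have d0 : 0 < `|x| + `|y| + 1 by rewrite ltr_wpDl// addr_ge0.
  have [T [h1 h2]] := near_l (e / (`|x| + `|y| + 1)) x y (divr_gt0 e0 d0).
  have -> : ip (l x) y - ip x (la y) = ip (l x - T x) y - ip x (la y - bop_adj T y).
    by rewrite ipBl ipBr bop_adjP opprB addrA subrK.
  apply: le_trans (ler_normB _ _) _.
  apply: le_trans (lerD (cauchy_schwarz _ _) (cauchy_schwarz _ _)) _.
  apply: (@le_trans _ _ (e / (`|x| + `|y| + 1) * (`|x| + `|y| + 1))); last first.
    by rewrite divfK// gt_eqF.
  rewrite !mulrDr mulr1 -[leLHS]addr0 lerD//; last by rewrite divr_ge0// ltW.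
  rewrite addrC; apply: lerD; first by rewrite mulrC ler_wpM2r// ltW.
  by rewrite ler_wpM2r// ltW.
have Al (e : C) A : 0 < e -> F A -> (forall S T, A S -> A T -> `|S - T| < e) ->
    forall T, A T -> forall x, `|T x - l x| <= e * `|x|.
  move=> e0 FA Ae T AT x; apply/ler_addgt0Pr => d d0.
  have /cvgrPdist_lt/(_ _ d0) h1 := cx x.
  have [S [AS hS]] := filter_ex (filterI FA h1).
  rewrite -(subrKA (S x)); apply: le_trans (ler_normD _ _) _.
  rewrite [X in _ + X <= _]distrC; apply: lerD; last exact: ltW.
  apply: le_trans (bop_le (T - S) x) _.
  by rewrite ler_wpM2r// ltW// Ae.
have [A FA Ae] := Fe 1 ltr01; have [h Ah] := filter_ex FA.
have lb : exists2 M : C, 0 <= M & forall x, `|l x| <= M * `|x|.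
  exists (`|h| + 1) => [|x]; first by rewrite addr_ge0.
  rewrite -[l x](subrK (h x)) mulrDl addrC; apply: le_trans (ler_normD _ _) _.
  apply: lerD; first exact: bop_le.
  rewrite distrC; exact: Al ltr01 FA Ae _ Ah x.
apply/cvg_ex; exists (Bop ladj lb).
apply/(@fcvgrPdist_lt C bop F) => e e0.
have e2 : 0 < e / 2 by rewrite divr_gt0.
have [A' FA' Ae'] := Fe _ e2; apply: (filterS _ FA') => T AT.
apply: (@le_lt_trans _ _ (e / 2)); last by rewrite ltr_pdivrMr// ltr_pMr// ltr1n.
rewrite distrC; apply: bop_norm_le; first exact: ltW.
move=> x; exact: Al e2 FA' Ae' _ AT x.
Qed.

HB.instance Definition _ := Uniform_isComplete.Build bop bop_complete.

Lemma bop_normM (S T : bop) : `|bop_M S T| <= `|S| * `|T|.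
Proof.
apply: bop_norm_le => [|x]; first by rewrite mulr_ge0.
by apply: le_trans (bop_le S (T x)) _; rewrite -mulrA ler_wpM2l// bop_le.
Qed.

Lemma bop_normC (T : bop) : `|bop_M (bop_star T) T| = `|T| ^+ 2.
Proof.
apply/eqP; rewrite eq_le; apply/andP; split.
  by apply: le_trans (bop_normM _ _) _; rewrite bop_norm_adj expr2.
set N := (X in _ <= X); have N0 : 0 <= N by rewrite normr_ge0.
rewrite -[leRHS](sqrtCK) ler_pXn2r ?nnegrE ?sqrtC_ge0//.
apply: bop_norm_le => [|x]; first by rewrite sqrtC_ge0.
have h : `|T x| ^+ 2 <= N * `|x| ^+ 2.
  rewrite [leLHS]sqr_norm_ip bop_adjP.
  apply: (@le_trans _ _ `|ip x (bop_adj T (T x))|).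
    by rewrite ger0_norm// -bop_adjP ip_ge0.
  apply: le_trans (cauchy_schwarz _ _) _; rewrite [leRHS](_ : _ = `|x| * (N * `|x|)).
    apply: ler_wpM2l => //.
    exact: (bop_le (bop_M (bop_star T) T) x).
  by rewrite expr2 mulrCA.
have sN0 : 0 <= sqrtC N by rewrite sqrtC_ge0.
by move: h; rewrite -{1}(sqrtCK N) -exprMn ler_pXn2r// ?nnegrE ?mulr_ge0.
Qed.

Lemma ell2_e_subproof (m : nat) : exists M : C, forall n, \sum_(k < n) `|(k == m :> nat)%:R : C| ^+ 2 <= M.
Proof.
exists 1 => n; have [nm|mn] := leqP n m.
  rewrite big1 ?ler01// => k _; rewrite ltn_eqF ?normr0 ?expr0n//.
  exact: leq_trans (ltn_ord k) nm.
rewrite (bigD1 (Ordinal mn))//= eqxx normr1 expr1n big1 ?addr0// => k km.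
by rewrite [_ == m](negbTE km) normr0 expr0n.
Qed.

Definition ell2_e (m : nat) : E := @Ell2 R (fun k => (k == m)%:R) (ell2_e_subproof m).

Lemma bop_one_neq0 : bop_one != 0 :> bop.
Proof.
apply/eqP => /(congr1 (fun T : bop => T (ell2_e 0) 0%N)) /=.
by move/eqP; rewrite oner_eq0.
Qed.

Definition bop_cstar : cstarAlg R.
Proof.
apply: (@CStarAlg R bop bop_one bop_M bop_star) => //.
all: try by move=> *; apply: bop_ext.
- by move=> S T U; apply: bop_ext => x /=; exact: bopD.
- by move=> c S T; apply: bop_ext => x /=; rewrite bopZ.
- exact: bop_one_neq0.
- exact: bop_normM.
- exact: bop_normC.
Defined.

End BoundedOperators.

Section LinearSpan.
Variables (R : realType) (A : cstarAlg R) (S : set A).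
Local Notation C := (cplx R).

Lemma lin_span_mem x : S x -> lin_span S x.
Proof. by move=> Sx; exists 1%N, (fun=> 1), (fun=> x); split=> //; rewrite big_ord1 scale1r. Qed.

Lemma lin_span0 : lin_span S 0.
Proof. by exists 0%N, (fun=> 0), (fun=> 0); split=> [[]|] //; rewrite big_ord0. Qed.

Lemma lin_spanD x y : lin_span S x -> lin_span S y -> lin_span S (x + y).
Proof.
move=> [n [k [v [Sv ->]]]] [m [l [w [Sw ->]]]].
exists (n + m)%N, (fun i : 'I_(n + m) => match fintype.split i with inl a => k a | inr b => l b end),
  (fun i : 'I_(n + m) => match fintype.split i with inl a => v a | inr b => w b end); split.
  by move=> i; case: (fintype.split i).
rewrite big_split_ord /=; congr (_ + _); apply: eq_bigr => i _.
  by rewrite (unsplitK (inl i)).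
by rewrite (unsplitK (inr i)).
Qed.

Lemma lin_spanZ (c : C) x : lin_span S x -> lin_span S (c *: x).
Proof.
move=> [n [k [v [Sv ->]]]]; exists n, (fun i => c * k i), v; split=> //.
by rewrite scaler_sumr; apply: eq_bigr => i _; rewrite scalerA.
Qed.

Lemma lin_span_sum I (r : seq I) (P : pred I) (F : I -> A) :
  (forall i, P i -> lin_span S (F i)) -> lin_span S (\sum_(i <- r | P i) F i).
Proof.
move=> h; elim/big_rec: _ => [|i x Pi]; first exact: lin_span0.
by apply: lin_spanD; exact: h.
Qed.

Lemma closure_lin_spanD x y :
  closure (lin_span S) x -> closure (lin_span S) y -> closure (lin_span S) (x + y).
Proof.
move=> /closureP_norm cx /closureP_norm cy; apply/closureP_norm => e e0.
have e2 : 0 < e / 2 by rewrite divr_gt0.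
have [x' x'S xx'] := cx _ e2; have [y' y'S yy'] := cy _ e2.
exists (x' + y'); first exact: lin_spanD.
by rewrite opprD addrACA [ltRHS]splitr; apply: le_lt_trans (ler_normD _ _) _; exact: ltrD.
Qed.

Hypothesis SM : forall x y, S x -> S y -> lin_span S (x * y).
Hypothesis Sstar : forall x, S x -> S (star x).

Lemma lin_spanM x y : lin_span S x -> lin_span S y -> lin_span S (x * y).
Proof.
move=> [n [k [v [Sv ->]]]] [m [l [w [Sw ->]]]].
rewrite mulr_suml; apply: lin_span_sum => i _; rewrite mulr_sumr; apply: lin_span_sum => j _.
by rewrite -scalerAl -scalerAr; do 2!apply: lin_spanZ; exact: SM.
Qed.

Lemma lin_span_star x : lin_span S x -> lin_span S (star x).
Proof.
move=> [n [k [v [Sv ->]]]]; rewrite star_sum; apply: lin_span_sum => i _.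
by rewrite starZ; apply: lin_spanZ; apply: lin_span_mem; exact: Sstar.
Qed.

End LinearSpan.

(** * Closed *-subalgebras *)

Section Subalgebra.
Variables (R : realType) (A : cstarAlg R).
Local Notation C := (cplx R).

Record star_subalg := StarSubalg {
  ss_set : set A;
  ss1 : ss_set 1;
  ssD : forall x y, ss_set x -> ss_set y -> ss_set (x + y);
  ssZ : forall (c : C) x, ss_set x -> ss_set (c *: x);
  ssM : forall x y, ss_set x -> ss_set y -> ss_set (x * y);
  ss_star : forall x, ss_set x -> ss_set (star x);
  ss_closed : forall x, closure ss_set x -> ss_set x }.

Section Closure.
Variable S : set A.
Hypothesis S1 : S 1.
Hypothesis SM : forall x y, S x -> S y -> lin_span S (x * y).
Hypothesis Sstar : forall x, S x -> S (star x).

Definition closed_span : star_subalg.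
Proof.
apply: (@StarSubalg (closure (lin_span S))).
- by apply: subset_closure; exact: lin_span_mem.
- by move=> x y; exact: closure_lin_spanD.
- move=> c x /closureP_norm cx; apply/closureP_norm => e e0.
  have c1 : 0 < `|c| + 1 by rewrite ltr_wpDl.
  have [x' x'S xx'] := cx _ (divr_gt0 e0 c1).
  exists (c *: x'); first exact: lin_spanZ.
  rewrite -scalerBr normrZ; apply: (@le_lt_trans _ _ ((`|c| + 1) * `|x - x'|)).
    by rewrite ler_wpM2r// lerDl.
  by rewrite mulrC -ltr_pdivlMr.
- move=> x y /closureP_norm cx /closureP_norm cy; apply/closureP_norm => e e0.
  have e2 : 0 < e / 2 by rewrite divr_gt0.
  have x1 : 0 < `|x| + 1 by rewrite ltr_wpDl.
  have [y' y'S yy'] := cy _ (divr_gt0 e2 x1).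
  have y1 : 0 < `|y'| + 1 by rewrite ltr_wpDl.
  have [x' x'S xx'] := cx _ (divr_gt0 e2 y1).
  exists (x' * y'); first exact: lin_spanM.
  rewrite (_ : x * y - x' * y' = x * (y - y') + (x - x') * y'); last first.
    by rewrite mulrBr mulrBl addrA subrK.
  apply: le_lt_trans (ler_normD _ _) _; rewrite [ltRHS]splitr; apply: ltrD.
    apply: le_lt_trans (cs_normrM _ _) _.
    apply: (@le_lt_trans _ _ ((`|x| + 1) * `|y - y'|)); first by rewrite ler_wpM2r// lerDl.
    by rewrite mulrC -ltr_pdivlMr.
  apply: le_lt_trans (cs_normrM _ _) _.
  apply: (@le_lt_trans _ _ (`|x - x'| * (`|y'| + 1))); first by rewrite ler_wpM2l// lerDl.
  by rewrite -ltr_pdivlMr.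
- move=> x /closureP_norm cx; apply/closureP_norm => e e0.
  have [x' x'S xx'] := cx _ e0; exists (star x'); first exact: lin_span_star.
  by rewrite -starB cs_norm_star.
- by move=> x; apply: (@closed_closure A).
Defined.

End Closure.

Variable P : star_subalg.

Record csub := CSub { csub_val :> A; csubP : ss_set P csub_val }.

Lemma csub_ext (x y : csub) : (x : A) = y -> x = y.
Proof. by case: x y => [x px] [y py] /= xy; subst y; congr CSub; exact: Prop_irrelevance. Qed.

HB.instance Definition _ := gen_eqMixin csub.
HB.instance Definition _ := gen_choiceMixin csub.

Lemma ss0 : ss_set P 0.
Proof. by rewrite -(scale0r 1); apply: ssZ; exact: ss1. Qed.

Definition csub_0 := CSub ss0.
Definition csub_1 := CSub (ss1 P).
Definition csub_D (x y : csub) := CSub (ssD (csubP x) (csubP y)).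
Definition csub_M (x y : csub) := CSub (ssM (csubP x) (csubP y)).
Definition csub_Z (c : C) (x : csub) := CSub (ssZ c (csubP x)).
Definition csub_N (x : csub) := csub_Z (-1) x.
Definition csub_star (x : csub) := CSub (ss_star (csubP x)).

Lemma csub_addA : associative csub_D.
Proof. by move=> x y z; apply: csub_ext; exact: addrA. Qed.
Lemma csub_addC : commutative csub_D.
Proof. by move=> x y; apply: csub_ext; exact: addrC. Qed.
Lemma csub_add0 : left_id csub_0 csub_D.
Proof. by move=> x; apply: csub_ext; exact: add0r. Qed.
Lemma csub_addN : left_inverse csub_0 csub_N csub_D.
Proof. by move=> x; apply: csub_ext; rewrite /= scaleN1r addNr. Qed.
HB.instance Definition _ := GRing.isZmodule.Build csub csub_addA csub_addC csub_add0 csub_addN.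

Lemma csub_scaleA a b x : csub_Z a (csub_Z b x) = csub_Z (a * b) x.
Proof. by apply: csub_ext; exact: scalerA. Qed.
Lemma csub_scale1 : left_id 1 csub_Z.
Proof. by move=> x; apply: csub_ext; exact: scale1r. Qed.
Lemma csub_scaleDr : right_distributive csub_Z +%R.
Proof. by move=> a x y; apply: csub_ext; exact: scalerDr. Qed.
Lemma csub_scaleDl x : {morph csub_Z^~ x : a b / a + b}.
Proof. by move=> a b; apply: csub_ext; exact: scalerDl. Qed.
HB.instance Definition _ := GRing.Zmodule_isLmodule.Build C csub
  csub_scaleA csub_scale1 csub_scaleDr csub_scaleDl.

Definition csub_norm (x : csub) : C := `|csub_val x|.

Lemma csub_normD x y : csub_norm (x + y) <= csub_norm x + csub_norm y.
Proof. exact: (ler_normD (csub_val x) (csub_val y)). Qed.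
Lemma csub_normZ (c : C) x : csub_norm (c *: x) = `|c| * csub_norm x.
Proof. exact: (normrZ c (csub_val x)). Qed.
Lemma csub_norm_eq0 x : csub_norm x = 0 -> x = 0.
Proof. by move=> /normr0_eq0 x0; apply: csub_ext. Qed.

HB.instance Definition _ := isPointed.Build csub 0.
HB.instance Definition _ :=
  Lmodule_isNormed.Build C csub csub_normD csub_normZ csub_norm_eq0.

Lemma csub_valB (x y : csub) : csub_val (x - y) = csub_val x - csub_val y.
Proof. by rewrite /= scaleN1r. Qed.

Lemma csub_distE (x y : csub) : `|x - y| = `|csub_val x - csub_val y|.
Proof. by rewrite -csub_valB. Qed.

Lemma csub_complete (F : set_system csub) : ProperFilter F -> cauchy F -> cvg F.
Proof.
move=> FF Fc.
have cv : cvg (csub_val @ F).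
  apply: cauchy_cvg; apply: cauchy_exP => e e0.
  have /cauchyP /(_ _ e0)[h Fh] := Fc; exists (csub_val h).
  rewrite /nbhs/= /fmap/=; apply: filterS Fh => y /=.
  by rewrite -!ball_normE /= csub_distE.
set l := lim (csub_val @ F) in cv.
have Pl : ss_set P l.
  apply: ss_closed; apply/closureP_norm => e e0.
  have /cvgrPdist_lt/(_ _ e0) h := cv; have [x hx] := filter_ex h.
  by exists (csub_val x) => //; exact: csubP.
apply/cvg_ex; exists (CSub Pl).
apply/(@fcvgrPdist_lt C csub F) => e e0.
have /cvgrPdist_lt/(_ _ e0) h := cv.
by apply: filterS h => x hx; rewrite csub_distE.
Qed.

HB.instance Definition _ := Uniform_isComplete.Build csub csub_complete.

Definition csub_cstar : cstarAlg R.
Proof.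
apply: (@CStarAlg R csub csub_1 csub_M csub_star).
- by move=> x y z; apply: csub_ext; exact: mulrA.
- by move=> x; apply: csub_ext; exact: mul1r.
- by move=> x; apply: csub_ext; exact: mulr1.
- by move=> x y z; apply: csub_ext; exact: mulrDl.
- by move=> x y z; apply: csub_ext; exact: mulrDr.
- by move=> c x y; apply: csub_ext; exact: scalerAl.
- by move=> c x y; apply: csub_ext; exact: scalerAr.
- by apply/eqP => /(congr1 csub_val) /eqP; rewrite oner_eq0.
- by move=> x; apply: csub_ext; exact: starK.
- by move=> x y; apply: csub_ext; exact: starD.
- by move=> c x; apply: csub_ext; exact: starZ.
- by move=> x y; apply: csub_ext; exact: starM.
- by move=> x y; exact: cs_normrM.
- by move=> x; exact: normC.
Defined.

End Subalgebra.

(** * The Cuntz algebra O_2 *)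

Section Basis.
Variable R : realType.
Local Notation C := (cplx R).
Local Notation E := (ell2 R).
Local Notation ell2_e := (@ell2_e R).

Lemma ip_e m (y : E) : ip (ell2_e m) y = y m.
Proof.
apply: (cplx_cvg_unique (@ip_cvg R (ell2_e m) y)).
apply: cvg_near_cst; exists m.+1 => // n /= mn.
rewrite /ip_seq (bigD1 (Ordinal mn))//= eqxx conjc1 mul1r big1 ?addr0// => k km.
by rewrite /= [_ == m](negbTE km) conjc0 mul0r.
Qed.

Lemma sum_ell2E n (F : 'I_n -> E) k : (\sum_(i < n) F i) k = \sum_(i < n) F i k.
Proof. exact: (big_morph (fun x : E => x k) (id1 := 0) (op1 := +%R)). Qed.

Lemma ell2_trunc (x : E) (e : C) : 0 < e ->
  exists n, `|x - \sum_(k < n) x k *: ell2_e k| < e.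
Proof.
move=> e0; have e2 : 0 < e / 2 by rewrite divr_gt0.
have /cvgrPdist_lt/(_ _ (exprn_gt0 2 e2)) [n _ /(_ n (leqnn n))] := @ip_cvg R x x.
move=> hn; exists n; apply: (@le_lt_trans _ _ (e / 2)); last first.
  by rewrite ltr_pdivrMr// ltr_pMr// ltr1n.
rewrite -(@ler_pXn2r _ 2)// ?nnegrE ?(ltW e2)// sqr_norm_ip.
apply: le_trans (ltW hn); apply: ip_le => N.
have seqE m : ip_seq x x m = \sum_(k < m) `|x k| ^+ 2.
  by apply: eq_bigr => k _; rewrite sqr_normc mulrC.
have coordE k : (x - \sum_(k < n) x k *: ell2_e k) k = if (k < n)%N then 0 else x k.
  rewrite -[LHS]/(x k - (\sum_(k < n) x k *: ell2_e k) k) sum_ell2E.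
  case: ifPn => kn.
    rewrite (bigD1 (Ordinal kn))//= big1 ?addr0; first by rewrite /= eqxx mulr1 subrr.
    by move=> i ik; rewrite /= eq_sym [_ == k](negbTE ik) mulr0.
  rewrite big1 ?subr0// => i _; rewrite /=.
  by rewrite gtn_eqF ?mulr0// (leq_trans (ltn_ord i))// leqNgt.
rewrite (eq_bigr (fun k : 'I_N => if (k < n)%N then 0 else `|x k| ^+ 2)); last first.
  by move=> k _; rewrite coordE; case: ifP; rewrite ?normr0 ?expr0n.
rewrite seqE ger0_norm ?subr_ge0 ?partial_le_ip//.
have [Nn|nN] := leqP N n.
  rewrite big1 ?subr_ge0 ?partial_le_ip// => k _.
  by rewrite (leq_trans (ltn_ord k) Nn).
rewrite lerBrDr; apply: le_trans (partial_le_ip x N).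
rewrite -(subnKC (ltnW nN)) !big_split_ord /=.
rewrite big1 ?add0r; last by move=> k _; rewrite ltn_ord.
rewrite [leLHS]addrC lerD2l; apply: ler_sum => k _.
by rewrite ltnNge leq_addr.
Qed.

Section PartialInjection.
Variables t t' : nat -> option nat.
Hypothesis tt' : forall n m, t n = Some m <-> t' m = Some n.

Lemma sum_uniq_le (F : nat -> C) (s : seq nat) (N : nat) : (forall k, 0 <= F k) -> uniq s ->
  (forall k, k \in s -> (k < N)%N) -> \sum_(k <- s) F k <= \sum_(k < N) F k.
Proof.
move=> F0 us sN; have ps : perm_eq s [seq k <- iota 0 N | k \in s].
  apply: uniq_perm => //; first by rewrite filter_uniq// iota_uniq.
  move=> k; rewrite mem_filter mem_iota /= add0n.
  by case: (boolP (k \in s)) => // /sN ->.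
rewrite (perm_big _ ps) /= big_filter -[X in _ <= X](big_mkord xpredT F) /index_iota subn0.
rewrite [leLHS]big_mkcond; apply: ler_sum => k _; by case: ifP.
Qed.

Lemma pinj_bound (x : E) n : \sum_(k < n) `|oapp x 0 (t k)| ^+ 2 <= ip x x.
Proof.
have -> : \sum_(k < n) `|oapp x 0 (t k)| ^+ 2 = \sum_(m <- pmap t (iota 0 n)) `|x m| ^+ 2.
  rewrite -(big_mkord xpredT (fun k => `|oapp x 0 (t k)| ^+ 2)) /index_iota subn0.
  elim: (iota 0 n) => [|k s IH]; first by rewrite !big_nil.
  rewrite big_cons /=; case: (t k) => [m|] /=; first by rewrite big_cons IH.
  by rewrite normr0 expr0n add0r.
pose N := (\max_(m <- pmap t (iota 0 n)) m).+1.
apply: le_trans (partial_le_ip x N); apply: (@sum_uniq_le (fun m => `|x m| ^+ 2)) => [k||k ks].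
- by rewrite exprn_ge0.
- apply: (@pmap_uniq _ _ t (fun m => odflt 0%N (t' m))); last exact: iota_uniq.
  by move=> k; case tk : (t k) => [m|] //=; move/tt' : tk => ->.
- by rewrite ltnS; apply: (@leq_bigmax_seq _ (pmap t (iota 0 n)) xpredT id).
Qed.

(** Coordinates are pulled back along [t], so on basis vectors the operator acts by [t']: it sends
    [e_m] to [e_(t' m)], or to [0] where [t'] is undefined. *)
Definition pinj (x : E) : E :=
  @Ell2 R (fun k => oapp x 0 (t k)) (ex_intro _ _ (@pinj_bound x)).

Lemma pinj_norm x : `|pinj x| <= `|x|.
Proof.
rewrite -(@ler_pXn2r _ 2)// ?nnegrE// !sqr_norm_ip.
by apply: ip_le => n; exact: pinj_bound.
Qed.

Lemma pinjD x y : pinj (x + y) = pinj x + pinj y.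
Proof. by apply: ell2_ext => k /=; case: (t k) => //=; rewrite addr0. Qed.

Lemma pinjZ c x : pinj (c *: x) = c *: pinj x.
Proof. by apply: ell2_ext => k /=; case: (t k) => //=; rewrite mulr0. Qed.

End PartialInjection.

(** The defect [h] is conjugate-linear, vanishes on basis vectors and is bounded by [2 * |x| * |y|];
    by [ell2_trunc] it vanishes on every [x]. *)
Lemma pinj_adj t t' (tt' : forall n m, t n = Some m <-> t' m = Some n)
  (t't : forall n m, t' n = Some m <-> t m = Some n) x y :
  ip (pinj tt' x) y = ip x (pinj t't y).
Proof.
apply/eqP; rewrite -subr_eq0 -normr_le0; apply/ler_addgt0Pr => e e0; rewrite add0r.
pose h x := ip (pinj tt' x) y - ip x (pinj t't y).
have hD a b : h (a + b) = h a + h b.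
  rewrite /h pinjD !ipDl; ring.
have hZ c a : h (c *: a) = conjc c * h a.
  by rewrite /h pinjZ !ipZl mulrBr.
have h0 : h 0 = 0 by rewrite -(scale0r (0 : E)) hZ conjc0 mul0r.
have he m : h (ell2_e m) = 0.
  rewrite /h ip_e; case E' : (t' m) => [n|].
    have -> : pinj tt' (ell2_e m) = ell2_e n.
      apply: ell2_ext => k /=; case tk : (t k) => [m'|] /=.
        congr ((nat_of_bool _)%:R); apply/eqP/eqP => [mm|kn].
          by move: tk; rewrite mm => /tt'; rewrite E' => -[].
        by move: E'; rewrite -kn => /tt'; rewrite tk => -[].
      by case: (k =P n) => // kn; move/tt': E'; rewrite -kn tk.
    by rewrite ip_e /= E' /= subrr.
  have -> : pinj tt' (ell2_e m) = 0.
    apply: ell2_ext => k /=; case tk : (t k) => [m'|] //=.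
    by case: (m' =P m) => // mm; move/tt' : tk; rewrite mm E'.
  by rewrite ipC ip0r conjc0 /= E' subrr.
have hb a : `|h a| <= 2 * (`|a| * `|y|).
  apply: le_trans (ler_normB _ _) _; rewrite mulr_natl mulr2n; apply: lerD.
    by apply: le_trans (cauchy_schwarz _ _) _; rewrite ler_wpM2r// pinj_norm.
  by apply: le_trans (cauchy_schwarz _ _) _; rewrite ler_wpM2l// pinj_norm.
have d0 : 0 < 2 * (`|y| + 1) by rewrite mulr_gt0// ltr_wpDl.
have [n xn] := ell2_trunc x (divr_gt0 e0 d0).
set z := \sum_(k < n) x k *: ell2_e k in xn.
have hz : h z = 0.
  rewrite /z (big_morph h hD h0) big1// => k _.
  by rewrite hZ he mulr0.
rewrite -/(h x) -(subrK z x) hD hz addr0.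
apply: le_trans (hb _) _.
apply: (@le_trans _ _ (`|x - z| * (2 * (`|y| + 1)))).
  rewrite mulrCA ler_wpM2l// ler_wpM2l// lerDl//.
by rewrite -ler_pdivlMr// ltW.
Qed.

Definition pinj_op t t' (tt' : forall n m, t n = Some m <-> t' m = Some n)
  (t't : forall n m, t' n = Some m <-> t m = Some n) : bop R :=
  Bop (pinj_adj tt' t't)
    (ex_intro2 (fun M : C => 0 <= M) (fun M : C => forall x, `|pinj tt' x| <= M * `|x|) (1 : C) ler01 (fun x => eq_ind_r (fun b => `|pinj tt' x| <= b) (pinj_norm tt' x) (mul1r _))).

End Basis.

(** * Words in two isometries with orthogonal ranges *)

Section CuntzWords.
Variables (R : realType) (A : cstarAlg R) (s : bool -> A).
Local Notation C := (cplx R).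

Fixpoint sw (w : seq bool) : A := if w is i :: w' then s i * sw w' else 1.

Lemma sw_cat v w : sw (v ++ w) = sw v * sw w.
Proof. by elim: v => [|i v IH] /=; rewrite ?mul1r// IH mulrA. Qed.

Hypothesis ss : forall i j, star (s i) * s j = (i == j)%:R.

Lemma sw_iso w : star (sw w) * sw w = 1.
Proof.
elim: w => [|i w IH] /=; first by rewrite star1 mulr1.
by rewrite starM mulrA -(mulrA _ (star (s i))) ss eqxx mulr1.
Qed.

Lemma sw_inner v w : [\/ exists u, star (sw v) * sw w = sw u,
  exists u, star (sw v) * sw w = star (sw u) | star (sw v) * sw w = 0].
Proof.
elim: v w => [|i v IH] [|j w] /=.
- by constructor 1; exists [::]; rewrite star1 mulr1.
- by constructor 1; exists (j :: w); rewrite star1 mul1r.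
- by constructor 2; exists (i :: v); rewrite mulr1.
rewrite starM mulrA -(mulrA _ (star (s i))) ss.
have [_|_] := eqVneq i j; last by constructor 3; rewrite mulr0 mul0r.
by rewrite mulr1; exact: IH.
Qed.

Definition monomials : set A := [set x | exists v w, x = sw v * star (sw w)].

Lemma monomials1 : monomials 1.
Proof. by exists [::], [::]; rewrite /= star1 mulr1. Qed.

Lemma monomials_gen i : monomials (s i).
Proof. by exists [:: i], [::]; rewrite /= star1 !mulr1. Qed.

Lemma monomialsM x y : monomials x -> monomials y -> lin_span monomials (x * y).
Proof.
move=> [a [b ->]] [c [d ->]].
rewrite -mulrA (mulrA (star (sw b))).
have [[u ->]|[u ->]|->] := sw_inner b c.
- by apply: lin_span_mem; exists (a ++ u), d; rewrite sw_cat mulrA.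
- by apply: lin_span_mem; exists a, (d ++ u); rewrite sw_cat starM.
- by rewrite mul0r mulr0; exact: lin_span0.
Qed.

Lemma monomials_star x : monomials x -> monomials (star x).
Proof. by move=> [v [w ->]]; exists w, v; rewrite starM starK. Qed.

End CuntzWords.

Section Representation.
Variable R : realType.
Local Notation C := (cplx R).
Local Notation E := (ell2 R).

Definition branch (i : bool) (k : nat) : option nat := if odd k == i then Some k./2 else None.
Definition cobranch (i : bool) (m : nat) : option nat := Some (i + m.*2)%N.

Lemma branchP i n m : branch i n = Some m <-> cobranch i m = Some n.
Proof.
rewrite /branch /cobranch; split; first by case: eqP => // <- [<-]; rewrite odd_double_half.
by move=> [<-]; rewrite oddD odd_double addbF oddb eqxx half_bit_double.
Qed.

Definition isom (i : bool) : bop_cstar R :=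
  pinj_op R (branchP i) (fun n m => iff_sym (branchP i m n)).

Lemma isomE i (x : E) k : (isom i : bop R) x k = if odd k == i then x k./2 else 0.
Proof. by rewrite /= /branch; case: eqP. Qed.

Lemma isom_e i m : (isom i : bop R) (ell2_e R m) = ell2_e R (i + m.*2).
Proof.
apply: ell2_ext => k; rewrite isomE /=.
case: eqP => [<-|ki]; last first.
  by case: eqP => // km; case: ki; rewrite km oddD odd_double addbF oddb.
congr ((nat_of_bool _)%:R); apply/eqP/eqP => [<-|->]; first by rewrite odd_double_half.
exact: half_bit_double.
Qed.

Lemma isom_star i (x : E) m : (star (isom i) : bop R) x m = x (i + m.*2)%N.
Proof. by []. Qed.

Lemma isom_inner i j : star (isom i) * isom j = (i == j)%:R.
Proof.
apply: bop_ext => x; apply: ell2_ext => m.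
rewrite -[LHS]/((isom j : bop R) x (i + m.*2)%N) isomE oddD odd_double addbF oddb half_bit_double.
by case: eqP.
Qed.

Lemma isom_sum : isom false * star (isom false) + isom true * star (isom true) = 1.
Proof.
apply: bop_ext => x; apply: ell2_ext => k.
rewrite -[LHS]/((isom false : bop R) ((star (isom false) : bop R) x) k +
   (isom true : bop R) ((star (isom true) : bop R) x) k) !isomE !isom_star.
rewrite -[RHS]/(x k) -[in RHS](odd_double_half k).
by case: (odd k); rewrite /= ?addr0 ?add0r.
Qed.

Definition cuntz : cstarAlg R := csub_cstar
  (closed_span (monomials1 isom) (monomialsM isom_inner) (@monomials_star _ _ isom)).

Lemma cuntz_mem x : monomials isom x -> closure (lin_span (monomials isom)) x.
Proof. by move=> mx; apply: subset_closure; exact: lin_span_mem. Qed.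

Definition cgen (i : bool) : cuntz := CSub
  (P := closed_span (monomials1 isom) (monomialsM isom_inner) (@monomials_star _ _ isom))
  (cuntz_mem (monomials_gen isom i)).

Lemma cgen_inner i j : star (cgen i) * cgen j = (i == j)%:R.
Proof.
apply: csub_ext; rewrite -[LHS]/(star (isom i) * isom j) isom_inner.
by case: (i == j).
Qed.

Lemma cgen_sum : cgen false * star (cgen false) + cgen true * star (cgen true) = 1.
Proof. by apply: csub_ext; exact: isom_sum. Qed.

Lemma cgen_sw w : csub_val (sw cgen w) = sw isom w.
Proof. by elim: w => [|i w IH] //=; rewrite -IH. Qed.

Lemma cuntz_dense : dense (lin_span (monomials cgen)).
Proof.
apply/denseP_norm => x e e0.
have /closureP_norm/(_ _ e0)[y [n [k [v [vS ->]]]] xy] := csubP x.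
have /choice[v' vv'] : forall i : 'I_n, exists v' : cuntz, monomials cgen v' /\ csub_val v' = v i.
  move=> i; have [a [b ->]] := vS i; exists (sw cgen a * star (sw cgen b)); split; first by exists a, b.
  by rewrite -!cgen_sw.
exists (\sum_(i < n) k i *: v' i); first by exists n, k, v'; split=> // i; case: (vv' i).
rewrite csub_distE; apply: le_lt_trans xy; rewrite le_eqVlt; apply/orP; left; apply/eqP.
congr (`|_ - _|); rewrite (big_morph (@csub_val R _ _) (id1 := 0) (op1 := +%R))//.
by apply: eq_bigr => i _; rewrite -(vv' i).2.
Qed.

Definition vector_state (xi : E) (x : cuntz) : C := ip xi ((csub_val x : bop R) xi).

Lemma vector_state_star xi (x y : cuntz) :
  vector_state xi (star x * y) = ip ((csub_val x : bop R) xi) ((csub_val y : bop R) xi).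
Proof. by rewrite [RHS]bop_adjP. Qed.

Lemma state_vector xi : `|xi| = 1 -> state (vector_state xi).
Proof.
move=> xi1; split.
- by move=> k x y; rewrite /vector_state -ipZr -ipDr.
- by move=> x; rewrite vector_state_star ip_ge0.
- by rewrite -[LHS]/(ip xi xi) -sqr_norm_ip xi1 expr1n.
Qed.

(** The norm is that of operators on l2, so the vector states of unit vectors detect it. *)
Lemma enough_states_cuntz : enough_states cuntz.
Proof.
move=> a c c0 h; apply: bop_norm_le => // xi.
have [->|x0] := eqVneq xi 0; first by rewrite bop0 !normr0 mulr0.
have nx : `|xi| != 0 by rewrite normr_eq0.
pose u := `|xi|^-1 *: xi.
have u1 : `|u| = 1 by rewrite normrZ normfV normr_id mulVf.
have := h _ (state_vector u1) 1.
rewrite star1 mul1r mulr1 mul1r vector_state_star -sqr_norm_ip.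
rewrite [vector_state _ 1](_ : _ = 1); last by case: (state_vector u1).
rewrite mulr1 ler_pXn2r// ?nnegrE// /u bopZ normrZ normfV normr_id.
by rewrite mulrC ler_pdivrMr// lt_def nx /=.
Qed.

Definition base_state : cuntz -> C := vector_state (ell2_e R 1).

Lemma state_base : state base_state.
Proof.
apply: state_vector; apply/eqP; rewrite -(@eqrXn2 _ 2)// ?ler01//.
by rewrite sqr_norm_ip ip_e expr1n.
Qed.

(** The binary numeral with digits [w], lowest first, and a leading digit [1] that records the
    length, so distinct words have distinct numbers. Starting from [e_0] would not do, because the
    generator [isom false] fixes it. *)
Fixpoint word_num (w : seq bool) : nat := if w is i :: w' then (i + (word_num w').*2)%N else 1.

Lemma word_num_gt0 w : (0 < word_num w)%N.
Proof. by elim: w => //= i w; case: i => //=; rewrite add0n double_gt0. Qed.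

Lemma word_num_inj : injective word_num.
Proof.
have gt1 i w : (1 < i + (word_num w).*2)%N.
  by apply: leq_trans (leq_addl _ _); rewrite (leq_double 1) word_num_gt0.
elim=> [|i v IH] [|j w] //= vw.
- by have := gt1 j w; rewrite -vw.
- by have := gt1 i v; rewrite vw.
have ij : i = j.
  by have := congr1 odd vw; rewrite !oddD !odd_double !addbF !oddb.
by congr (_ :: _) => //; apply: IH; move: vw; rewrite ij => /addnI/double_inj.
Qed.

Lemma sw_e w : (sw isom w : bop R) (ell2_e R 1) = ell2_e R (word_num w).
Proof.
elim: w => [|i w IH] //=.
by rewrite -[LHS]/((isom i : bop R) ((sw isom w : bop R) (ell2_e R 1))) IH isom_e.
Qed.

Lemma base_state_sw v w : base_state (star (sw cgen v) * sw cgen w) = (v == w)%:R.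
Proof.
rewrite /base_state vector_state_star !cgen_sw !sw_e ip_e /=.
congr ((nat_of_bool _)%:R); apply/eqP/eqP => [/word_num_inj//|->//].
Qed.

End Representation.

(** * Nuclearity *)

Section PositiveSemidefinite.
Variable R : realType.
Local Notation C := (cplx R).

(** Diagonalise [G] by a unitary [P]. The eigenvalues are values of the form at conjugated rows of
    [P], hence nonnegative, and [Z] is the diagonal of their square roots times [P]. *)
Lemma psd_factor_ord n (G : 'M[C]_n) : (forall i j, conjc (G i j) = G j i) ->
  (forall v : 'I_n -> C, 0 <= \sum_i \sum_j (conjc (v i) : C) * G i j * v j) ->
  exists Z : 'M[C]_n, forall i j, G i j = \sum_h (conjc (Z h i) : C) * Z h j.
Proof.
move=> Gh Gp.
have GA : map_mx (@Num.conj C) G^T = G by apply/matrixP => i j; rewrite !mxE; exact: Gh.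
have /orthomx_spectralP GE : G \is normalmx by apply/normalmxP; rewrite GA.
set P := spectralmx G in GE; set D := spectral_diag G in GE.
have uP : P \is unitarymx := spectral_unitarymx G.
have DE k : D 0 k = (P *m G *m map_mx (@Num.conj C) P^T) k k.
  rewrite GE invmx_unitary// !mulmxA (unitarymxP uP) mul1mx -mulmxA (unitarymxP uP) mulmx1.
  by rewrite mxE eqxx mulr1n.
have D0 k : 0 <= D 0 k.
  rewrite DE mxE; apply: le_trans (Gp (fun j => conjc (P k j))) _.
  rewrite exchange_big /= le_eqVlt; apply/orP; left; apply/eqP.
  apply: eq_bigr => j _; rewrite !mxE mulr_suml; apply: eq_bigr => i _.
  by rewrite conjcK.
exists (\matrix_(h, i) (sqrtC (D 0 h) * P h i)) => i j.
rewrite {1}GE invmx_unitary// mxE; apply: eq_bigr => h _.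
rewrite !mxE (bigD1 h)//= big1 ?addr0; last first.
  by move=> k kh; rewrite !mxE (negbTE kh) mulr0n mulr0.
rewrite !mxE eqxx mulr1n cplx_conjM (conjc_ge0 (k := sqrtC _)) ?sqrtC_ge0//.
by rewrite -{1}(sqrtCK (D 0 h)) expr2 !mulrA.
Qed.

Lemma psd_factor (K : finType) (G : K -> K -> C) : (forall i j, conjc (G i j) = G j i) ->
  (forall v : K -> C, 0 <= \sum_i \sum_j (conjc (v i) : C) * G i j * v j) ->
  exists Z : K -> K -> C, forall i j, G i j = \sum_h (conjc (Z h i) : C) * Z h j.
Proof.
move=> Gh Gp; pose G' := \matrix_(i < #|K|, j < #|K|) G (enum_val i) (enum_val j).
have [i j|v|Z ZE] := @psd_factor_ord _ G'.
- by rewrite !mxE.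
- apply: le_trans (Gp (fun k => v (enum_rank k))) _.
  rewrite le_eqVlt; apply/orP; left; apply/eqP.
  rewrite (reindex _ (onW_bij _ (@enum_val_bij K))) /=; apply: eq_bigr => i _.
  rewrite (reindex _ (onW_bij _ (@enum_val_bij K))) /=; apply: eq_bigr => j _.
  by rewrite !mxE !enum_valK.
exists (fun h k => Z (enum_rank h) (enum_rank k)) => i j.
have := ZE (enum_rank i) (enum_rank j); rewrite mxE !enum_rankK => ->.
by rewrite [RHS](reindex _ (onW_bij _ (@enum_val_bij K))) /=; apply: eq_bigr => h _; rewrite enum_valK.
Qed.

End PositiveSemidefinite.

Section Words.

Fixpoint words (l : nat) : seq (seq bool) :=
  if l is l'.+1 then map (cons false) (words l') ++ map (cons true) (words l') else [:: [::]].

Lemma mem_words l w : (w \in words l) = (size w == l).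
Proof.
elim: l w => [|l IH] [|i w] //=; rewrite ?mem_cat.
  by apply/negP => /orP[] /mapP[].
have inj b : injective (cons b : seq bool -> seq bool) by move=> ? ? [].
rewrite eqSS -IH; case: i.
  rewrite orbC (mem_map (inj true)); case: (w \in _) => //=.
  by apply/negP => /mapP[].
rewrite (mem_map (inj false)); case: (w \in _) => //=.
by apply/negP => /mapP[].
Qed.

Lemma words_uniq l : uniq (words l).
Proof.
elim: l => //= l IH; rewrite cat_uniq !map_inj_uniq ?IH //=; try by move=> ? ? [].
by rewrite andbT; apply/hasPn => _ /mapP[w _ ->]; apply/negP => /mapP[].
Qed.

Definition word_band m N : seq (seq bool) := flatten [seq words l | l <- iota m N].

Lemma mem_word_band m N w : (w \in word_band m N) = (m <= size w < m + N)%N.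
Proof.
apply/flatten_mapP/idP => [[l]|h].
  by rewrite mem_iota mem_words => lN /eqP ->.
by exists (size w); rewrite ?mem_iota// mem_words.
Qed.

Lemma word_band_uniq m N : uniq (word_band m N).
Proof.
elim: N m => // N IH m; rewrite /word_band /= cat_uniq words_uniq IH andbT /=.
apply/hasPn => w; rewrite -[flatten _]/(word_band m.+1 N) mem_word_band mem_words.
by move=> /andP[mw _]; rewrite gtn_eqF.
Qed.

Lemma big_word_band (V : nmodType) m N (F : seq bool -> V) :
  \sum_(w <- word_band m N) F w = \sum_(l <- iota m N) \sum_(w <- words l) F w.
Proof. by rewrite big_flatten /= big_map. Qed.

End Words.

Section WordSums.
Variables (R : realType) (A : cstarAlg R) (s : bool -> A).
Local Notation C := (cplx R).
Hypothesis s_sum : s false * star (s false) + s true * star (s true) = 1.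

Lemma sum_words l : \sum_(w <- words l) sw s w * star (sw s w) = 1.
Proof.
elim: l => [|l IH]; first by rewrite big_seq1 /= star1 mulr1.
have step i : \sum_(w <- words l) sw s (i :: w) * star (sw s (i :: w)) = s i * star (s i).
  under eq_bigr => w _ do rewrite /= starM mulrA -(mulrA (s i)).
  by rewrite -mulr_suml -mulr_sumr IH mulr1.
by rewrite /= big_cat !big_map /= !step.
Qed.

Lemma sum_word_band m N : \sum_(w <- word_band m N) sw s w * star (sw s w) = N%:R.
Proof.
rewrite big_word_band (eq_bigr (fun=> 1)); last by move=> l _; exact: sum_words.
by rewrite big_const_seq count_predT size_iota iter_addr_0.
Qed.

End WordSums.

(** * Operator inequalities read through a state *)

Section StateForms.
Variables (R : realType) (B : cstarAlg R) (phi : B -> cplx R).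
Local Notation C := (cplx R).
Hypothesis phiP : state phi.

Lemma state_gram (K : finType) (a b : K -> C) (eta : K -> B) :
  phi (star (\sum_k a k *: eta k) * (\sum_k b k *: eta k)) =
  \sum_k \sum_l (conjc (a k) : C) * phi (star (eta k) * eta l) * b l.
Proof.
rewrite star_sum mulr_suml state_sum//; apply: eq_bigr => k _.
rewrite mulr_sumr state_sum//; apply: eq_bigr => l _.
by rewrite starZ -scalerAl -scalerAr !stateZ//; ring.
Qed.

(** The row with entries [T i] has squared norm [N]. Summing the positive numbers
    [phi (star (d i) * d i)] for [d i = star (T i) * u - N *: zeta i] gives [N ^+ 2 * \sum_i phi
    (star (zeta i) * zeta i) - N * phi (star u * u)]. *)
Lemma row_contraction (I : finType) (P : pred I) (T zeta : I -> B) (N : C) u : 0 < N ->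
  \sum_(i | P i) T i * star (T i) = N *: 1 ->
  u = \sum_(i | P i) T i * zeta i ->
  phi (star u * u) <= N * \sum_(i | P i) phi (star (zeta i) * zeta i).
Proof.
move=> N0 TT uE; have NE : conjc N = N by rewrite conjc_ge0// ltW.
pose d i := star (T i) * u - N *: zeta i.
have dE : \sum_(i | P i) star (d i) * d i =
    (N ^+ 2) *: (\sum_(i | P i) star (zeta i) * zeta i) - N *: (star u * u).
  have e1 : \sum_(i | P i) star u * (T i * star (T i)) * u = N *: (star u * u).
    by rewrite -mulr_suml -mulr_sumr TT -scalerAr mulr1 -scalerAl.
  have e2 : \sum_(i | P i) star u * (T i * zeta i) = star u * u by rewrite -mulr_sumr -uE.
  have e3 : \sum_(i | P i) star (T i * zeta i) * u = star u * u.
    by rewrite -mulr_suml -star_sum -uE.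
  have -> : \sum_(i | P i) star (d i) * d i =
    \sum_(i | P i) (star u * (T i * star (T i)) * u) - N *: \sum_(i | P i) star u * (T i * zeta i)
     - N *: \sum_(i | P i) star (T i * zeta i) * u
     + (N ^+ 2) *: \sum_(i | P i) star (zeta i) * zeta i.
    rewrite !scaler_sumr -!sumrB -big_split /=; apply: eq_bigr => i _.
    rewrite /d starB starM starK starZ NE mulrBr !mulrBl -!scalerAl -!scalerAr starM scalerA !mulrA.
    by rewrite -expr2 opprB addrA addrAC; congr (_ + _); rewrite addrAC.
  by rewrite e1 e2 e3 subrr add0r addrC.
have : 0 <= \sum_(i | P i) phi (star (d i) * d i) by apply: sumr_ge0 => i _; exact: state_ge0.
rewrite -state_sum// dE stateB// !stateZ// subr_ge0 expr2 -mulrA ler_pM2l//.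
by rewrite state_sum.
Qed.

(** [G] is the matrix of [c ^+ 2] minus [M] adjoint times [M]. It is positive semidefinite by the
    norm bound, so it factors through some [Z], and the difference of the two sides is the sum of
    squares for [Z] applied to [eta]. *)
Lemma matrix_contraction n (M : 'M[C]_n) (c : C) (eta : 'I_n -> B) : 0 <= c -> op_norm_le M c ->
  \sum_i phi (star (\sum_k M i k *: eta k) * (\sum_k M i k *: eta k)) <=
  c ^+ 2 * \sum_i phi (star (eta i) * eta i).
Proof.
move=> c0 Mc.
pose G k l : C := c ^+ 2 * (k == l)%:R - \sum_i (conjc (M i k) : C) * M i l.
have qE (f : 'I_n -> 'I_n -> C) : \sum_k \sum_l G k l * f k l =
    c ^+ 2 * \sum_k f k k - \sum_i \sum_k \sum_l (conjc (M i k) : C) * M i l * f k l.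
  have -> : \sum_i \sum_k \sum_l (conjc (M i k) : C) * M i l * f k l =
      \sum_k \sum_l (\sum_i (conjc (M i k) : C) * M i l) * f k l.
    rewrite exchange_big; apply: eq_bigr => k _; rewrite exchange_big; apply: eq_bigr => l _.
    by rewrite mulr_suml.
  rewrite mulr_sumr -sumrB; apply: eq_bigr => k _.
  under eq_bigr => l _ do rewrite mulrBl.
  rewrite sumrB; congr (_ - _); rewrite (bigD1 k)//= eqxx mulr1 big1 ?addr0// => l lk.
  by rewrite eq_sym (negbTE lk) mulr0 mul0r.
have [i j|v|Z ZE] := @psd_factor R 'I_n G.
- rewrite /G rmorphB rmorphM rmorph_nat rmorphXn /= (conjc_ge0 c0) eq_sym rmorph_sum.
  congr (_ - _); apply: eq_bigr => k _; rewrite /= cplx_conjM conjcK mulrC //.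
- have := Mc (\col_i v i); rewrite -subr_ge0 => h; apply: le_trans h _.
  rewrite le_eqVlt; apply/orP; left; apply/eqP.
  transitivity (\sum_k \sum_l G k l * ((conjc (v k) : C) * v l)); last first.
    by apply: eq_bigr => k _; apply: eq_bigr => l _; ring.
  rewrite qE; congr (_ * _ - _).
    by apply: eq_bigr => k _; rewrite mxE sqr_normc mulrC.
  apply: eq_bigr => i _; rewrite mxE sqr_normc rmorph_sum mulrC mulr_suml; apply: eq_bigr => k _.
  rewrite mulr_sumr; apply: eq_bigr => l _; rewrite !mxE /= cplx_conjM; ring.
have : 0 <= \sum_h phi (star (\sum_k Z h k *: eta k) * (\sum_k Z h k *: eta k)).
  by apply: sumr_ge0 => h _; exact: state_ge0.
have -> : \sum_h phi (star (\sum_k Z h k *: eta k) * (\sum_k Z h k *: eta k)) =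
    \sum_k \sum_l G k l * phi (star (eta k) * eta l).
  under eq_bigr => h _ do rewrite state_gram.
  rewrite exchange_big; apply: eq_bigr => k _; rewrite exchange_big; apply: eq_bigr => l _.
  by rewrite ZE mulr_suml; apply: eq_bigr => h _; ring.
rewrite qE subr_ge0 => h; apply: le_trans h.
rewrite le_eqVlt; apply/orP; left; apply/eqP; apply: eq_bigr => i _.
rewrite state_gram; apply: eq_bigr => k _; apply: eq_bigr => l _; ring.
Qed.

Lemma bessel (I : finType) (P : pred I) (T : I -> B) (y : B) :
  (forall x, phi (star x) = conjc (phi x)) ->
  (forall i j, P i -> P j -> phi (star (T i) * T j) = (i == j)%:R) ->
  \sum_(i | P i) `|phi (star (T i) * y)| ^+ 2 <= phi (star y * y).
Proof.
move=> phi_star TT; pose c i := phi (star (T i) * y).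
pose u := \sum_(i | P i) c i *: T i.
have cE i : `|c i| ^+ 2 = conjc (c i) * c i :> C by rewrite sqr_normc mulrC.
have uy : phi (star u * y) = \sum_(i | P i) `|c i| ^+ 2.
  rewrite star_sum mulr_suml state_sum//; apply: eq_bigr => i _.
  by rewrite starZ -scalerAl stateZ// cE.
have yu : phi (star y * u) = \sum_(i | P i) `|c i| ^+ 2.
  rewrite mulr_sumr state_sum//; apply: eq_bigr => i _.
  rewrite -scalerAr stateZ// cE mulrC; congr (_ * _).
  by rewrite /c -phi_star starM starK.
have uu : phi (star u * u) = \sum_(i | P i) `|c i| ^+ 2.
  rewrite star_sum mulr_suml state_sum//; apply: eq_bigr => i Pi.
  rewrite mulr_sumr state_sum// (bigD1 i)//= big1 ?addr0.
    by rewrite starZ -scalerAl -scalerAr !stateZ// TT// eqxx mulr1 cE.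
  move=> j /andP[Pj ji].
  by rewrite starZ -scalerAl -scalerAr !stateZ// TT// eq_sym (negbTE ji) !mulr0.
have := state_ge0 phiP (y - u).
rewrite starB mulrBl !mulrBr !stateB// uy yu uu subrr subr0 subr_ge0.
by [].
Qed.

End StateForms.

Section CfunSqrt.
Variables (R : realType) (X : compactType).
Local Notation C := (cplx R).
Local Notation CX := (cfun_cstar X (cplx_cstar R)).

Lemma cfun_sqrt (h : CX) : (forall x, (0 : C) <= ev h x) -> exists q : CX, star q * q = h.
Proof.
move=> h0.
have cu : continuous (fun x => Num.sqrt (complex.Re (ev h x))).
  move=> x; apply: (@continuous_comp _ _ _ (fun x => complex.Re (ev h x)) Num.sqrt).
    by apply: continuous_comp; [exact: ev_continuous|exact: Re_continuous].
  exact: sqrt_continuous.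
exists (realCf cu); apply: ev_ext => x.
rewrite evM ev_star /realCf ev_mkcfun.
set a := complex.Re _.
have a0 : 0 <= a by have := h0 x; rewrite [X in _ <= X](cplx_real (h0 x)) cplx_le.
transitivity (a%:C%C : C); last by rewrite [RHS](cplx_real (h0 x)).
rewrite -[LHS]/((conjc ((Num.sqrt a)%:C%C : C) : C) * (Num.sqrt a)%:C%C).
rewrite conjc_ge0 ?cplx_le ?sqrtr_ge0// -[RHS](congr1 (fun b : R => b%:C%C : C) (sqr_sqrtr a0)).
by rewrite expr2 -rmorphM.
Qed.

Lemma tens_cfun_star_mul (A : cstarAlg R) (a b : A) (q : CX) :
  tens_cfun (star a * b) (star q * q) = star (tens_cfun a q) * tens_cfun b q.
Proof.
apply: ev_ext => x; rewrite evM ev_star !ev_tens_cfun evM ev_star starZ.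
by rewrite -scalerAl -scalerAr scalerA.
Qed.

End CfunSqrt.

(* Makes a sum of squares a single square, as [mx_positive] requires. *)
Lemma orthogonal_isometries_mul (R : realType) (A : cstarAlg R) (K : finType) (W x y : K -> A) :
  (forall k l, star (W k) * W l = (k == l)%:R) ->
  star (\sum_k W k * x k) * (\sum_k W k * y k) = \sum_k star (x k) * y k.
Proof.
move=> WW; rewrite star_sum mulr_suml; apply: eq_bigr => k _.
rewrite mulr_sumr (bigD1 k)//= big1 ?addr0 => [|l lk].
  by rewrite starM mulrA -(mulrA (star (x k))) WW eqxx mulr1.
by rewrite starM mulrA -(mulrA (star (x k))) WW eq_sym (negbTE lk) mulr0 mul0r.
Qed.

(** * Factoring C(X, B) through a matrix algebra *)

Section MatrixFactorization.
Variables (R : realType) (X : compactType) (B : cstarAlg R).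
Local Notation C := (cplx R).
Local Notation CX := (cfun_cstar X (cplx_cstar R)).
Local Notation A := (cfun_cstar X B).
Hypothesis eB : enough_states B.
Variable omega : B -> C.
Hypothesis omegaP : state omega.
Hypothesis omega_star : forall x, omega (star x) = conjc (omega x).
Variable V : nat -> B.
Hypothesis VV : forall t t', star (V t) * V t' = (t == t')%:R.
Variables (J n : nat) (pts : 'I_J -> X) (p : 'I_J -> CX).
Hypothesis p0 : forall j x, (0 : C) <= ev (p j) x.
Hypothesis p1 : forall x, \sum_j (ev (p j) x : C) = 1.
Variables (blk : 'I_n -> 'I_J) (T : 'I_n -> B) (N : C).
Hypothesis N0 : 0 < N.
Hypothesis T_orth : forall i i', blk i = blk i' -> omega (star (T i) * T i') = (i == i')%:R.
Hypothesis T_sum : forall j, \sum_(i | blk i == j) T i * star (T i) = N *: 1.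

(** In the GNS space of [omega] the vectors [T i] of one block are orthonormal, and block [j] is the
    compression of the operator [f (pts j)] to their span. Nuclearity is stated with a full matrix
    algebra, so the direct sum of the blocks is embedded in it with zeros off the diagonal, and
    [expansion] ignores those entries. *)
Definition compression (f : A) : 'M[C]_n := \matrix_(i, i')
  if blk i == blk i' then omega (star (T i) * ev f (pts (blk i)) * T i') else 0.

Definition expansion_block (j : 'I_J) (M : 'M[C]_n) : B :=
  N^-1 *: \sum_(i | blk i == j) \sum_(i' | blk i' == j) M i i' *: (T i * star (T i')).

Definition expansion (M : 'M[C]_n) : A := \sum_j tens_cfun (expansion_block j M) (p j).

Lemma ev_expansion M x : ev (expansion M) x = \sum_j (ev (p j) x : C) *: expansion_block j M.
Proof. by rewrite ev_sum; apply: eq_bigr => j _; rewrite ev_tens_cfun. Qed.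

Lemma compression_linear : linear compression.
Proof.
move=> k f g; apply/matrixP => i i'; rewrite !mxE; case: ifP => _; last by rewrite mulr0 addr0.
by rewrite evD evZ mulrDr mulrDl -scalerAr -scalerAl stateD// stateZ.
Qed.

Lemma expansion_block_linear j : linear (expansion_block j).
Proof.
move=> k M M'; rewrite /expansion_block scalerA mulrC -scalerA -scalerDr; congr (_ *: _).
rewrite scaler_sumr -big_split; apply: eq_bigr => i _.
rewrite scaler_sumr -big_split; apply: eq_bigr => i' _.
by rewrite !mxE scalerDl scalerA.
Qed.

Lemma expansion_linear : linear expansion.
Proof.
move=> k M M'; apply: ev_ext => x; rewrite evD evZ !ev_expansion scaler_sumr -big_split.
apply: eq_bigr => j _; rewrite expansion_block_linear scalerDr; congr (_ + _).
have sC (a b : C) (y : B) : a *: (b *: y) = b *: (a *: y) by rewrite !scalerA mulrC.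
exact: sC.
Qed.

(** The vector [xi j] has the norm of the block [j] of [v], and by Bessel's inequality the block [j]
    of the image is no longer than [f (pts j)] applied to [xi j]. *)
Lemma compression_norm f : op_norm_le (compression f) `|f|.
Proof.
move=> v.
pose xi j := \sum_(i | blk i == j) v i 0 *: T i.
have cE i : (compression f *m v) i 0 = omega (star (T i) * (ev f (pts (blk i)) * xi (blk i))).
  rewrite mxE mulrA mulr_sumr state_sum// [RHS]big_mkcond; apply: eq_bigr => i' _.
  rewrite mxE eq_sym; case: ifP => _; last by rewrite mul0r.
  by rewrite -scalerAr stateZ// mulrC.
have xiE j : omega (star (xi j) * xi j) = \sum_(i | blk i == j) `|v i 0| ^+ 2.
  rewrite star_sum mulr_suml state_sum//; apply: eq_bigr => i bi.
  rewrite mulr_sumr state_sum// (bigD1 i)//= big1 ?addr0.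
    by rewrite starZ -scalerAl -scalerAr !stateZ// T_orth// eqxx mulr1 sqr_normc mulrC.
  move=> i' /andP[bi' ii']; rewrite starZ -scalerAl -scalerAr !stateZ// T_orth.
    by rewrite eq_sym (negbTE ii') !mulr0.
  by rewrite (eqP bi) (eqP bi').
have part (F : 'I_n -> C) : \sum_i F i = \sum_j \sum_(i | blk i == j) F i.
  by rewrite (partition_big blk predT).
rewrite !part mulr_sumr; apply: ler_sum => j _.
apply: (@le_trans _ _ (omega (star (ev f (pts j) * xi j) * (ev f (pts j) * xi j)))).
  apply: le_trans (bessel (P := fun i => blk i == j) (T := T) omegaP _ omega_star _).
    by apply: ler_sum => i /eqP bi; rewrite cE bi.
  by move=> i i' /eqP bi /eqP bi'; apply: T_orth; rewrite bi.
rewrite starM mulrA -(mulrA (star (xi j))) -xiE.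
apply: le_trans (state_norm_le omegaP _ _) _.
rewrite ler_wpM2r ?state_ge0//.
by rewrite ler_pXn2r ?nnegrE// ev_norm_le.
Qed.

(** The image, read as one matrix indexed by ['I_m * 'I_n], is a sum of Gram matrices for [omega],
    hence positive semidefinite. Cutting the factor given by [psd_factor] into blocks yields the
    root demanded by [mx_positive]. *)
Lemma compression_cp : completely_positive (@star R A) (@mx_star R n) compression.
Proof.
move=> m Y [Z YE].
pose eta (j : 'I_J) (c : 'I_m) (k : 'I_m * 'I_n) : B :=
  if blk k.2 == j then ev (Z c k.1) (pts j) * T k.2 else 0.
pose G k l : C := \sum_j \sum_c omega (star (eta j c k) * eta j c l).
have GE a b i i' : compression (Y a b) i i' = G (a, i) (b, i').
  rewrite /G mxE (bigD1 (blk i))//= [X in _ = _ + X]big1 ?addr0; last first.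
    move=> j ji; rewrite big1// => c _.
    by rewrite /eta /= eq_sym (negbTE ji) star0 mul0r state0.
  rewrite /eta /= eqxx eq_sym; case: ifP => _; last first.
    by rewrite big1// => c _; rewrite mulr0 state0.
  rewrite YE mxE ev_sum mulr_sumr mulr_suml state_sum//; apply: eq_bigr => c _.
  by rewrite !mxE evM ev_star starM !mulrA.
have [i j|v|W WE] := @psd_factor R ('I_m * 'I_n)%type G.
- rewrite /G rmorph_sum; apply: eq_bigr => j' _; rewrite rmorph_sum; apply: eq_bigr => c _.
  by rewrite -[LHS]omega_star starM starK.
- have -> : \sum_i \sum_j (conjc (v i) : C) * G i j * v j =
      \sum_j' \sum_c omega (star (\sum_k v k *: eta j' c k) * (\sum_k v k *: eta j' c k)).
    rewrite /G; under [RHS]eq_bigr => j' _ do under eq_bigr => c _ do rewrite state_gram//.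
    under [RHS]eq_bigr => j' _ do rewrite exchange_big; rewrite [RHS]exchange_big /=.
    apply: eq_bigr => k _.
    under [RHS]eq_bigr => j' _ do rewrite exchange_big; rewrite [RHS]exchange_big /=.
    apply: eq_bigr => l _; rewrite mulr_sumr mulr_suml; apply: eq_bigr => j' _.
    by rewrite mulr_sumr mulr_suml.
  by apply: sumr_ge0 => j' _; apply: sumr_ge0 => c _; exact: state_ge0.
exists (\matrix_(c, b) \matrix_(k, i) W (c, k) (b, i)).
apply/matrixP => a b; rewrite !mxE; apply/matrixP => i i'.
rewrite GE WE summxE.
transitivity (\sum_c \sum_k (conjc (W (c, k) (a, i)) : C) * W (c, k) (b, i')).
  by rewrite pair_bigA; apply: eq_bigr => -[c k] _.
apply: eq_bigr => c _; rewrite !mxE; apply: eq_bigr => k _.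
by rewrite !mxE.
Qed.

(** The map sends [y] to the column [eta k = star (T k) * y], applies [M], and returns by the row
    [T]. In squared norm the three steps cost [N], [c ^+ 2] and [N], which the prefactor [N^-1]
    compensates. *)
Lemma expansion_block_norm j (M : 'M[C]_n) (c : C) : 0 <= c -> op_norm_le M c ->
  `|expansion_block j M| <= c.
Proof.
move=> c0 Mc; apply: eB => // phi phiP y.
pose eta k := if blk k == j then star (T k) * y else 0.
pose zeta i := \sum_k M i k *: eta k.
pose u := \sum_(i | blk i == j) T i * zeta i.
have NE : conjc N^-1 = N^-1 :> C by rewrite conjc_ge0// invr_ge0 ltW.
have -> : star y * (star (expansion_block j M) * expansion_block j M) * y =
    (N^-1 * N^-1) *: (star u * u).
  have uE : expansion_block j M * y = N^-1 *: u.
    rewrite -scalerAl; congr (_ *: _); rewrite mulr_suml; apply: eq_bigr => i _.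
    rewrite mulr_suml mulr_sumr big_mkcond; apply: eq_bigr => k _ /=.
    rewrite /eta; case: ifP => _; last by rewrite scaler0 mulr0.
    by rewrite -scalerAl -scalerAr mulrA.
  by rewrite mulrA -starM -mulrA uE starZ NE -scalerAl -scalerAr scalerA.
rewrite stateZ//.
have etaE : \sum_i phi (star (eta i) * eta i) = N * phi (star y * y).
  rewrite -stateZ// (_ : N *: (star y * y) = star y * (N *: 1) * y); last first.
    by rewrite -scalerAr -scalerAl mulr1.
  rewrite -(T_sum j) mulr_sumr mulr_suml state_sum// [RHS]big_mkcond; apply: eq_bigr => i _.
  rewrite /eta; case: ifP => _; last by rewrite mulr0 state0.
  by rewrite starM starK !mulrA.
have h1 := row_contraction phiP N0 (T_sum j) (erefl u).
have h2 : \sum_(i | blk i == j) phi (star (zeta i) * zeta i) <=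
    \sum_i phi (star (zeta i) * zeta i).
  rewrite [leLHS]big_mkcond; apply: ler_sum => i _; case: ifP => // _; exact: state_ge0.
have h3 := matrix_contraction phiP eta c0 Mc.
have NN : 0 < N * N by rewrite mulr_gt0.
rewrite -invfM mulrC ler_pdivrMr//; apply: le_trans h1 _.
rewrite [leRHS](_ : _ = N * (c ^+ 2 * (N * phi (star y * y)))); last by ring.
rewrite ler_wpM2l ?(ltW N0)//; apply: le_trans h2 _.
by apply: le_trans h3 _; rewrite etaE.
Qed.

Lemma expansion_norm (M : 'M[C]_n) (c : C) : 0 <= c -> op_norm_le M c -> `|expansion M| <= c.
Proof.
move=> c0 Mc; apply: norm_le_ev => x; rewrite ev_expansion.
by apply: convex_comb_norm_le => // j _; exact: expansion_block_norm.
Qed.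

(** With [r] the rows of [P] applied to the [star (T i)] and scaled by the inverse root of [N], a
    block of [mx_star P *m Q] expands to a sum of products [star (r j k P) * r j k Q]; roots [q j]
    of the weights keep this form. The constant isometries [W k], with mutually orthogonal ranges,
    then merge the sum over all [(j, k)] into one product. *)
Lemma expansion_cp : completely_positive (@mx_star R n) (@star R A) expansion.
Proof.
move=> m Y [Z YE].
have /choice[q qE] : forall j, exists q : CX, star q * q = p j by move=> j; exact: cfun_sqrt.
pose r (j : 'I_J) (k : 'I_n) (P : 'M[C]_n) : B :=
  \sum_(i | blk i == j) ((sqrtC N)^-1 * P k i) *: star (T i).
have rE j (P Q : 'M[C]_n) : expansion_block j (mx_star P *m Q) = \sum_k star (r j k P) * r j k Q.
  rewrite /expansion_block scaler_sumr.
  under [RHS]eq_bigr => k _ do rewrite star_sum mulr_suml.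
  rewrite [RHS]exchange_big; apply: eq_bigr => i _.
  under [RHS]eq_bigr => k _ do rewrite mulr_sumr.
  rewrite [RHS]exchange_big scaler_sumr; apply: eq_bigr => i' _.
  rewrite mxE scaler_suml scaler_sumr; apply: eq_bigr => k _.
  rewrite !mxE starZ starK -scalerAl -scalerAr !scalerA cplx_conjM.
  rewrite (conjc_ge0 (k := (sqrtC N)^-1)) ?invr_ge0 ?sqrtC_ge0 ?(ltW N0)//.
  congr (_ *: _); rewrite -{1}(sqrtCK N) expr2 invfM; ring.
pose e (k : 'I_J * 'I_n) (c b : 'I_m) := tens_cfun (r k.1 k.2 (Z c b)) (q k.1).
pose W (k : 'I_J * 'I_n) : A := cstf X (V (enum_rank k)).
have WW k l : star (W k) * W l = (k == l)%:R.
  apply: ev_ext => x; rewrite evM ev_star !ev_mkcfun VV (inj_eq val_inj) (inj_eq enum_rank_inj).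
  by case: (k == l).
exists (\matrix_(c, b) \sum_k W k * e k c b).
apply/matrixP => a b; rewrite !mxE YE mxE.
rewrite (big_morph expansion (id1 := 0) (op1 := +%R)); first last.
- by have := expansion_linear (-1) 0 0; rewrite scaler0 add0r scaleN1r addNr.
- by move=> P Q; have := expansion_linear 1 P Q; rewrite !scale1r.
apply: eq_bigr => c _; rewrite !mxE orthogonal_isometries_mul//.
transitivity (\sum_j \sum_k star (e (j, k) c a) * e (j, k) c b).
  apply: eq_bigr => j _; rewrite rE -(qE j).
  under [RHS]eq_bigr => k _ do rewrite -tens_cfun_star_mul.
  by apply: ev_ext => x; rewrite ev_sum ev_tens_cfun scaler_sumr.
by rewrite pair_bigA; apply: eq_bigr => -[j k] _.
Qed.

End MatrixFactorization.

Section WordCombinatorics.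

(** Stripping the common prefix [a] lowers the window of lengths by [size a]; since [size a <= m],
    the truncated subtraction is exact. *)
Lemma big_word_band_prefix (V : nmodType) m N (a : seq bool) (F : seq bool -> V) :
  (size a <= m)%N -> (forall w, ~~ prefix a w -> (m <= size w)%N -> F w = 0) ->
  \sum_(w <- word_band m N) F w = \sum_(g <- word_band (m - size a) N) F (a ++ g).
Proof.
move=> am F0.
have ar x y : (x <= m)%N -> (m <= x + y < m + N)%N = (m - x <= y < m - x + N)%N by lia.
rewrite (bigID (prefix a)) /= [X in _ + X]big1_seq ?addr0; last first.
  by move=> w /andP[aw]; rewrite mem_word_band => /andP[mw _]; exact: F0.
rewrite -big_filter -(big_map (cat a) predT F); apply: perm_big; apply: uniq_perm.
- by rewrite filter_uniq// word_band_uniq.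
- rewrite map_inj_uniq ?word_band_uniq// => x y /eqP.
  by rewrite eqseq_cat// eqxx => /eqP.
move=> w; rewrite mem_filter mem_word_band; apply/andP/mapP => [[/prefixP[g ->]]|[g]].
  by rewrite size_cat ar// => gN; exists g => //; rewrite mem_word_band.
by rewrite mem_word_band => gN ->; split; [exact: prefix_prefix|rewrite size_cat ar].
Qed.

Lemma big_diagonal (V : nmodType) (I : eqType) (s1 s2 s3 : seq I) (F : I -> I -> V) :
  uniq s1 -> uniq s2 -> uniq s3 -> (forall x, (x \in s3) = (x \in s1) && (x \in s2)) ->
  (forall x y, x != y -> F x y = 0) ->
  \sum_(x <- s1) \sum_(y <- s2) F x y = \sum_(x <- s3) F x x.
Proof.
move=> u1 u2 u3 s3E F0.
have -> : \sum_(x <- s3) F x x = \sum_(x <- s1 | x \in s2) F x x.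
  rewrite -[RHS]big_filter; apply: perm_big; apply: uniq_perm => //; first by rewrite filter_uniq.
  by move=> x; rewrite mem_filter s3E andbC.
rewrite [RHS]big_mkcond; apply: eq_bigr => x _; case: ifPn => xs2.
  rewrite (bigD1_seq x)//= big1 ?addr0// => y yx.
  by apply: F0; rewrite eq_sym.
by rewrite big1_seq// => y /= ys2; apply: F0; apply: contraNneq xs2 => ->.
Qed.

End WordCombinatorics.

(** * Convergence of the averages over bands of words *)

Section CuntzNuclear.
Variables (R : realType) (B : cstarAlg R) (s : bool -> B).
Local Notation C := (cplx R).
Hypothesis s_inner : forall i j, star (s i) * s j = (i == j)%:R.
Hypothesis s_sum : s false * star (s false) + s true * star (s true) = 1.
Hypothesis s_dense : dense (lin_span (monomials s)).
Hypothesis eB : enough_states B.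
Variable omega : B -> C.
Hypothesis omegaP : state omega.
Hypothesis omega_star : forall x, omega (star x) = conjc (omega x).
Hypothesis omega_sw : forall v w, omega (star (sw s v) * sw s w) = (v == w)%:R.

(** The effect of [expansion] after [compression] on the value of a function at one point. *)
Definition band_average m N (b : B) : B := (N%:R : C)^-1 *:
  \sum_(w <- word_band m N) \sum_(w' <- word_band m N)
    omega (star (sw s w) * b * sw s w') *: (sw s w * star (sw s w')).

Lemma band_averageD m N b b' :
  band_average m N (b + b') = band_average m N b + band_average m N b'.
Proof.
rewrite -scalerDr -big_split; congr (_ *: _); apply: eq_bigr => w _.
rewrite -big_split; apply: eq_bigr => w' _ /=.
by rewrite mulrDr mulrDl stateD// scalerDl.
Qed.

Lemma band_averageZ m N (k : C) b : band_average m N (k *: b) = k *: band_average m N b.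
Proof.
rewrite /band_average scalerA mulrC -scalerA; congr (_ *: _).
rewrite scaler_sumr; apply: eq_bigr => w _; rewrite scaler_sumr; apply: eq_bigr => w' _.
by rewrite -scalerAr -scalerAl stateZ// scalerA.
Qed.

Lemma sw_not_prefix a w : ~~ prefix a w -> (size a <= size w)%N -> star (sw s w) * sw s a = 0.
Proof.
elim: a w => [|i a IH] [|j w] //=.
rewrite ltnS starM mulrA -(mulrA _ (star (s j))) s_inner eq_sym.
by case: eqP => _ /=; [rewrite mulr1; exact: IH|rewrite mulr0 mul0r].
Qed.

Lemma sw_prefix a g : star (sw s (a ++ g)) * sw s a = star (sw s g).
Proof. by rewrite sw_cat starM -mulrA sw_iso ?mulr1//. Qed.

(** Stripping [a] and [b] leaves pairs of words from two windows of [N] lengths, starting at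
    [m - size a] and [m - size b]; [omega] keeps the equal pairs. The windows overlap in [N - d]
    lengths, from [m - minn (size a) (size b)] on, and the words of each length contribute [1] by
    [sum_words]. *)
Lemma band_average_monomial m N a b : (size a <= m)%N -> (size b <= m)%N ->
  let d := (maxn (size a) (size b) - minn (size a) (size b))%N in
  band_average m N (sw s a * star (sw s b)) =
  ((N%:R : C)^-1 * (N - d)%:R) *: (sw s a * star (sw s b)).
Proof.
move=> am bm d; rewrite /band_average -scalerA; congr (_ *: _).
rewrite (big_word_band_prefix _ am); last first.
  move=> w aw mw; rewrite big1// => w' _.
  by rewrite mulrA sw_not_prefix ?(leq_trans am)// !mul0r state0// scale0r.
transitivity (\sum_(g <- word_band (m - size a) N) \sum_(h <- word_band (m - size b) N)
    ((g == h)%:R : C) *: (sw s a * (sw s g * star (sw s h)) * star (sw s b))).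
  apply: eq_bigr => g _; rewrite (big_word_band_prefix _ bm); last first.
    move=> w bw mw.
    rewrite mulrA sw_prefix -mulrA (_ : star (sw s b) * sw s w = 0) ?mulr0 ?state0 ?scale0r//.
    by rewrite -[LHS]starK starM starK sw_not_prefix ?star0// (leq_trans bm).
  apply: eq_bigr => h _.
  rewrite mulrA sw_prefix -mulrA (_ : star (sw s b) * sw s (b ++ h) = sw s h); last first.
    by rewrite -[LHS]starK starM starK sw_prefix starK.
  by rewrite omega_sw !sw_cat starM !mulrA.
rewrite (big_diagonal (s3 := word_band (m - minn (size a) (size b)) (N - d)));
  rewrite ?word_band_uniq//; first last.
- by move=> x y /negbTE ->; rewrite scale0r.
- by move=> x; rewrite !mem_word_band /d; lia.
under eq_bigr => g _ do rewrite eqxx scale1r.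
by rewrite -mulr_suml -mulr_sumr sum_word_band// -mulrA mulr_natl mulrnAr scaler_nat.
Qed.

(** Among the words consisting of [t] letters [true] and a final [false], none is a prefix of
    another; so two generators yield infinitely many isometries with orthogonal ranges, as
    [expansion_cp] requires for matrices of any size. *)
Lemma sw_isometries t t' : star (sw s (rcons (nseq t true) false)) * sw s (rcons (nseq t' true) false)
  = (t == t')%:R.
Proof.
elim: t t' => [|t IH] [|t'] /=; rewrite starM mulrA -(mulrA _ (star (s _))) s_inner /=.
- by rewrite star1 !mulr1.
- by rewrite mulr0 mul0r.
- by rewrite mulr0 mul0r.
- by rewrite mulr1 IH.
Qed.

Section Factorization.
Variables (X : compactType) (J : nat) (pts : 'I_J -> X).
Variable p : 'I_J -> cfun_cstar X (cplx_cstar R).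
Hypothesis p0 : forall j x, (0 : C) <= ev (p j) x.
Hypothesis p1 : forall x, \sum_j (ev (p j) x : C) = 1.
Variables (m N : nat).
Hypothesis N0 : (0 < N)%N.

Let L := [seq (j, w) | j <- enum 'I_J, w <- word_band m N].
Let idx (i : 'I_(size L)) := tnth (in_tuple L) i.

Lemma sum_block (V : nmodType) (F : seq bool -> V) j :
  \sum_(i < size L | (idx i).1 == j) F (idx i).2 = \sum_(w <- word_band m N) F w.
Proof.
rewrite -(big_tnth _ _ L (fun x => x.1 == j) (fun x => F x.2)) big_mkcond.
rewrite big_allpairs /= big_enum /= (bigD1 j)//= [X in _ + X]big1 ?addr0.
  by under eq_bigr => w _ do rewrite eqxx.
by move=> j' /negbTE jj'; rewrite big1// => w _; rewrite jj'.
Qed.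

Lemma idx_inj : injective idx.
Proof.
apply/tuple_uniqP; apply: allpairs_uniq; rewrite ?enum_uniq ?word_band_uniq//.
by move=> [? ?] [? ?] _ _ [-> ->].
Qed.

Lemma cuntz_factorization : exists n (phi : cfun_cstar X B -> 'M[C]_n) (psi : 'M[C]_n -> cfun_cstar X B),
  [/\ linear phi /\ linear psi,
      completely_positive (@star R _) (@mx_star R n) phi,
      completely_positive (@mx_star R n) (@star R _) psi,
      (forall a, op_norm_le (phi a) `|a|) /\
      (forall M c, 0 <= c -> op_norm_le M c -> `|psi M| <= c)
    & forall f x, ev (psi (phi f)) x =
        \sum_j (ev (p j) x : C) *: band_average m N (ev f (pts j))].
Proof.
pose blk i := (idx i).1; pose T i := sw s (idx i).2.
have N0' : 0 < (N%:R : C) by rewrite ltr0n.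
have T_orth i i' : blk i = blk i' -> omega (star (T i) * T i') = (i == i')%:R.
  move=> bb; rewrite omega_sw -(inj_eq idx_inj); move: bb; rewrite /blk.
  by case: (idx i) (idx i') => [j w] [j' w'] /= ->; rewrite xpair_eqE eqxx.
have T_sum j : \sum_(i | blk i == j) T i * star (T i) = (N%:R : C) *: 1.
  by rewrite (sum_block (fun w => sw s w * star (sw s w))) sum_word_band// scaler_nat.
exists (size L), (compression omega pts blk T), (expansion p blk T N%:R); split.
- by split; [exact: compression_linear|exact: expansion_linear].
- exact: compression_cp.
- exact: (expansion_cp sw_isometries p0 blk T N0').
- split; first exact: compression_norm.
  exact: (expansion_norm eB p0 p1 N0' T_sum).
move=> f x; rewrite ev_expansion; apply: eq_bigr => j _; congr (_ *: _); congr (_ *: _).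
rewrite -(sum_block _ j); apply: eq_bigr => i /eqP; rewrite -/(blk i) => bi.
rewrite -(sum_block _ j); apply: eq_bigr => i' /eqP; rewrite -/(blk i') => bi'.
by rewrite mxE bi bi' eqxx.
Qed.

End Factorization.

(** The factorization over a partition of unity with the single weight [1], applied to a constant
    function, factors this map through contractions. *)
Lemma band_average_norm m N b : (0 < N)%N -> `|band_average m N b| <= `|b|.
Proof.
move=> N0; pose X := circle R.
have [n [phi [psi [_ _ _ [hphi hpsi] hE]]]] := @cuntz_factorization X 1 (fun=> point) (fun=> 1)
  (fun _ _ => ler01) (fun x => big_ord1 _ _) m N N0.
have := hE (cstf X b) point; rewrite big_ord1 ev1 scale1r => <-.
apply: le_trans (ev_norm_le _ _) _; apply: le_trans (hpsi _ _ _ (hphi _)) _ => //.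
by apply: norm_le_ev => x.
Qed.

(** Both parameters range over a tail, so finitely many elements can share one choice; [M < N] also
    keeps [N] positive. *)
Definition averages_to (b : B) := forall e : C, 0 < e ->
  exists M, forall m N, (M <= m)%N -> (M < N)%N -> `|band_average m N b - b| < e.

Lemma averages_to_monomial a b : averages_to (sw s a * star (sw s b)).
Proof.
move=> e e0; set x := sw s a * star (sw s b).
pose d := (maxn (size a) (size b) - minn (size a) (size b))%N.
have [k k0 hk] := exists_divn_lt (mulr_ge0 (ler0n C d) (normr_ge0 x)) e0.
exists (maxn (maxn (size a) (size b)) k) => m N; rewrite !geq_max => /andP[/andP[am bm] km].
rewrite gtn_max => /andP[abN kN].
have Nn : (0 < N)%N by lia.
have N0 : 0 < (N%:R : C) by rewrite ltr0n.
rewrite band_average_monomial// -/d -/x -[X in _ - X]scale1r -scalerBl normrZ.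
have dN : (d <= N)%N by rewrite /d; lia.
have -> : (N%:R : C)^-1 * (N - d)%:R - 1 = - (d%:R / N%:R).
  by rewrite natrB// mulrBr mulVf ?gt_eqF// addrC addKr mulrC.
rewrite normrN ger0_norm ?divr_ge0 ?ler0n// mulrAC.
apply: le_lt_trans hk; rewrite ler_wpM2l ?mulr_ge0 ?ler0n// lef_pV2 ?posrE ?ltr0n//.
by rewrite ler_nat ltnW.
Qed.

Lemma averages_toD b b' : averages_to b -> averages_to b' -> averages_to (b + b').
Proof.
move=> hb hb' e e0; have e2 : 0 < e / 2 by rewrite divr_gt0.
have [M hM] := hb _ e2; have [M' hM'] := hb' _ e2.
exists (maxn M M') => m N; rewrite geq_max gtn_max => /andP[Mm M'm] /andP[MN M'N].
rewrite band_averageD opprD addrACA [ltRHS]splitr.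
by apply: le_lt_trans (ler_normD _ _) _; apply: ltrD; [exact: hM|exact: hM'].
Qed.

Lemma averages_toZ (k : C) b : averages_to b -> averages_to (k *: b).
Proof.
move=> hb e e0; have k1 : 0 < `|k| + 1 by rewrite ltr_wpDl.
have [M hM] := hb _ (divr_gt0 e0 k1).
exists M => m N Mm MN; rewrite band_averageZ -scalerBr normrZ.
apply: (@le_lt_trans _ _ ((`|k| + 1) * `|band_average m N b - b|)).
  by rewrite ler_wpM2r// lerDl.
by rewrite mulrC -ltr_pdivlMr//; exact: hM.
Qed.

Lemma averages_to_all b : averages_to b.
Proof.
move=> e e0; have e3 : 0 < e / 3 by rewrite divr_gt0.
have /denseP_norm/(_ b _ e3)[b' [n [k [v [vS ->]]]] bb'] := s_dense.
set x := \sum_i _ in bb'.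
have hx : averages_to x.
  rewrite /x; elim/big_rec: _ => [e' e'0|i y _ hy]; last first.
    apply: averages_toD hy; apply: averages_toZ.
    by have [a [c ->]] := vS i; exact: averages_to_monomial.
  exists 0%N => m N _ _.
  by have := band_averageZ m N 0 0; rewrite !scale0r => ->; rewrite subrr normr0.
have [M hM] := hx _ e3.
exists M => m N Mm MN; have N0 : (0 < N)%N by apply: leq_ltn_trans MN.
have -> : band_average m N b - b = band_average m N (b - x) + (band_average m N x - x) - (b - x).
  by rewrite opprB !addrA subrK -band_averageD subrK.
rewrite [ltRHS](_ : e = e / 3 + e / 3 + e / 3); last by field.
apply: le_lt_trans (ler_normB _ _) _; apply: ltrD => //.
apply: le_lt_trans (ler_normD _ _) _; apply: ltrD; last exact: hM.
exact: le_lt_trans (band_average_norm _ _ N0) bb'.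
Qed.

Theorem cuntz_nuclear (X : compactType) : nuclear (cfun_cstar X B).
Proof.
move=> F e e0; have e3 : 0 < e / 3 by rewrite divr_gt0.
(* Summing the oscillations over [F] makes one partition of unity serve all its elements. *)
pose d x y : R := \sum_(f <- F) complex.Re `|ev f x - ev f y|.
have e3' : 0 < complex.Re (e / 3) by rewrite -cplx_lt -(cplx_real (ltW e3)).
have [| |J [y [p [p0 p1 pd]]]] := partition_of_unity (d := d) e3'.
- move=> y x; apply: (@cvg_big R) => // [|f _]; first exact: add_continuous.
  apply: (@continuous_comp _ _ _ (fun x => `|ev f x - ev f y|)).
    apply: continuous_comp; last exact: norm_continuous.
    by apply: cvgB; [exact: (ev_continuous f x)|exact: cvg_cst].
  exact: (@Re_continuous R _).
- by move=> x; rewrite /d big1// => f _; rewrite subrr normr0.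
have [M hM] : exists M, forall f, f \in F -> forall j m N, (M <= m)%N -> (M < N)%N ->
    `|band_average m N (ev f (y j)) - ev f (y j)| < e / 3.
  elim: F {d pd} => [|f F [M hM]]; first by exists 0%N.
  have /choice[M' hM'] : forall j, exists M', forall m N, (M' <= m)%N -> (M' < N)%N ->
      `|band_average m N (ev f (y j)) - ev f (y j)| < e / 3.
    by move=> j; exact: averages_to_all.
  exists (maxn M (\max_j M' j)) => f' f'F j m N.
  rewrite geq_max gtn_max => /andP[Mm M'm] /andP[MN M'N].
  move: f'F; rewrite inE => /predU1P[->|f'F]; last exact: hM.
  apply: hM'; first exact: leq_trans (leq_bigmax j) M'm.
  exact: leq_ltn_trans (leq_bigmax j) M'N.
(* The least window that [hM] allows: lengths from [M] on, [M.+1] of them. *)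
have [n [phi [psi [h1 h2 h3 h4 hE]]]] := cuntz_factorization y p0 p1 M (ltn0Sn M).
exists n, phi, psi; split=> // f fF.
have e23 : e / 3 + e / 3 < e.
  rewrite [ltRHS](_ : e = e / 3 + e / 3 + e / 3); last by field.
  by rewrite ltrDl.
apply: le_lt_trans e23; apply: norm_le_ev => x.
have fE : \sum_j (ev (p j) x : C) *: ev f x = ev f x by rewrite -scaler_suml p1 scale1r.
rewrite evB hE -[X in _ - X]fE -sumrB.
under eq_bigr do rewrite -scalerBr.
have e230 : 0 <= e / 3 + e / 3 by rewrite addr_ge0 ?(ltW e3).
apply: convex_comb_norm_le => // j /pd dj.
rewrite -[X in X - _](subrK (ev f (y j))) -addrA.
apply: le_trans (ler_normD _ _) _; apply: lerD; first by apply: ltW; apply: hM.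
rewrite (cplx_real (normr_ge0 _)) (cplx_real (ltW e3)) cplx_le distrC; apply: le_trans (ltW dj).
rewrite /d (big_rem f)//= lerDl; apply: sumr_ge0 => g _.
by rewrite -cplx_le -(cplx_real (normr_ge0 _)); exact: normr_ge0.
Qed.

End CuntzNuclear.

(** * Separability *)

Section Separability.
Variable R : realType.
Local Notation C := (cplx R).

Definition gauss_rat (q : rat * rat) : C := Complex (ratr q.1) (ratr q.2).

Lemma gauss_rat_dense (k e : C) : 0 < e -> exists q, `|k - gauss_rat q| < e.
Proof.
move=> e0; have eE := cplx_real (ltW e0).
have e0' : 0 < complex.Re e / 2 by rewrite divr_gt0// -cplx_lt -eE.
have approx (a : R) : exists q : rat, `|a - ratr q| < complex.Re e / 2.
  have ab : a - complex.Re e / 2 < a + complex.Re e / 2.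
    by rewrite ltrD2l (lt_trans _ e0')// oppr_lt0.
  have [q] := rat_in_itvoo ab; rewrite in_itv /= => /andP[h1 h2]; exists q.
  by rewrite ltr_distlC; apply/andP; split.
have [[a Ha] [b Hb]] := (approx (complex.Re k), approx (complex.Im k)).
exists (a, b); rewrite eE.
have -> : k - gauss_rat (a, b) = Complex (complex.Re k - ratr a) (complex.Im k - ratr b).
  by case: k {Ha Hb}.
by apply: le_lt_trans (norm_cplx_le _ _) _; rewrite cplx_lt [ltRHS]splitr ltrD.
Qed.

Lemma separable_lin_span (A : cstarAlg R) (T : countType) (g : T -> A) :
  dense (lin_span (range g)) -> cs_separable A.
Proof.
move=> gd; pose F (s : seq (rat * rat * T)) : A := \sum_(x <- s) gauss_rat x.1 *: g x.2.
exists (range F); split.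
  exact: sub_countable (card_image_le F setT) (countableP setT).
apply/denseP_norm => x e e0; have e2 : 0 < e / 2 by rewrite divr_gt0.
have /denseP_norm/(_ x _ e2)[y [n [k [v [vS ->]]]] xy] := gd.
have /choice[t tv] : forall i : 'I_n, exists t, g t = v i by move=> i; have [t _ <-] := vS i; exists t.
(* [n.+1] and, below, [|v i| + 1] keep the tolerances defined when the sum is empty or some [v i]
   vanishes. *)
have n0 : 0 < (n.+1%:R : C) by rewrite ltr0n.
have /choice[q qk] : forall i : 'I_n, exists q, `|k i - gauss_rat q| < e / 2 / n.+1%:R / (`|v i| + 1).
  by move=> i; apply: gauss_rat_dense; rewrite !divr_gt0// ltr_wpDl.
exists (F [seq (q i, t i) | i <- enum 'I_n]); first by exists [seq (q i, t i) | i <- enum 'I_n].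
set z := \sum_i _ in xy.
rewrite -(subrKA z) [ltRHS]splitr; apply: le_lt_trans (ler_normD _ _) _; apply: ltr_leD => //.
rewrite /z /F big_map big_enum -sumrB /=; apply: le_trans (ler_norm_sum _ _ _) _.
apply: (@le_trans _ _ (\sum_(i < n) e / 2 / n.+1%:R)).
  apply: ler_sum => i _; rewrite tv -scalerBl normrZ.
  apply: (@le_trans _ _ (`|k i - gauss_rat (q i)| * (`|v i| + 1))).
    by rewrite ler_wpM2l// lerDl.
  by rewrite -ler_pdivlMr ?ltr_wpDl// ltW.
rewrite sumr_const card_ord -[leLHS]mulr_natr mulrAC ler_pdivrMr// ler_wpM2l ?(ltW e2)//.
by rewrite ler_nat.
Qed.

Lemma tens_cfun_dense (X : compactType) (B : cstarAlg R) (I J : Type) (b : I -> B)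
  (h : J -> cfun_cstar X (cplx_cstar R)) :
  dense (lin_span (range b)) -> dense (lin_span (range h)) ->
  dense (lin_span (range (fun p => tens_cfun (b p.1) (h p.2)))).
Proof.
move=> bd hd; set S := range _.
have spanT a k : lin_span (range b) a -> lin_span (range h) k -> lin_span S (tens_cfun a k).
  move=> [n [c [v [vS ->]]]] [m [l [w [wS ->]]]].
  rewrite (_ : tens_cfun _ _ = \sum_(i < n) \sum_(j < m) (c i * l j) *: tens_cfun (v i) (w j)).
    apply: lin_span_sum => i _; apply: lin_span_sum => j _; apply/lin_spanZ/lin_span_mem.
    by have [[i' _ <-] [j' _ <-]] := (vS i, wS j); exists (i', j').
  apply: ev_ext => x; rewrite ev_tens_cfun !ev_sum scaler_sumr; apply: eq_bigr => i _.
  rewrite ev_sum scaler_suml; apply: eq_bigr => j _.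
  have sC (r1 r2 r3 : C) (z : B) : (r1 * r3) *: (r2 *: z) = (r2 * r1) *: (r3 *: z).
    by rewrite !scalerA; congr (_ *: _); ring.
  exact: sC.
have normT a k : `|tens_cfun a k : cfun_cstar X B| <= `|k| * `|a|.
  apply: norm_le_ev => x; rewrite ev_tens_cfun normrZ.
  by apply: (@ler_wpM2r C) => //; exact: (ev_norm_le k).
have nearT a k : closure (lin_span S) (tens_cfun a k).
  apply/closureP_norm => e e0; have e2 : 0 < e / 2 by rewrite divr_gt0.
  have k1 : 0 < `|k| + 1 by rewrite ltr_wpDl.
  have /denseP_norm/(_ a _ (divr_gt0 e2 k1))[a' a'S aa'] := bd.
  have a1 : 0 < `|a'| + 1 by rewrite ltr_wpDl.
  have /denseP_norm/(_ k _ (divr_gt0 e2 a1))[k' k'S kk'] := hd.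
  exists (tens_cfun a' k'); first exact: spanT.
  have -> : tens_cfun a k - tens_cfun a' k' =
      tens_cfun (a - a') k + tens_cfun a' (k - k') :> cfun_cstar X B.
    apply: ev_ext => x; rewrite evB evD !ev_tens_cfun evB scalerBr scalerBl.
    by rewrite addrA subrK.
  apply: le_lt_trans (ler_normD _ _) _; rewrite [ltRHS]splitr; apply: ltrD.
    apply: le_lt_trans (normT _ _) _.
    apply: (@le_lt_trans _ _ ((`|k| + 1) * `|a - a'|)); first by rewrite ler_wpM2r// lerDl.
    by rewrite mulrC -ltr_pdivlMr.
  apply: le_lt_trans (normT _ _) _.
  apply: (@le_lt_trans _ _ (`|k - k'| * (`|a'| + 1))); first by rewrite ler_wpM2l// lerDl.
  by rewrite -ltr_pdivlMr.
apply/denseP_norm => f e e0; have e2 : 0 < e / 2 by rewrite divr_gt0.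
have [n [y [p [_ _ fp]]]] := cfun_approx f e2.
have : closure (lin_span S) (\sum_j tens_cfun (ev f (y j)) (p j)).
  elim/big_rec: _ => [|j x _]; last exact: closure_lin_spanD.
  by apply: subset_closure; exact: lin_span0.
move=> /closureP_norm/(_ _ e2)[z zS hz]; exists z => //.
rewrite -(subrKA (\sum_j tens_cfun (ev f (y j)) (p j))) [ltRHS]splitr.
by apply: le_lt_trans (ler_normD _ _) _; apply: ler_ltD.
Qed.

Lemma laurent_dense : dense (lin_span (range
  (fun k : nat * nat => (circz R : C_S1 R) ^+ k.1 * star (circz R) ^+ k.2))).
Proof.
set S := range _.
have mulC (f g : C_S1 R) : f * g = g * f.
  by apply: ev_ext => x; rewrite !evM; exact: (@mulrC C).
have SM x y : S x -> S y -> lin_span S (x * y).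
  move=> [[k l] _ <-] [[k' l'] _ <-]; apply: lin_span_mem; exists (k + k', l + l')%N => //=.
  by rewrite !exprD !mulrA; congr (_ * _); rewrite -!mulrA; congr (_ * _); exact: mulC.
have spanE f d : calc (circz R) f d -> lin_span S f.
  elim=> [|||f1 d1 f2 d2 _ h1 _ h2|k f1 d1 _ h1|f1 d1 f2 d2 _ h1 _ h2].
  - by apply: lin_span_mem; exists (0, 0)%N => //=; rewrite !expr0 mulr1.
  - by apply: lin_span_mem; exists (1, 0)%N => //=; rewrite expr0 expr1 mulr1.
  - by apply: lin_span_mem; exists (0, 1)%N => //=; rewrite expr0 expr1 mul1r.
  - exact: lin_spanD.
  - exact: lin_spanZ.
  - exact: lin_spanM.
apply/denseP_norm => f e e0; have [g [d [cgd fg]]] := calc_dense (circz R) f e0.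
by exists g => //; exact: spanE cgd.
Qed.

Lemma separable_circle_cuntz : cs_separable (cfun_cstar (circle R) (cuntz R)).
Proof.
have cd : dense (lin_span (range (fun w : seq bool * seq bool =>
    sw (@cgen R) w.1 * star (sw (@cgen R) w.2)))).
  rewrite [X in lin_span X](_ : _ = monomials (@cgen R)); first exact: cuntz_dense.
  by apply/seteqP; split=> x; [move=> [[v w] _ <-]; exists v, w|move=> [v [w ->]]; exists (v, w)].
exact: separable_lin_span (tens_cfun_dense cd laurent_dense).
Qed.

End Separability.

(** * The null-homotopy *)

Section Rotation.
Variables (R : realType) (A : cstarAlg R) (w : A).
Local Notation C := (cplx R).
Hypotheses (www : w * star w * w = w) (ww0 : w * w = 0).

Let p := star w * w.
Let q := w * star w.
Let r := p + q.
Let k := w - star w.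

Let ss0 : star w * star w = 0.
Proof. by rewrite -starM ww0 star0. Qed.

Let sws : star w * w * star w = star w.
Proof. by have := congr1 (@star R A) www; rewrite !starM starK mulrA. Qed.

Let rw : r * w = w.
Proof. by rewrite mulrDl -mulrA ww0 mulr0 add0r www. Qed.

Let rsw : r * star w = star w.
Proof. by rewrite mulrDl sws -mulrA ss0 mulr0 addr0. Qed.

Let wr : w * r = w.
Proof. by rewrite mulrDr !mulrA ww0 mul0r addr0 www. Qed.

Let swr : star w * r = star w.
Proof. by rewrite mulrDr !mulrA ss0 mul0r add0r sws. Qed.

Let rk : r * k = k. Proof. by rewrite mulrBr rw rsw. Qed.
Let kr : k * r = k. Proof. by rewrite mulrBl wr swr. Qed.
Let rr : r * r = r. Proof. by rewrite {1}/r mulrDl -!mulrA wr swr. Qed.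
Let kk : k * k = - r.
Proof. by rewrite mulrBl !mulrBr ww0 ss0 sub0r subr0 -opprD addrC. Qed.

(** Since [k * k = - r] and [r] is a unit for [k], the element [c *: r + s *: k] is the rotation
    with cosine [c] and sine [s] on the range of [r]; the complement [1 - r] is left fixed. *)
Definition rot (c s : C) : A := 1 + (c - 1) *: r + s *: k.

Lemma rot_mul c s : c ^+ 2 + s ^+ 2 = 1 -> rot c s * rot c (- s) = 1.
Proof.
move=> cs; pose a := c - 1.
have XY : (a *: r + s *: k) * (a *: r + (- s) *: k) = (a ^+ 2 + s ^+ 2) *: r.
  rewrite mulrDl !mulrDr -!scalerAl -!scalerAr rr rk kr kk !scalerA scalerN -scaleNr.
  rewrite [X in _ + X]addrC addrACA -!scalerDl.
  rewrite (_ : a * - s + s * a = 0) ?scale0r ?addr0; last by ring.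
  by congr (_ *: _); ring.
rewrite /rot -!addrA -/a mulrDl mul1r mulrDr mulr1 XY -addrA.
rewrite -[RHS]addr0; congr (_ + _).
have -> : a *: r + (- s) *: k + (a *: r + s *: k + (a ^+ 2 + s ^+ 2) *: r) =
    (a + a) *: r + (a ^+ 2 + s ^+ 2) *: r.
  by rewrite [LHS]addrA; congr (_ + _); rewrite addrACA -!scalerDl addNr scale0r addr0.
rewrite -scalerDl (_ : _ + _ = 0) ?scale0r//.
have -> : s ^+ 2 = 1 - c ^+ 2 by rewrite -cs addrC addKr.
by rewrite /a; ring.
Qed.

Lemma star_rot c s : 0 <= c -> 0 <= s -> star (rot c s) = rot c (- s).
Proof.
move=> c0 s0; rewrite /rot !starD star1 !starZ /k starB starK.
have -> : conjc (c - 1) = c - 1 :> C.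
  have := @starB R (cplx_cstar R) c 1; rewrite star1 => h; rewrite [LHS]h.
  by congr (_ - _); exact: conjc_ge0.
rewrite (conjc_ge0 s0) scaleNr -scalerN opprB /r starD /p /q !starM !starK.
by [].
Qed.

Lemma rot_mul' c s : c ^+ 2 + s ^+ 2 = 1 -> rot c (- s) * rot c s = 1.
Proof. by move=> cs; rewrite -{2}[s]opprK rot_mul// sqrrN. Qed.

Lemma rot10 : rot 1 0 = 1.
Proof. by rewrite /rot subrr !scale0r !addr0. Qed.

Lemma rot01_conj : rot 0 1 * p * rot 0 (- 1) = q.
Proof.
have kp : k * p = w by rewrite mulrBl /p !mulrA ss0 mul0r subr0 www.
have rp : r * p = p by rewrite mulrDl /p /q !mulrA sws -[w * _ * _]mulrA ss0 mulr0 mul0r addr0.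
have wk : w * k = - q by rewrite mulrBr ww0 sub0r.
have -> : rot 0 1 * p = w.
  by rewrite /rot sub0r scaleN1r scale1r mulrDl mulrDl mul1r mulNr rp kp subrr add0r.
by rewrite /rot sub0r !scaleN1r mulrDr mulrDr mulr1 !mulrN wr wk opprK subrr add0r.
Qed.

End Rotation.

Section Unitaries.
Variables (R : realType) (A : cstarAlg R).
Implicit Types x y : A.

Definition unitary x : Prop := star x * x = 1 /\ x * star x = 1.

Lemma unitaryM x y : unitary x -> unitary y -> unitary (x * y).
Proof.
move=> [x1 x2] [y1 y2]; split; rewrite starM -mulrA.
  by rewrite [star x * _]mulrA x1 mul1r.
by rewrite [y * _]mulrA y2 mul1r.
Qed.

Lemma unitary_star x : unitary x -> unitary (star x).
Proof. by move=> [x1 x2]; split; rewrite starK. Qed.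

End Unitaries.

(** * A central unitary cut down by projections *)

Section Bump.
Variables (R : realType) (A : cstarAlg R) (z : A).
Local Notation C := (cplx R).
Hypotheses (zC : forall x, z * x = x * z) (zu : unitary z).

Let y := z - 1.

Let yC x : y * x = x * y.
Proof. by rewrite mulrBl mulrBr zC mul1r mulr1. Qed.

Let syC x : star y * x = x * star y.
Proof. by rewrite -[x]starK -!starM yC. Qed.

Let yy : y + star y + y * star y = 0.
Proof.
case: zu => _ zz; rewrite /y starB star1 mulrBl mul1r mulrBr zz mulr1.
by rewrite -[1 - z]opprB -opprD subrr.
Qed.

(* [z] on the range of the projection [p], and [1] on its complement. *)
Definition bump (p : A) : A := 1 + y * p.

Lemma bumpM p q : p * q = 0 -> bump p * bump q = bump (p + q).
Proof.
move=> pq; rewrite /bump mulrDl mul1r mulrDr mulr1.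
rewrite [y * p * _]mulrA -[y * p * y]mulrA -(yC p) -!mulrA pq !mulr0 addr0.
by rewrite mulrDr -addrA [y * q + _]addrC.
Qed.

Lemma bump1 : bump 1 = z.
Proof. by rewrite /bump mulr1 addrC subrK. Qed.

Lemma bump_unitary p : star p = p -> p * p = p -> unitary (bump p).
Proof.
move=> sp pp; have sb : star (bump p) = 1 + star y * p.
  by rewrite /bump starD star1 starM sp syC.
(* For idempotent [p] and [b] commuting with everything, [(1 + a * p) * (1 + b * p) = 1 + (a + b + a
   * b) * p], and unitarity of [z = 1 + y] is the vanishing of that coefficient for [y] and
   [star y]. *)
have key (a b : A) : (forall x, b * x = x * b) -> a + b + a * b = 0 ->
    (1 + a * p) * (1 + b * p) = 1.
  move=> bC ab; rewrite mulrDl mul1r mulrDr mulr1 [b * p]bC.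
  rewrite -[a * p * _]mulrA [p * (p * b)]mulrA pp -bC mulrA -addrA.
  by rewrite -!mulrDl addrA [b + a]addrC ab mul0r addr0.
split; rewrite sb; apply: key => //.
by rewrite [star y + y]addrC syC.
Qed.

Lemma bump_conj a b p : a * b = 1 -> a * bump p * b = bump (a * p * b).
Proof. by move=> ab; rewrite /bump mulrDr mulr1 mulrDl ab mulrA -yC !mulrA. Qed.

Section Swap.
Variables a b : A.
Hypotheses (aa : star a * a = 1) (bb : star b * b = 1) (ab : star a * b = 0).

Let w := a * star b.

Let ba : star b * a = 0.
Proof. by rewrite -[a]starK -starM ab star0. Qed.

Let www : w * star w * w = w.
Proof. by rewrite /w starM starK -!mulrA [star a * _]mulrA aa mul1r [star b * (b * _)]mulrA bb mul1r. Qed.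

Let ww0 : w * w = 0.
Proof. by rewrite /w -mulrA [star b * _]mulrA ba mul0r mulr0. Qed.

Let pE : star w * w = b * star b.
Proof. by rewrite /w starM starK -mulrA [star a * _]mulrA aa mul1r. Qed.

Let qE : w * star w = a * star a.
Proof. by rewrite /w starM starK -mulrA [star b * _]mulrA bb mul1r. Qed.

Lemma range_proj_unitary (c : A) : star c * c = 1 -> unitary (bump (c * star c)).
Proof.
move=> cc; apply: bump_unitary; first by rewrite starM starK.
by rewrite -mulrA [star c * _]mulrA cc mul1r.
Qed.

(** The partial isometry [w] carries the range of [b] to that of [a], so a full quarter turn
    replaces [b * star b] by [a * star a] in the first half of the commutator. *)
Definition swap_path (c s : C) : A :=
  rot w c s * bump (b * star b) * rot w c (- s) * star (bump (b * star b)).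

Lemma swap_path_unitary c s : 0 <= c -> 0 <= s -> c ^+ 2 + s ^+ 2 = 1 ->
  unitary (swap_path c s).
Proof.
move=> c0 s0 cs.
have ub := range_proj_unitary bb.
have ur : unitary (rot w c s).
  by split; rewrite (star_rot w c0 s0) ?(rot_mul www ww0 cs) ?(rot_mul' www ww0 cs).
have ur' : unitary (rot w c (- s)) by rewrite -(star_rot w c0 s0); exact: unitary_star.
by apply/unitaryM; [apply/unitaryM; [exact: unitaryM|]|exact: unitary_star].
Qed.

Lemma swap_path_start : swap_path 1 0 = 1.
Proof.
by rewrite /swap_path oppr0 rot10 mul1r mulr1; case: (range_proj_unitary bb).
Qed.

Lemma swap_path_end : swap_path 0 1 = bump (a * star a) * star (bump (b * star b)).
Proof.
rewrite /swap_path bump_conj.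
  by rewrite -pE (rot01_conj www ww0) qE.
by rewrite (rot_mul www ww0)// expr0n expr1n add0r.
Qed.

Lemma swap_path_continuous (T : topologicalType) (c s : T -> C) :
  continuous (c : T -> C^o) -> continuous (s : T -> C^o) ->
  continuous (fun t => swap_path (c t) (s t)).
Proof.
move=> cc cs; have cr (d : T -> C) : continuous (d : T -> C^o) ->
    continuous (fun t => rot w (c t) (d t)).
  move=> cd t.
  have H1 : (fun t => c t - 1 : C^o) @ t --> (c t - 1 : C^o).
    by apply: cvgB; [exact: cc|exact: cvg_cst].
  exact: (cvgD (cvgD (cvg_cst _) (cvgZ H1 (cvg_cst _))) (cvgZ (cd t) (cvg_cst _))).
have cs' : continuous (fun t => - s t : C^o) by move=> t; apply: cvgN; exact: cs.
apply: mulf_continuous; last exact: cs_cst_continuous.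
apply: mulf_continuous; last exact: cr.
by apply: mulf_continuous; [exact: cr|exact: cs_cst_continuous].
Qed.

End Swap.

End Bump.

Section NullHomotopy.
Variables (R : realType) (A : cstarAlg R) (z s1 s2 : A).
Local Notation C := (cplx R).
Hypotheses (zC : forall x, z * x = x * z) (zu : unitary z).
Hypotheses (s11 : star s1 * s1 = 1) (s22 : star s2 * s2 = 1) (s12 : star s1 * s2 = 0)
  (s1s2 : s1 * star s1 + s2 * star s2 = 1).

Let s21 : star s2 * s1 = 0.
Proof. by rewrite -[s1]starK -starM s12 star0. Qed.

Let iso (a b : A) : star a * a = 1 -> star b * b = 1 -> star (a * b) * (a * b) = 1.
Proof. by move=> aa bb; rewrite starM -mulrA [star a * _]mulrA aa mul1r. Qed.

Let x := swap_path z s1 s2.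
Let y1 := swap_path z s2 (s1 * s1).
Let y2 := swap_path z s2 (s1 * s2).

(** The word imitates a K_0 computation: [e0], [e1], [e2] and [e1 + e2] are all equivalent, so [e0]
    = [e1] + [e2] = 2 [e0] and every class is zero. Only quotients [u_p u_q^*] of equivalent
    projections are connected to [1] directly, so each letter is such a quotient. *)
Definition null_path (c s : C) : A :=
  x c s * y1 c s * (x c s * y2 c s) * (x c s * y1 c s * y2 c s).

Let o21 : star s2 * (s1 * s1) = 0. Proof. by rewrite mulrA s21 mul0r. Qed.
Let o22 : star s2 * (s1 * s2) = 0. Proof. by rewrite mulrA s21 mul0r. Qed.

Lemma null_path_unitary c s : 0 <= c -> 0 <= s -> c ^+ 2 + s ^+ 2 = 1 ->
  unitary (null_path c s).
Proof.
move=> c0 s0 cs.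
have ux : unitary (x c s) by exact: swap_path_unitary.
have uy1 : unitary (y1 c s) by apply: swap_path_unitary => //; exact: iso.
have uy2 : unitary (y2 c s) by apply: swap_path_unitary => //; exact: iso.
have u1 := unitaryM ux uy1.
exact: (unitaryM (unitaryM u1 (unitaryM ux uy2)) (unitaryM u1 uy2)).
Qed.

Lemma null_path_start : null_path 1 0 = 1.
Proof. by rewrite /null_path /x /y1 /y2 !swap_path_start ?mulr1//; exact: iso. Qed.

(** As [u_(e1+e2) = u_e1 u_e2] and the [u_ei] commute, the three factors end at [u_e2], [u_e1] and
    [u_e0], and the three projections add up to [1]. *)
Lemma null_path_end : null_path 0 1 = z.
Proof.
pose e0 := s2 * star s2; pose e1 := s1 * s1 * star (s1 * s1).
pose e2 := s1 * s2 * star (s1 * s2).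
have e12 : e1 + e2 = s1 * star s1.
  rewrite /e1 /e2 !starM !mulrA -mulrDl -!mulrA -mulrDr.
  by rewrite s1s2 mulr1.
have u0 : unitary (bump z e0) by exact: range_proj_unitary.
have u1 : unitary (bump z e1) by apply: range_proj_unitary => //; exact: iso.
have u2 : unitary (bump z e2) by apply: range_proj_unitary => //; exact: iso.
have ort (a b : A) : star a * b = 0 -> a * star a * (b * star b) = 0.
  by move=> h; rewrite -mulrA [star a * _]mulrA h mul0r mulr0.
have h12 : star (s1 * s1) * (s1 * s2) = 0.
  by rewrite starM -mulrA [star s1 * (s1 * _)]mulrA s11 mul1r s12.
have h21 : star (s1 * s2) * (s1 * s1) = 0.
  by rewrite starM -mulrA [star s1 * (s1 * _)]mulrA s11 mul1r s21.
have b12 : bump z e1 * bump z e2 = bump z (s1 * star s1).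
  by rewrite bumpM ?e12// ort.
have b21 : bump z e2 * bump z e1 = bump z (s1 * star s1).
  by rewrite bumpM ?[e2 + _]addrC ?e12// ort.
have b02 : bump z e0 * bump z e2 = bump z e2 * bump z e0.
  have h20 : star (s1 * s2) * s2 = 0.
    by have := congr1 (@star R A) o22; rewrite starM starK star0.
  by rewrite (bumpM zC (ort _ _ o22)) (bumpM zC (ort _ _ h20)) addrC.
have tot : bump z e2 * bump z e1 * bump z e0 = z.
  by rewrite b21 (bumpM zC (ort _ _ s12)) s1s2 bump1.
rewrite /null_path /x /y1 /y2 !swap_path_end//; try exact: iso.
rewrite -/e0 -/e1 -/e2.
case: u0 u1 u2 => [u0 u0'] [u1 u1'] [u2 u2'].
have xy1 : bump z (s1 * star s1) * star (bump z e0) * (bump z e0 * star (bump z e1)) = bump z e2.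
  by rewrite mulrA -[_ * _ * bump z e0]mulrA u0 mulr1 -b21 -mulrA u1' mulr1.
have xy2 : bump z (s1 * star s1) * star (bump z e0) * (bump z e0 * star (bump z e2)) = bump z e1.
  by rewrite mulrA -[_ * _ * bump z e0]mulrA u0 mulr1 -b12 -mulrA u2' mulr1.
rewrite xy1 xy2.
transitivity (bump z e2 * bump z e1 * (bump z e2 * bump z e0) * star (bump z e2)).
  by rewrite !mulrA.
by rewrite -b02 -!mulrA u2' mulr1 mulrA tot.
Qed.

Lemma null_path_continuous (T : topologicalType) (c s : T -> C) :
  continuous (c : T -> C^o) -> continuous (s : T -> C^o) ->
  continuous (fun t => null_path (c t) (s t)).
Proof.
move=> cc cs.
have cx : continuous (fun t => x (c t) (s t)) by exact: swap_path_continuous.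
have cy1 : continuous (fun t => y1 (c t) (s t)) by exact: swap_path_continuous.
have cy2 : continuous (fun t => y2 (c t) (s t)) by exact: swap_path_continuous.
have c1 := mulf_continuous cx cy1.
exact: (mulf_continuous (mulf_continuous c1 (mulf_continuous cx cy2)) (mulf_continuous c1 cy2)).
Qed.

Lemma null_homotopy : exists v : cfun_cstar (itv01 R) A,
  [/\ star v * v = 1, v * star v = 1, ev v (itv01_0 R) = 1 & ev v (itv01_1 R) = z].
Proof.
(* The quarter circle is parametrised by its sine, so a square root takes the place of trigonometric
   functions. *)
pose s (t : itv01 R) : C := (\val t)%:C%C.
pose c (t : itv01 R) : C := (Num.sqrt (1 - \val t ^+ 2))%:C%C.
have vc : continuous (fun t : itv01 R => \val t : R) by exact: initial_continuous.
have c1 : continuous (fun t : itv01 R => 1 - \val t ^+ 2 : R).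
  by move=> t; exact: (@cvgB R R^o _ _ _ _ _ _ _ (cvg_cst _) (cvgM (vc t) (vc t))).
have cs : continuous (s : _ -> C^o).
  by move=> t; apply: continuous_comp; [exact: vc|exact: realC_continuous].
have cc : continuous (c : _ -> C^o).
  move=> t; apply: (@continuous_comp _ _ _ (fun t : itv01 R => Num.sqrt (1 - \val t ^+ 2))).
    apply: (@continuous_comp _ _ _ (fun t : itv01 R => 1 - \val t ^+ 2)).
      exact: c1.
    exact: (@sqrt_continuous R).
  exact: (@realC_continuous R).
have t01 (t : itv01 R) : 0 <= \val t <= 1 by have := set_mem (valP t); rewrite /= in_itv.
have c0 t : 0 <= c t by rewrite (cplx_le 0) sqrtr_ge0.
have s0 t : 0 <= s t by rewrite (cplx_le 0); case/andP: (t01 t).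
have cs1 t : c t ^+ 2 + s t ^+ 2 = 1.
  rewrite -!rmorphXn -rmorphD /= sqr_sqrtr ?subrK//.
  have /andP[h0 h1] := t01 t.
  by rewrite subr_ge0 expr_le1.
have cs01 : c (itv01_0 R) = 1 /\ s (itv01_0 R) = 0.
  by rewrite /c /s /= expr0n subr0 sqrtr1.
have cs10 : c (itv01_1 R) = 0 /\ s (itv01_1 R) = 1.
  by rewrite /c /s /= expr1n subrr sqrtr0.
exists (mkcfun (null_path_continuous cc cs)); split.
- by apply: ev_ext => t; case: (null_path_unitary (c0 t) (s0 t) (cs1 t)).
- by apply: ev_ext => t; case: (null_path_unitary (c0 t) (s0 t) (cs1 t)).
- by rewrite ev_mkcfun (proj1 cs01) (proj2 cs01) null_path_start.
- by rewrite ev_mkcfun (proj1 cs10) (proj2 cs10) null_path_end.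
Qed.

End NullHomotopy.

Theorem theorem2p6 (R : realType) :
  exists (H2 : minTensor (C_S1 R) (C_S1 R)) (Delta : C_S1 R -> H2),
    circle_comult Delta /\
    exists A : cstarAlg R,
      cs_separable A /\ nuclear A /\
      exists delta : coaction Delta A,
        free_coaction delta /\
        exists phi : C_S1 R -> cfun_cstar (itv01 R) (coAH delta),
          [/\ unital_star_hom phi,
              forall f, nc_join delta (phi f)
            & join_equivariant delta phi].
Proof.
exists (H2 R), (@Delta R); split; first exact: circle_comult_Delta.
pose B := cuntz R; have eB : enough_states B := @enough_states_cuntz R.
exists (cfun_cstar (circle R) B); split; first exact: separable_circle_cuntz.
split.
  apply: (cuntz_nuclear (@cgen_inner R) (@cgen_sum R) (@cuntz_dense R) eB (@state_base R) _
    (@base_state_sw R)).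
  by move=> x; rewrite /base_state /vector_state -[RHS]ipC -bop_adjP'.
exists (translation eB); split; first exact: translation_free.
pose z : cfun_cstar (circle R) B := tens_cfun 1 (circz R).
have evz g : ev z g = (\val g : cplx R) *: 1 by [].
have zC x : z * x = x * z.
  by apply: ev_ext => g; rewrite !evM evz -scalerAl -scalerAr mul1r mulr1.
have zu : unitary z.
  have [_ zM z1 zs] := @tens_cfun1_hom R (circle R) B.
  by split; rewrite -zs -zM ?circz_unitary ?circz_unitary' z1.
(* The generators of O_2, as constant functions, satisfy the same relations in [A], where [z] is
   central; the null-homotopy is therefore formed in [A] itself. *)
have cs i j : star (cstf (circle R) (@cgen R i)) * cstf (circle R) (@cgen R j) = (i == j)%:R.
  by apply: ev_ext => g; rewrite evM ev_star !ev_mkcfun cgen_inner; case: (i == j).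
have ss : cstf (circle R) (@cgen R false) * star (cstf (circle R) (@cgen R false)) +
    cstf (circle R) (@cgen R true) * star (cstf (circle R) (@cgen R true)) = 1.
  by apply: ev_ext => g; exact: cgen_sum.
have [v [vv vv' v0 v1]] := null_homotopy zC zu (cs false false) (cs true true) (cs false true) ss.
exists (join_hom eB vv vv'); split; first exact: fcalc_hom.
- exact: join_hom_join.
- exact: join_hom_equivariant.
Qed.
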